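(* Let $\mathfrak g=\mathfrak{gl}(V)$, $\dim V=N$, let $\boldsymbol\lambda=(\lambda_1\geqslant\dots\geqslant\lambda_\delta)$ be a partition of $N$, let $\Phi:\{1,\dots,\delta\}\to\{a,b\}$ be a function and let $(\mathfrak g,\mathfrak k,\mathfrak p)=(\mathfrak g,\mathfrak k^\Phi,\mathfrak p^\Phi)$ be the associated symmetric Lie algebra of type AIII. Let $e\in\mathfrak p$ be the associated nilpotent element of Jordan type $\boldsymbol\lambda$, $S_G$ the $G$-sheet containing $e$, $(e,h,f)$ the associated $\mathfrak{sl}_2$-triple, $e+X=S_G\cap(e+\mathfrak g^f)$, $X_{\mathfrak p}=X\cap\mathfrak p$, and let $\varepsilon$, $\mathfrak t$ and $m_i(t,c)$ be as defined in the context. Let $t\in\mathfrak t$, and consider the condition $$(\ast)\qquad m_i(t,c)=m_i(t,-c)\quad\text{for all } c\in\mathbb K \text{ and all } i\in\{1,\dots,\delta\}.$$ (i) If $t$ satisfies $(\ast)$, then $\varepsilon(e+t)\in e+X_{\mathfrak p}$. (ii) One has $G.(e+t)\cap\mathfrak p\neq\emptyset$ if and only if $t$ satisfies $(\ast)$. (iii) $G.(S_G\cap\mathfrak p)=G.(e+X_{\mathfrak p})$.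
   Context: $\mathbb K$ is an algebraically closed field of characteristic zero; $G$ is the adjoint group of $\mathfrak g=\mathfrak{gl}(V)$ (the image of $\mathrm{GL}(V)$ acting by conjugation). A $G$-sheet is an irreducible component of some $\{x\in\mathfrak g:\dim G.x=m\}$; in $\mathfrak{gl}(V)$ each nilpotent element lies in exactly one $G$-sheet. Fix a basis $\{v^{(i)}_j: 1\le i\le\delta,\ 1\le j\le\lambda_i\}$ of $V$. Put $e.v^{(i)}_j=v^{(i)}_{j-1}$ for $j\ge2$ and $e.v^{(i)}_1=0$. Let $V_i=\langle v^{(i)}_j\rangle_j$, and $\mathfrak q_i=\mathfrak{gl}(V_i)\subset\mathfrak g$ (extended by $0$), $e=\sum_i e_i$ with $e_i\in\mathfrak q_i$; for each $i$, $(e_i,h_i,f_i)$ is the standard $\mathfrak{sl}_2$-triple in $\mathfrak q_i$ with $h_i=\mathrm{diag}(\lambda_i-1,\lambda_i-3,\dots,-\lambda_i+1)$ in the basis $(v_1^{(i)},\dots,v_{\lambda_i}^{(i)})$, and $h=\sum h_i$, $f=\sum f_i$. $\mathfrak h$ is the algebra of diagonal matrices in the basis $(v_j^{(i)})$; for $t\in\mathfrak h$ write $t.v_j^{(i)}=t_{i,j}v_j^{(i)}$. Let $\mathfrak t=\{t\in\mathfrak h: t_{i,j}=t_{i',j}\text{ for all } i\le i',\ 1\le j\le\lambda_{i'}\}$. For $t\in\mathfrak h$, $c\in\mathbb K$, $m_i(t,c)=\#\{j\in\{1,\dots,\lambda_i\}:t_{i,j}=c\}$. Symmetric pair: $V_a$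 is spanned by the $v^{(i)}_j$ with ($\Phi(i)=a$ and $\lambda_i-j$ even) or ($\Phi(i)=b$ and $\lambda_i-j$ odd); $V_b$ by the $v^{(i)}_j$ with ($\Phi(i)=b$ and $\lambda_i-j$ even) or ($\Phi(i)=a$ and $\lambda_i-j$ odd). $\mathfrak k^\Phi=\mathfrak{gl}(V_a)\oplus\mathfrak{gl}(V_b)$, $\mathfrak p^\Phi=\mathrm{Hom}(V_a,V_b)\oplus\mathrm{Hom}(V_b,V_a)$. The map $\varepsilon:e+\mathfrak h\to e+\mathfrak g^f$ ($\mathfrak g^f$ = centralizer of $f$): let $\mathfrak g(k)=\{x:[h,x]=kx\}$. For $i\le1$ one has $\mathfrak g(2i-2)=[e,\mathfrak g(2i-4)]\oplus(\mathfrak g^f\cap\mathfrak g(2i-2))$; let $\mathrm{pr}_1$ be the projection onto the first summand and $\eta_{2i-2}:\mathfrak g(2i-2)\to\mathfrak g(2i-4)$ the linear map $(\mathrm{ad}\,e)^{-1}\circ\mathrm{pr}_1$ ($\mathrm{ad}\,e$ being injective on $\mathfrak g(2i-4)$). For $e+z\in e+\bigoplus_{j\le0}\mathfrak g(2j)$ with component $w_{2i-2}$ of $z$ in $\mathfrak g(2i-2)$, set $\epsilon_i(e+z)=\exp(\mathrm{ad}\,\eta_{2i-2}(w_{2i-2}))(e+z)$. Then $\varepsilon$ is the restriction to $e+\mathfrak h$ of $\epsilon_{-k}\circ\cdots\circ\epsilon_0\circ\epsilon_1$ for $k$ large. It maps $e+\mathfrak t$ into $e+X$. *)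

(* Defs.v *)
From mathcomp Require Import all_boot all_order all_algebra.
From mathcomp Require Import boolp classical_sets.
From mathcomp Require Import mpoly.

Set Implicit Arguments.
Unset Strict Implicit.
Unset Printing Implicit Defensive.

Import GRing.Theory.
Local Open Scope classical_set_scope.
Local Open Scope ring_scope.

Section LieAlgebra.
Context {K : fieldType} {n : nat}.
Implicit Types (x y z u : 'M[K]_n) (Y Z S C : set 'M[K]_n).

Definition lie x y := x *m y - y *m x.

Definition centralizer z : set 'M[K]_n := [set x | lie z x = 0].

(* exp (ad u) for nilpotent u: then u ^ n = 0, so (ad u) ^ (2 n - 1) = 0 and the
   exponential series stops before its term of index 2 n. *)
Definition exp_ad u y := \sum_(k < n.*2) (k`!)%:R^-1 *: iter k (lie u) y.

(* The G-saturation G.Y, where G is the image of GL_n acting by conjugation. *)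
Definition Gsat Y : set 'M[K]_n :=
  [set z | exists2 g, g \in unitmx & exists2 y, Y y & z = g *m y *m invmx g].

Definition Gorbit x : set 'M[K]_n := Gsat [set x].

(* Polynomial functions on the affine space 'M_n are polynomials in the n * n
   entries, listed by mxvec. *)
Definition evalm x (P : {mpoly K[n * n]}) : K := P.@[fun i => mxvec x 0 i].

Definition zariski_closed Z :=
  exists I : set {mpoly K[n * n]}, Z = [set x | forall P, I P -> evalm x P = 0].

(* Irreducibility of Y for the topology induced by the Zariski topology. *)
Definition irreducible Y :=
  Y !=set0 /\
  forall Z1 Z2, zariski_closed Z1 -> zariski_closed Z2 ->
    Y `<=` Z1 `|` Z2 -> Y `<=` Z1 \/ Y `<=` Z2.

Definition irreducible_component Y C :=
  [/\ C `<=` Y, irreducible C &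
      forall C', C' `<=` Y -> irreducible C' -> C `<=` C' -> C' = C].

(* Algebraic independence over K of the restrictions to Y of the polynomial
   functions F 0, ..., F (d - 1). *)
Definition alg_independent Y d (F : 'I_d -> {mpoly K[n * n]}) :=
  forall P : {mpoly K[d]},
    (forall y, Y y -> P.@[fun i => evalm y (F i)] = 0) -> P = 0.

(* dim Y = d for a nonempty Y: the dimension of a variety is the transcendence
   degree of its ring of regular functions, i.e. the largest number of
   algebraically independent ones (for irreducible Y, the transcendence degree of
   its function field). *)
Definition has_dim Y d :=
  (exists F : 'I_d -> {mpoly K[n * n]}, alg_independent Y F) /\
  (forall d' (F : 'I_d' -> {mpoly K[n * n]}), alg_independent Y F -> (d' <= d)%N).

Definition is_Gsheet S :=
  exists m, irreducible_component [set x | has_dim (Gorbit x) m] S.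

End LieAlgebra.

Definition is_partition delta (lam : 'I_delta -> nat) :=
  (forall i, 0 < lam i)%N /\ (forall i i' : 'I_delta, i <= i' -> lam i' <= lam i)%N.

Inductive side := side_a | side_b.

(* V is K^N (column vectors), N = \sum_i lam i. Its standard basis is the basis
   v^(i)_j: the vector v^(i)_(j+1), for i : 'I_delta and j : 'I_(lam i), is the
   standard basis vector of index tagnat.Rank i j; conversely, the p-th standard
   basis vector is v^(i)_(j+1) for i = tagnat.sig1 p and j = tagnat.sig2 p. *)
Section JordanBasis.
Context {K : fieldType} {delta : nat} (lam : 'I_delta -> nat).
Local Notation N := (\sum_(i < delta) lam i)%N.
Implicit Types (p q : 'I_N) (x y t u w : 'M[K]_N).

Definition blk p : 'I_delta := tagnat.sig1 p.

(* The one-based index j of the basis vector v^(i)_j. *)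
Definition pos p : nat := (tagnat.sig2 p).+1.

Definition e_mx : 'M[K]_N :=
  \matrix_(p, q) ((blk p == blk q) && ((pos p).+1 == pos q))%:R.

Definition h_mx : 'M[K]_N :=
  diag_mx (\row_p ((lam (blk p))%:R + 1 - ((pos p).*2)%:R)).

(* f . v_j = j (lam_i - j) v_(j+1) *)
Definition f_mx : 'M[K]_N :=
  \matrix_(p, q) (if (blk p == blk q) && (pos p == (pos q).+1)
                  then (pos q * (lam (blk q) - pos q))%:R else 0).

Definition diag_entry t i (j : 'I_(lam i)) : K :=
  t (tagnat.Rank i j) (tagnat.Rank i j).

Definition t_space : set 'M[K]_N :=
  [set t | is_diag_mx t /\
     forall (i i' : 'I_delta) (j : 'I_(lam i)) (j' : 'I_(lam i')),
       (i <= i')%N -> j = j' :> nat -> diag_entry t j = diag_entry t j'].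

Definition mult t i (c : K) : nat := #|[set j : 'I_(lam i) | diag_entry t j == c]%SET|.

Section SymmetricPair.
Variable Phi : 'I_delta -> side.

Definition in_a p : bool :=
  match Phi (blk p) with
  | side_a => ~~ odd (lam (blk p) - pos p)
  | side_b => odd (lam (blk p) - pos p)
  end.

Definition in_b p : bool :=
  match Phi (blk p) with
  | side_b => ~~ odd (lam (blk p) - pos p)
  | side_a => odd (lam (blk p) - pos p)
  end.

Definition V_a : set 'cV[K]_N := [set v : 'cV[K]_N | forall p, ~~ in_a p -> v p 0 = 0].
Definition V_b : set 'cV[K]_N := [set v : 'cV[K]_N | forall p, ~~ in_b p -> v p 0 = 0].

Definition p_space : set 'M[K]_N :=
  [set x | (forall v : 'cV[K]_N, V_a v -> V_b (x *m v)) /\ (forall v : 'cV[K]_N, V_b v -> V_a (x *m v))].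

End SymmetricPair.

(* e + g^f *)
Definition slodowy_slice : set 'M[K]_N := [set y : 'M[K]_N | centralizer f_mx (y - e_mx)].

Section Slice.
Variables (S : set 'M[K]_N) (Phi : 'I_delta -> side).

(* e + X = S `&` (e + g^f) *)
Definition X_space : set 'M[K]_N := [set x : 'M[K]_N | (S `&` slodowy_slice) (e_mx + x)].

Definition Xp_space : set 'M[K]_N := X_space `&` p_space Phi.

Definition e_plus_Xp : set 'M[K]_N := [set e_mx + x | x in Xp_space].

End Slice.

Definition gr (k : int) : set 'M[K]_N := [set x | lie h_mx x = k%:~R *: x].

(* The component in g(k): [h, x] has (p, q) entry (h_pp - h_qq) x_pq, and the
   weights are integers, K being of characteristic 0. *)
Definition gr_comp (k : int) x : 'M[K]_N :=
  \matrix_(p, q) (if h_mx p p - h_mx q q == k%:~R then x p q else 0).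

(* eta_(2 i - 2) (w): the unique u in g(2 i - 4) such that [e, u] is the first
   component of w in g(2 i - 2) = [e, g(2 i - 4)] (+) (g^f /\ g(2 i - 2)), i <= 1. *)
Definition eta (i : int) w : 'M[K]_N :=
  xget 0 [set u | gr (2 * i - 4) u /\
    exists2 v, (centralizer f_mx `&` gr (2 * i - 2)) v & w = lie e_mx u + v].

Definition eps_step (i : int) y : 'M[K]_N :=
  exp_ad (eta i (gr_comp (2 * i - 2) (y - e_mx))) y.

(* eps_comp m is the composite of the m maps eps_step (2 - m), ..., eps_step 0,
   eps_step 1, where eps_step 1 is applied first. *)
Fixpoint eps_comp (m : nat) y : 'M[K]_N :=
  if m is m'.+1 then eps_step (1 - m'%:Z) (eps_comp m' y) else y.

(* All i >= - N are used; eps_step i fixes e + \bigoplus_(j <= 0) g(2 j) pointwise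
   for i < - N, since then g(2 i - 2) = 0. *)
Definition varepsilon : 'M[K]_N -> 'M[K]_N := eps_comp N.+2.

End JordanBasis.

(* Main.v *)
Require Import Defs.
From HB Require Import structures.
From mathcomp Require Import all_boot all_order all_algebra.
From mathcomp Require Import boolp classical_sets mpoly.
From mathcomp Require Import zify ring.

Set Implicit Arguments.
Unset Strict Implicit.
Unset Printing Implicit Defensive.

Import GRing.Theory.
Local Open Scope classical_set_scope.
Local Open Scope ring_scope.

(** Why the proposition holds.

Fix t in the space t. By definition t_(i,j) depends on j only; call it tau_j and put
P_k = (X - tau_1) ... (X - tau_k). For x = e + t acting on row vectors, the j-th basis
vector of block i is g_i P_(j-1)(x), where g_i is the first one, and g_i P_(lam_i)(x) = 0.
So K^N is the direct sum of the cyclic modules K[X]/(P_(lam_i)), and since these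
polynomials divide one another, x is in Frobenius normal form with invariant factors of
degrees lam. Every matrix has such a form for exactly one partition, its type
[frobenius_form]; hence G.(e + t), with t running through the space t, is the set of all
matrices of type lam.

The sheet. The dimension of G.x is the rank of ad x [has_dim_Gorbit], and for x of type nu
it is N^2 - sum_(i,j) min(nu_i, nu_j) [rank_ad_tau_mx], which depends only on the sum of
all the partial sums nu_1 + ... + nu_k [sum_min]. Each of these partial sums is the largest
dimension of an x-stable subspace generated by k vectors, which makes it lower
semicontinuous in x [rank_cyc_open]. In an irreducible set that contains e and x and has
constant orbit dimension, some point has partial sums at least as large as those of e and
of x; since the totals agree, all partial sums agree and x has type lam. Conversely
G.(e + t) is irreducible, because two points of it are joined by a rational curve
[irreducible_Gsat], and its orbits have constant dimension. So S_G = G.(e + t) [sheet_eq].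

The slice. The map eta exists because ad f o ad e is injective on negative weights, by
sl_2-theory. Each step of varepsilon conjugates by the exponential of a block diagonal
element of negative degree and moves one more graded component into g^f, so
y = varepsilon (e + t) lies in e + g^f and is conjugate to e + t block by block
[varepsilon_slice]. Under the symmetry condition on multiplicities the traces on each block
of the odd powers of e + t, hence of y, vanish. If the even part of y - e had a leading
component z of degree -j, with j even, it would contribute (j + 1) tr (e^j z) to the trace
of y^(j+1); this is nonzero because z commutes with f, so that the diagonal of e^j z is
proportional to positive products of binomial coefficients [lie_f_trace0]. Hence y - e has
only odd components [slice_odd_of_traces], and these lie in p whatever Phi is. This is
assertion (i) and, as y is conjugate to e + t, half of (ii).

The converse in (ii). If y in p is conjugate to e + t, then y is conjugate to - y by the
involution defining p, so e + t is conjugate to e - t. The invariant factors of the two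
agree [conj_prefix_poly], which says that block i has the same number of entries c and - c.

Assertion (iii) combines these: a point of S_G in p is conjugate to some e + t, which
satisfies the symmetry condition by (ii), so it is conjugate to varepsilon (e + t). *)

(** * Lie brackets and exponentials of nilpotent matrices *)

Section LieBracket.
Context {K : fieldType} {n : nat}.
Implicit Types (x y z u w : 'M[K]_n).

Lemma lieDr x y z : lie x (y + z) = lie x y + lie x z.
Proof. by rewrite /lie mulmxDr mulmxDl opprD addrACA. Qed.

Lemma lieZr a x y : lie x (a *: y) = a *: lie x y.
Proof. by rewrite /lie -scalemxAr -scalemxAl scalerBr. Qed.

Lemma lieZl a x y : lie (a *: x) y = a *: lie x y.
Proof. by rewrite /lie -scalemxAr -scalemxAl scalerBr. Qed.

Lemma lieNr x y : lie x (- y) = - lie x y.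
Proof. by rewrite -scaleN1r lieZr scaleN1r. Qed.

Lemma lieNl x y : lie (- x) y = - lie x y.
Proof. by rewrite -scaleN1r lieZl scaleN1r. Qed.

Lemma lieBr x y z : lie x (y - z) = lie x y - lie x z.
Proof. by rewrite lieDr lieNr. Qed.

Lemma lie0r x : lie x 0 = 0.
Proof. by rewrite /lie mulmx0 mul0mx subr0. Qed.

Lemma lieC x y : lie x y = - lie y x.
Proof. by rewrite /lie opprB. Qed.

Lemma lie_jacobi x y z : lie x (lie y z) = lie (lie x y) z + lie y (lie x z).
Proof.
rewrite /lie !mulmxBl !mulmxBr !mulmxA.
move: (x *m y *m z) (x *m z *m y) (y *m x *m z) (y *m z *m x) (z *m x *m y).
by move=> a b c d f; move: (z *m y *m x) => g; apply/matrixP=> i j; rewrite !mxE; ring.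
Qed.

(** ad u is the difference of left and right multiplication by u, which commute, so the
binomial formula applies to its powers. *)
Lemma iter_lie_expand u y k :
  iter k (lie u) y
  = \sum_(i < k.+1) (u ^+ (k - i) *m y *m (- u) ^+ i) *+ 'C(k, i).
Proof.
pose L : 'M[K]_(n * n) := lin_mulmx u.
pose R : 'M[K]_(n * n) := lin_mulmxr (- u).
have LE a z : mxvec z *m L ^+ a = mxvec (u ^+ a *m z).
  elim: a => [|a IH]; first by rewrite mulmx1 mul1mx.
  by rewrite exprSr mulmxA IH mul_vec_lin /= mulmxA -[_ *m u ^+ a]exprS.
have RE a z : mxvec z *m R ^+ a = mxvec (z *m (- u) ^+ a).
  elim: a => [|a IH]; first by rewrite !mulmx1.
  by rewrite exprSr mulmxA IH mul_vec_lin /= -mulmxA -[_ *m (- u)]exprSr.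
have cLR : GRing.comm L R.
  apply/matrixP=> i j; apply/eqP; rewrite -subr_eq0; apply/eqP.
  have -> : (L * R) i j - (R * L) i j = (delta_mx 0 i *m (L * R - R * L) : 'rV_(n * n)) 0 j.
    by rewrite -rowE !mxE.
  rewrite -[delta_mx 0 i]vec_mxK mulmxBr !mulmxA.
  by rewrite -[L]expr1 -[R]expr1 !(LE, RE) !expr1 !mulmxA subrr mxE.
have iterE : mxvec (iter k (lie u) y) = mxvec y *m (L + R) ^+ k.
  elim: k => [|k IH]; first by rewrite mulmx1.
  rewrite iterS exprSr mulmxA -IH mulmxDr !mul_vec_lin /= -linearD /=.
  by rewrite mulmxN.
apply: (can_inj mxvecK); rewrite iterE exprDn_comm // mulmx_sumr linear_sum.
apply: eq_bigr => i _.
by rewrite -!scaler_nat -scalemxAr linearZ /= mulmxA LE RE.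
Qed.

Lemma invmxM x y : x \in unitmx -> y \in unitmx ->
  invmx (x *m y) = invmx y *m invmx x.
Proof.
move=> xU yU; have xyU : x *m y \in unitmx by rewrite unitmx_mul xU yU.
by rewrite -[RHS](mulKmx xyU) !mulmxA !mulmxK.
Qed.

Lemma conj_expr g x k : g \in unitmx ->
  (g *m x *m invmx g) ^+ k = g *m x ^+ k *m invmx g.
Proof.
move=> gU; elim: k => [|k IH]; first by rewrite mulmx1 mulmxV.
by rewrite !exprS IH -![_ * _]/(_ *m _) !mulmxA mulmxKV.
Qed.

Definition expmx u := \sum_(k < n) (k`!)%:R^-1 *: u ^+ k.

Hypothesis charK0 : [pchar K] =i pred0.

Lemma natr_neq0 k : (0 < k)%N -> (k%:R : K) != 0.
Proof. by move=> k0; rewrite (pcharf0P K).1 -?lt0n. Qed.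

(** Both sides are sums of u^a/a! y (-u)^b/b!; the terms with a or b at least n vanish, and
the bound 2 n of the exponential series leaves room for all the others. *)
Lemma exp_ad_conj u y : u ^+ n = 0 -> exp_ad u y = expmx u *m y *m expmx (- u).
Proof.
move=> un0.
have up k : (n <= k)%N -> u ^+ k = 0.
  by move=> /subnK <-; rewrite exprD un0 mulr0.
have Nup k : (n <= k)%N -> (- u) ^+ k = 0.
  by move=> nk; rewrite exprNn up // mulr0.
pose F a b := (a`!%:R^-1 *: u ^+ a) *m y *m (b`!%:R^-1 *: (- u) ^+ b).
have F0 a b : (n <= a)%N || (n <= b)%N -> F a b = 0.
  by rewrite /F => /orP[/up ->|/Nup ->]; rewrite scaler0 ?mulmx0 ?mul0mx.
have -> : expmx u *m y *m expmx (- u) = \sum_(a < n) \sum_(b < n) F a b.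
  rewrite /expmx mulmx_suml mulmx_suml; apply: eq_bigr => a _.
  by rewrite mulmx_sumr.
transitivity (\sum_(0 <= k < n.*2) \sum_(0 <= b < n.*2 | (b <= k)%N) F (k - b)%N b).
  rewrite /exp_ad big_mkord; apply: eq_bigr => k _; rewrite iter_lie_expand scaler_sumr.
  rewrite -(big_mkord predT (fun b => k`!%:R^-1 *: ((u ^+ (k - b) *m y *m (- u) ^+ b) *+ 'C(k, b)))).
  rewrite (big_nat_widen 0 k.+1 n.*2) //.
  apply: congr_big_nat => // b /= /andP[bk _]; rewrite ltnS in bk.
  rewrite -scaler_nat scalerA /F -!scalemxAl -scalemxAr scalerA; congr (_ *: _).
  rewrite -(bin_fact bk) natrM natrM invfM mulrC mulrA invfM mulrAC.
  by rewrite mulrAC mulfV ?mul1r 1?mulrC // natr_neq0 ?bin_gt0.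
rewrite (exchange_big_dep_nat predT) //= (big_cat_nat _ (n := n)) //=; last by lia.
rewrite [X in _ + X]big_nat_cond [X in _ + X]big1 ?addr0; last first.
  move=> b /andP[/andP[nb _] _]; apply: big1 => k _; apply: F0; lia.
rewrite [RHS]exchange_big /= big_mkord; apply: eq_bigr => b _.
have bn : (b < n)%N := ltn_ord b.
rewrite (big_cat_nat _ (n := b)) /=; [|lia|lia].
rewrite big_nat_cond big1 ?add0r => [|k /andP[/andP[_ kb] bk]]; last by lia.
rewrite big_nat_cond (eq_bigl (fun k => (b <= k < n.*2)%N)); last first.
  by move=> k; case: (b <= k)%N; rewrite ?andbT ?andbF.
rewrite -big_nat -{1}[b : nat]add0n big_addn.
under eq_bigr do rewrite addnK.
rewrite (big_cat_nat _ (n := n)) /=; [|lia|lia].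
rewrite [X in _ + X]big_nat_cond [X in _ + X]big1 ?addr0 ?big_mkord //.
by move=> k /andP[/andP[nk _] _]; apply: F0; rewrite nk.
Qed.

(** Taking y = 1 in [exp_ad_conj] gives exp u exp (- u) = 1, as ad u kills 1. *)
Lemma expmx_unit u : u ^+ n = 0 -> expmx u \in unitmx /\ invmx (expmx u) = expmx (- u).
Proof.
move=> un0; have E1 : expmx u *m expmx (- u) = 1%:M.
  rewrite -[expmx u]mulmx1 -exp_ad_conj // /exp_ad.
  case: (posnP n) => [n0 | n_gt0].
    by apply/matrixP=> i; have := ltn_ord i; lia.
  have /prednK <- : (0 < n.*2)%N by lia.
  rewrite big_ord_recl /= fact0 invr1 scale1r big1 ?addr0 // => i _.
  rewrite -iterS iterSr [lie u 1%:M](_ : _ = 0); last by rewrite /lie mulmx1 mul1mx subrr.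
  suff -> a : iter a (lie u) 0 = 0 by rewrite scaler0.
  by elim: a => //= a ->; rewrite lie0r.
have [uU _] := mulmx1_unit E1; split=> //.
by rewrite -[RHS](mulKmx uU) E1 mulmx1.
Qed.

(** If f^(a+1).u = 0 then 0 = e.f^(a+1).u = (a + 1)(k - a) f^a.u, because e.u is killed by f
and e f^(a+1) - f^(a+1) e = (a + 1) f^a (h - a). As k - a never vanishes, the power of f
can be lowered until it reaches u itself. *)
Lemma sl2_neg_weight e f h u (k : K) m :
  lie e f = h -> lie h f = - (2%:R *: f) -> lie h u = k *: u ->
  (forall a : nat, k - a%:R != 0) -> lie f (lie e u) = 0 ->
  iter m (lie f) u = 0 -> u = 0.
Proof.
move=> ef hf hu kP fe0.
have hfu a : lie h (iter a (lie f) u) = (k - (a.*2)%:R) *: iter a (lie f) u.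
  elim: a => [|a IH]; first by rewrite subr0.
  rewrite iterS lie_jacobi IH hf lieNl lieZl lieZr -scaleNr -scalerDl.
  by congr (_ *: _); rewrite doubleS -addn2 natrD; ring.
have efu a : lie e (iter a.+1 (lie f) u)
    = (a.+1%:R * (k - a%:R)) *: iter a (lie f) u.
  elim: a => [|a IH].
    by rewrite iterS lie_jacobi ef hu fe0 addr0 subr0 mul1r.
  rewrite iterS lie_jacobi ef IH hfu lieZr -iterS -scalerDl.
  by congr (_ *: _); rewrite -muln2 natrM -!natr1; ring.
elim: m => [//|m IH] fm0; apply: IH; apply/eqP.
have /eqP := efu m; rewrite fm0 lie0r eq_sym scaler_eq0 mulf_eq0.
by rewrite (negPf (natr_neq0 _)) // (negPf (kP _)).
Qed.

End LieBracket.

(** * The Jordan basis and its sl_2-triple *)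

(** The dimension argument that gives the existence of eta from its uniqueness. *)
Lemma linear_inj_surj (K : fieldType) n (T : 'M[K]_n -> 'M[K]_n) :
  linear T -> (forall x, T x = 0 -> x = 0) -> forall y, exists x, T x = y.
Proof.
move=> Tlin Tinj y.
pose Tl : {linear 'M[K]_n -> 'M[K]_n} :=
  HB.pack T (GRing.isLinear.Build _ _ _ _ T Tlin).
have Tu : lin_mx Tl \in unitmx.
  rewrite -row_free_unit; apply/inj_row_free => v.
  rewrite -[v]vec_mxK mul_vec_lin /= => /eqP; rewrite mxvec_eq0 => /eqP/Tinj->.
  by rewrite linear0.
exists (vec_mx (mxvec y *m invmx (lin_mx Tl))).
apply: (can_inj mxvecK); rewrite -[T _]/(Tl _) -mul_vec_lin vec_mxK.
by rewrite -mulmxA mulVmx ?mulmx1.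
Qed.

Section JordanBasisIndices.
Context {K : fieldType} {delta : nat} (lam : 'I_delta -> nat).
Hypothesis charK0 : [pchar K] =i pred0.
Local Notation N := (\sum_(i < delta) lam i)%N.
Implicit Types (p q r : 'I_N) (x y t u v w : 'M[K]_N).
Local Notation e := (e_mx lam : 'M[K]_N).
Local Notation h := (h_mx lam : 'M[K]_N).
Local Notation f := (f_mx lam : 'M[K]_N).

Lemma pos_gt0 p : (0 < pos p)%N. Proof. by []. Qed.

Lemma pos_le p : (pos p <= lam (blk p))%N.
Proof. exact: (ltn_ord (tagnat.sig2 p)). Qed.

Lemma pos_inj p q : blk p = blk q -> pos p = pos q -> p = q.
Proof.
move=> bE [pE]; apply: val_inj; apply/eqP.
by rewrite -[p]tagnat.sig2K -[q]tagnat.sig2K tagnat.eq_Rank pE eqxx andbT; apply/eqP.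
Qed.

Lemma eq_idx p q : (p == q) = (blk p == blk q) && (pos p == pos q).
Proof.
apply/eqP/andP=> [->|[/eqP b /eqP s]]; first by rewrite !eqxx.
exact: pos_inj.
Qed.

Lemma idx_exists i k : (0 < k <= lam i)%N -> exists2 p : 'I_N, blk p = i & pos p = k.
Proof.
case: k => // k /= kl; exists (tagnat.Rank i (Ordinal kl)).
  exact: tagnat.Rank1K.
by rewrite /pos tagnat.Rank2K.
Qed.

Lemma lam_le_N i : (lam i <= N)%N.
Proof. by rewrite (bigD1 i) //= leq_addr. Qed.

Lemma intr_pchar0_inj (a b : int) : a%:~R = b%:~R :> K -> a = b.
Proof.
move=> /eqP; rewrite -subr_eq0 -intrB; case: (a - b) (subrK b a) => [[|k]|k] <- //.
  by rewrite add0r.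
- by rewrite -pmulrn (negPf (natr_neq0 _ _)).
by rewrite NegzE intrN oppr_eq0 -pmulrn (negPf (natr_neq0 _ _)).
Qed.

(** The eigenvalue of ad h on the matrix unit with entry (p, q). *)
Definition wt p q : K := h p p - h q q.

Lemma wt_blk p q : blk p = blk q ->
  wt p q = ((2 * ((pos q)%:Z - (pos p)%:Z)) : int)%:~R.
Proof.
move=> b; rewrite /wt !mxE !eqxx !mulr1n b intrM intrB -!pmulrn -!muln2 !natrM.
ring.
Qed.

Lemma lie_h x p q : lie h x p q = wt p q * x p q.
Proof.
rewrite /lie /h_mx [LHS]mxE mul_diag_mx [X in _ + X]mxE mul_mx_diag.
by rewrite /wt !mxE !eqxx !mulr1n; ring.
Qed.

Variant succ_spec p : Prop :=
  | HasSucc p' of blk p' = blk p & pos p' = (pos p).+1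
  | NoSucc of pos p = lam (blk p).

Lemma idx_succP p : succ_spec p.
Proof.
have := pos_le p; rewrite leq_eqVlt => /orP[/eqP|] hp; first exact: NoSucc.
have [p' bp' sp'] := @idx_exists (blk p) (pos p).+1 hp.
exact: HasSucc bp' sp'.
Qed.

Variant pred_spec p : Prop :=
  | HasPred p' of blk p' = blk p & pos p = (pos p').+1
  | NoPred of pos p = 1%N.

Lemma idx_predP p : pred_spec p.
Proof.
move: (pos_gt0 p) (pos_le p); case E : (pos p) => [|[|k]] // _ hp; first exact: NoPred.
have [|p' bp' sp'] := @idx_exists (blk p) k.+1; first exact: ltnW.
by apply: HasPred bp' _; rewrite E sp'.
Qed.

Lemma e_entry p q : e p q = ((blk p == blk q) && ((pos p).+1 == pos q))%:R.
Proof. by rewrite mxE. Qed.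

Lemma f_entry p q : f p q = (if (blk p == blk q) && (pos p == (pos q).+1)
                  then (pos q * (lam (blk q) - pos q))%:R else 0).
Proof. by rewrite mxE. Qed.

Lemma e_mul x p p' q : blk p' = blk p -> pos p' = (pos p).+1 ->
  (e *m x) p q = x p' q.
Proof.
move=> b s; rewrite mxE (bigD1 p') //= [X in _ + X]big1 => [|r rp].
  by rewrite mxE b s !eqxx mul1r addr0.
by rewrite mxE -s -b eq_sym [pos p' == _]eq_sym -eq_idx (negPf rp) mul0r.
Qed.

Lemma e_mul_last x p q : pos p = lam (blk p) -> (e *m x) p q = 0.
Proof.
move=> pl; rewrite mxE big1 // => r _; rewrite mxE.
case: andP => [[/eqP b /eqP s]|]; last by rewrite mul0r.
by have := pos_le r; rewrite -s pl b ltnn.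
Qed.

Lemma mul_e x p p' q : blk p' = blk p -> pos p' = (pos p).+1 ->
  (x *m e) q p' = x q p.
Proof.
move=> b s; rewrite mxE (bigD1 p) //= [X in _ + X]big1 => [|r rp].
  by rewrite mxE b s !eqxx mulr1 addr0.
by rewrite mxE s b eqSS -eq_idx (negPf rp) mulr0.
Qed.

Lemma mul_e_first x p q : pos p = 1%N -> (x *m e) q p = 0.
Proof.
move=> pl; rewrite mxE big1 // => r _; rewrite mxE pl eqSS.
by rewrite andbF mulr0.
Qed.

Local Notation coef p := ((pos p * (lam (blk p) - pos p))%:R : K).

Lemma f_mul x p p' q : blk p' = blk p -> pos p' = (pos p).+1 ->
  (f *m x) p' q = coef p * x p q.
Proof.
move=> b s; rewrite mxE (bigD1 p) //= [X in _ + X]big1 => [|r rp].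
  by rewrite mxE b s !eqxx addr0.
by rewrite mxE s b eqSS eq_sym [pos p == _]eq_sym -eq_idx (negPf rp) mul0r.
Qed.

Lemma f_mul_first x p q : pos p = 1%N -> (f *m x) p q = 0.
Proof.
move=> pl; rewrite mxE big1 // => r _; rewrite mxE pl eqSS.
by rewrite andbF mul0r.
Qed.

Lemma mul_f x p p' q : blk p' = blk p -> pos p' = (pos p).+1 ->
  (x *m f) q p = coef p * x q p'.
Proof.
move=> b s; rewrite mxE (bigD1 p') //= [X in _ + X]big1 => [|r rp].
  by rewrite mxE b s !eqxx addr0 mulrC.
by rewrite mxE -s -b -eq_idx (negPf rp) mulr0.
Qed.

Lemma lie_ef : lie e f = h.
Proof.
apply/matrixP=> p q; rewrite /lie mxE [X in _ + X]mxE.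
have hE : h p q = (if p == q then (lam (blk p))%:R + 1 - ((pos p).*2)%:R else 0).
  by rewrite !mxE; case: eqP.
rewrite hE; have lp := pos_le p.
have -> : (e *m f) p q = if p == q then coef p else 0.
  case: (idx_succP p) => [p' bp' sp'|pl].
    rewrite (e_mul _ _ bp' sp') f_entry bp' sp' eqSS -eq_idx; case: eqP => // ->//.
  rewrite e_mul_last //; case: eqP => // _.
  by rewrite pl subnn muln0.
have -> : (f *m e) p q = if p == q then ((pos p).-1 * (lam (blk p) - (pos p).-1))%:R else 0.
  case: (idx_predP p) => [p' bp' sp'|pl].
    rewrite (f_mul _ _ (esym bp') sp') e_entry bp' -sp' -eq_idx.
    have -> : (pos p).-1 = pos p' by rewrite sp'.
    by case: eqP => _; rewrite ?mulr1 ?mulr0.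
  by rewrite f_mul_first // pl mul0n if_same.
case: eqP => _; last by rewrite subrr.
have [c lE] : exists c, lam (blk p) = (pos p + c)%N by exists (lam (blk p) - pos p)%N; rewrite subnKC.
rewrite lE; case: (pos p) (pos_gt0 p) => // k _ /=.
have -> : (k.+1 + c - k.+1 = c)%N by lia.
have -> : (k.+1 + c - k = c.+1)%N by lia.
by rewrite -!muln2 !natrM !natrD -!natr1; ring.
Qed.

Lemma lie_he : lie h e = 2%:R *: e.
Proof.
apply/matrixP=> p q; rewrite lie_h [RHS]mxE !e_entry.
case: andP => [[/eqP b /eqP s]|_]; last by rewrite !mulr0.
by rewrite wt_blk // -s; congr (_ * _); rewrite [RHS]pmulrn; congr _%:~R; lia.
Qed.

Lemma lie_hf : lie h f = - (2%:R *: f).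
Proof.
apply/matrixP=> p q; rewrite lie_h !mxE.
case: andP => [[/eqP b /eqP s]|_]; last by rewrite !mulr0 oppr0.
rewrite wt_blk // s -mulNr; congr (_ * _).
by rewrite [X in X%:~R](_ : _ = - 2%:Z) ?intrN //; lia.
Qed.

End JordanBasisIndices.

(** * Gradings and the decomposition defining eta *)

Section Grading.
Context {K : fieldType} {delta : nat} (lam : 'I_delta -> nat).
Hypothesis charK0 : [pchar K] =i pred0.
Local Notation N := (\sum_(i < delta) lam i)%N.
Implicit Types (p q r : 'I_N) (x y t u v w : 'M[K]_N).
Local Notation e := (e_mx lam : 'M[K]_N).
Local Notation h := (h_mx lam : 'M[K]_N).
Local Notation f := (f_mx lam : 'M[K]_N).
Local Notation wt := (@wt K delta lam).

(** The filtration attached to the grading by (weight of ad h) / 2, on block diagonal matrices: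
in a block the entry (p, q) has degree pos q - pos p. Block diagonality is part of the
predicate so that one product rule serves for both. *)
Definition fil (d : int) x :=
  forall p q, x p q != 0 -> blk p = blk q /\ (pos q)%:Z <= (pos p)%:Z + d.

Lemma fil_le d d' x : d <= d' -> fil d x -> fil d' x.
Proof. by move=> dd' H p q /H[? ?]; split=> //; lia. Qed.

Lemma filD d x y : fil d x -> fil d y -> fil d (x + y).
Proof.
move=> fx fy p q; rewrite mxE.
have [->|/fx //] := eqVneq (x p q) 0.
by rewrite add0r => /fy.
Qed.

Lemma filN d x : fil d x -> fil d (- x).
Proof. by move=> fx p q; rewrite mxE oppr_eq0 => /fx. Qed.

Lemma filB d x y : fil d x -> fil d y -> fil d (x - y).
Proof. by move=> fx /filN; apply: filD. Qed.

Lemma filZ d a x : fil d x -> fil d (a *: x).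
Proof. by move=> fx p q; rewrite mxE mulf_eq0 negb_or => /andP[_ /fx]. Qed.

Lemma fil0 d : fil d 0.
Proof. by move=> p q; rewrite mxE eqxx. Qed.

Lemma mulmx_neq0 x y p q : (x *m y) p q != 0 -> exists2 r, x p r != 0 & y r q != 0.
Proof.
rewrite mxE => /eqP H; apply: contrapT => nH; apply: H; apply: big1 => r _.
apply/eqP; rewrite mulf_eq0 -[_ || _]negbK negb_or; apply/negP => /andP[x0 y0].
by apply: nH; exists r.
Qed.

Lemma filM a b x y : fil a x -> fil b y -> fil (a + b) (x *m y).
Proof.
move=> fx fy p q /mulmx_neq0[r /fx[-> ?] /fy[-> ?]]; split=> //; lia.
Qed.

Lemma fil1 : fil 0 1%:M.
Proof. by move=> p q; rewrite mxE; case: (p =P q) => [->|_]; rewrite ?eqxx //; split=> //; lia. Qed.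

Lemma filX a x k : fil a x -> fil (a *+ k) (x ^+ k).
Proof.
by move=> fx; elim: k => [|k IH]; [exact: fil1|rewrite exprS mulrS; exact: filM].
Qed.

Lemma fil_sum d (I : Type) (s : seq I) (P : pred I) (F : I -> 'M_N) :
  (forall i, P i -> fil d (F i)) -> fil d (\sum_(i <- s | P i) F i).
Proof. by move=> H; elim/big_ind: _ => //; [exact: fil0|exact: filD]. Qed.

Lemma fil_lie a b x y : fil a x -> fil b y -> fil (a + b) (lie x y).
Proof. by move=> fx fy; apply: filB; [|rewrite addrC]; apply: filM. Qed.

(** Positions range over 1, ..., N, so that no entry has degree - N or less. *)
Lemma fil_small d x : d <= - N%:Z -> fil d x -> x = 0.
Proof.
move=> dN fx; apply/matrixP=> p q; rewrite [RHS]mxE; apply/eqP/negPn/negP => /fx[_].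
have := pos_gt0 q; have := pos_le p; have := lam_le_N lam (blk p); lia.
Qed.

Lemma fil_nilp x : fil (-1) x -> x ^+ N = 0.
Proof. by move=> fx; apply: (fil_small _ (filX (k := N) fx)); rewrite -mulr_natr; lia. Qed.

Lemma fil_e : fil 1 e.
Proof.
move=> p q; rewrite e_entry; case: andP => [[/eqP -> /eqP <-]|]; rewrite ?eqxx //.
by split=> //; lia.
Qed.

Lemma fil_f : fil (-1) f.
Proof.
move=> p q; rewrite f_entry; case: andP => [[/eqP -> /eqP ->]|]; rewrite ?eqxx //.
Qed.

Definition block_diag x := forall p q, x p q != 0 -> blk p = blk q.

Lemma fil_block_diag d x : fil d x -> block_diag x.
Proof. by move=> H p q /H[]. Qed.

Lemma grP k x : gr k x <-> forall p q, x p q != 0 -> wt p q = k%:~R.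
Proof.
split=> [H p q x0 | H].
  by have /matrixP/(_ p q) := H; rewrite lie_h mxE => /(mulIf x0).
apply/matrixP=> p q; rewrite lie_h mxE.
by have [->|/H->] := eqVneq (x p q) 0; rewrite ?mulr0.
Qed.

(** On block diagonal matrices the weight 2 m of ad h is the degree m of the filtration; the
characteristic is used to read the degree off its image in K. *)
Lemma fil_gr m x : gr (2 * m) x -> block_diag x -> fil m x.
Proof.
move=> /grP gx bx p q x0; have b := bx _ _ x0; split=> //.
by have := gx _ _ x0; rewrite wt_blk // => /(intr_pchar0_inj charK0); lia.
Qed.

Lemma gr_gr_comp k x : gr k (gr_comp k x).
Proof. by apply/grP => p q; rewrite mxE; case: ifP => [/eqP//|]; rewrite eqxx. Qed.

Lemma gr_comp_id k x : gr k x -> gr_comp k x = x.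
Proof.
move=> /grP gx; apply/matrixP=> p q; rewrite mxE; case: eqP => // wk.
by apply/eqP; rewrite eq_sym; apply/negPn/negP => /gx.
Qed.

Lemma grB k x y : gr k x -> gr k y -> gr k (x - y).
Proof. by rewrite /gr /= lieBr => -> ->; rewrite scalerBr. Qed.

Lemma gr_lie k l x y : gr k x -> gr l y -> gr (k + l) (lie x y).
Proof.
rewrite /gr /= => gx gy; rewrite lie_jacobi gx gy lieZl lieZr -scalerDl.
by rewrite -intrD addrC.
Qed.

Lemma gr_eq k l x : k = l -> gr k x -> gr l x.
Proof. by move=> ->. Qed.

Lemma gr_e : gr 2 e.
Proof. by rewrite /gr /= lie_he. Qed.

Lemma gr_f : gr (-2) f.
Proof. by rewrite /gr /= lie_hf // intrN scaleNr. Qed.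

(** This is [sl2_neg_weight] for the adjoint action of (e, h, f). *)
Lemma lie_f_lie_e_inj k u : k < 0 -> gr k u -> lie f (lie e u) = 0 -> u = 0.
Proof.
move=> k0 gu fe0.
apply: (@sl2_neg_weight _ _ charK0 e f h u k%:~R N.*2) => //; first exact: lie_ef.
- exact: lie_hf.
- move=> a; rewrite pmulrn -intrB; apply/eqP => /(intr_pchar0_inj charK0 (b := 0)); lia.
rewrite iter_lie_expand; apply: big1 => i _.
have fN : f ^+ N = 0 by apply: fil_nilp; exact: fil_f.
have fup a : (N <= a)%N -> f ^+ a = 0 by move=> /subnK<-; rewrite exprD fN mulr0.
have [iN|iN] := leqP N i.
  by rewrite exprNn (fup i) // mulr0 mulmx0 mul0rn.
rewrite fup ?mul0mx ?mul0rn //; lia.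
Qed.

Lemma gr_comp_linear k a x y :
  gr_comp k (a *: x + y) = a *: gr_comp k x + gr_comp k y.
Proof.
by apply/matrixP=> p q; rewrite !mxE; case: ifP => _ //; rewrite mulr0 addr0.
Qed.

(** The endomorphism ad f o ad e of g(k) is injective, hence surjective; a preimage u of [f, w]
makes w - [e, u] commute with f. In T the complement of g(k) is completed by the identity,
so that the argument runs in the whole matrix algebra. *)
Lemma eta_exists k w : k < 0 -> gr (k + 2) w ->
  exists2 u, gr k u & lie f (w - lie e u) = 0.
Proof.
move=> k0 gw.
(* T is ad f o ad e on g(k) and the identity on the other weight spaces. *)
pose T u := lie f (lie e (gr_comp k u)) + (u - gr_comp k u).
have gT u : gr k (lie f (lie e (gr_comp k u))).
  apply: (@gr_eq (-2 + (2 + k))); first by ring.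
  by apply: gr_lie; [exact: gr_f|apply: gr_lie; [exact: gr_e|exact: gr_gr_comp]].
have gK u y : gr k y -> T u = y -> gr k u /\ lie f (lie e u) = y.
  move=> gy Ty; have : gr k (u - gr_comp k u).
    have -> : u - gr_comp k u = y - lie f (lie e (gr_comp k u)).
      by rewrite -Ty /T addrAC subrr add0r.
    exact: grB.
  move=> /gr_comp_id gE.
  have uE : gr_comp k u = u.
    apply/matrixP => p q; move/matrixP/(_ p q): gE; rewrite !mxE.
    by case: eqP => // _ /esym /eqP; rewrite subr0 => /eqP ->.
  by split; [rewrite -uE; exact: gr_gr_comp|rewrite -Ty /T uE subrr addr0].
have Tlin : linear T.
  move=> a x y; rewrite /T gr_comp_linear [lie e (_ + _)]lieDr [lie e (_ *: _)]lieZr.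
  rewrite [lie f (_ + _)]lieDr [lie f (_ *: _)]lieZr.
  move: (lie f _) (lie f _) => A B; rewrite !scalerDr scalerN.
  by rewrite opprD [X in _ + X = _]addrACA [LHS]addrACA.
have [|u Tu] := @linear_inj_surj _ _ T Tlin _ (lie f w).
  move=> u /gK[|gu fe]; first by rewrite /gr /= lie0r scaler0.
  exact: (lie_f_lie_e_inj k0 gu fe).
have [|gu fe] := gK _ _ _ Tu.
  by apply: (@gr_eq (-2 + (k + 2))); [ring|apply: gr_lie => //; exact: gr_f].
by exists u => //; rewrite lieBr fe subrr.
Qed.

Lemma eta_unique k u1 u2 v1 v2 : k < 0 -> gr k u1 -> gr k u2 ->
  lie f v1 = 0 -> lie f v2 = 0 -> lie e u1 + v1 = lie e u2 + v2 -> u1 = u2.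
Proof.
move=> k0 g1 g2 f1 f2 E; apply/eqP; rewrite -subr_eq0; apply/eqP.
apply: (lie_f_lie_e_inj k0); first exact: grB.
rewrite [lie e _]lieBr (_ : lie e u1 - lie e u2 = v2 - v1); first by rewrite lieBr f1 f2 subrr.
by apply/eqP; rewrite subr_eq addrAC eq_sym subr_eq [v2 + _]addrC E.
Qed.

(** The choice operator in the definition of eta does find a solution. *)
Lemma etaP i w : i <= 1 -> gr (2 * i - 2) w ->
  gr (2 * i - 4) (Defs.eta i w) /\
  exists2 v, lie f v = 0 /\ gr (2 * i - 2) v & w = lie e (Defs.eta i w) + v.
Proof.
move=> i1 gw; rewrite /Defs.eta; case: xgetP => [u -> [gu [v [fv gv] wE]] | nE].
  by split=> //; exists v.
have [||u gu fu] := @eta_exists (2 * i - 4) w; first by lia.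
  by apply: gr_eq gw; ring.
exfalso; apply: (nE u); split=> //; exists (w - lie e u); last by rewrite addrC subrK.
split=> //; apply: grB => //.
by apply: (@gr_eq (2 + (2 * i - 4))); [ring | apply: gr_lie => //; exact: gr_e].
Qed.

(** The projection onto block diagonal matrices; it commutes with ad a for block diagonal a. *)
Definition block_part x : 'M[K]_N := \matrix_(p, q) if blk p == blk q then x p q else 0.

Lemma block_diag_block_part x : block_diag (block_part x).
Proof. by move=> p q; rewrite mxE; case: (blk p =P blk q); rewrite ?eqxx. Qed.

Lemma block_part_id x : block_diag x -> block_part x = x.
Proof.
move=> bx; apply/matrixP=> p q; rewrite mxE; case: eqP => // b.
by apply/eqP; rewrite eq_sym; apply/negPn/negP => /bx.
Qed.

Lemma block_partD x y : block_part (x + y) = block_part x + block_part y.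
Proof. by apply/matrixP=> p q; rewrite !mxE; case: ifP; rewrite ?addr0. Qed.

Lemma block_part_lie a x : block_diag a -> block_part (lie a x) = lie a (block_part x).
Proof.
move=> ba; apply/matrixP=> p q; rewrite !mxE; case: eqP => [b|nb].
  congr (_ - _); apply: eq_bigr => r _; rewrite mxE.
    by have [->|/ba <-] := eqVneq (a p r) 0; rewrite ?mul0r // b eqxx.
  by have [->|/ba ->] := eqVneq (a r q) 0; rewrite ?mulr0 // b eqxx.
rewrite !big1 ?subr0 // => r _; rewrite mxE; case: eqP => b; rewrite ?mul0r ?mulr0 //.
  by have [->|/ba E] := eqVneq (a r q) 0; rewrite ?mulr0 //; case: nb; rewrite b.
by have [->|/ba E] := eqVneq (a p r) 0; rewrite ?mul0r //; case: nb; rewrite E.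
Qed.

Lemma gr_block_part k x : gr k x -> gr k (block_part x).
Proof. by move=> /grP gx; apply/grP=> p q; rewrite mxE; case: ifP; [move=> _ /gx | rewrite eqxx]. Qed.

(** If u solves the equation that defines eta w, so does its block diagonal part; the solution
is unique. *)
Lemma block_diag_eta i w : i <= 1 -> gr (2 * i - 2) w -> block_diag w -> block_diag (Defs.eta i w).
Proof.
move=> i1 gw bw; have [gu [v [fv gv] wE]] := etaP i1 gw.
suff -> : Defs.eta i w = block_part (Defs.eta i w) by exact: block_diag_block_part.
have be := fil_block_diag fil_e; have bf := fil_block_diag fil_f.
apply: (@eta_unique (2 * i - 4) _ _ v (block_part v)) => //; first by lia.
- exact: gr_block_part.
- by rewrite -block_part_lie // fv; apply/matrixP=> p q; rewrite !mxE if_same.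
by rewrite -block_part_lie // -block_partD -wE block_part_id.
Qed.

End Grading.

(** * varepsilon maps e + h into the Slodowy slice *)

Section SliceReduction.
Context {K : fieldType} {delta : nat} (lam : 'I_delta -> nat).
Hypothesis charK0 : [pchar K] =i pred0.
Local Notation N := (\sum_(i < delta) lam i)%N.
Implicit Types (p q r : 'I_N) (x y t u v w : 'M[K]_N).
Local Notation e := (e_mx lam : 'M[K]_N).
Local Notation f := (f_mx lam : 'M[K]_N).
Local Notation wt := (@wt K delta lam).

(** Writing the case distinction as a factor lets it pass through matrix products. *)
Lemma gr_comp_entry k x p q : gr_comp k x p q = x p q * (wt p q == k%:~R)%:R.
Proof. by rewrite mxE -/(wt p q); case: eqP; rewrite ?mulr1 ?mulr0. Qed.

Lemma wt_split p q r : wt p q = wt p r + wt r q.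
Proof. by rewrite /wt addrA subrK. Qed.

Lemma gr_comp_mull k l a x : gr l a -> gr_comp (l + k) (a *m x) = a *m gr_comp k x.
Proof.
move=> /grP ga; apply/matrixP=> p q; rewrite gr_comp_entry !mxE mulr_suml.
apply: eq_bigr => r _; rewrite gr_comp_entry mulrA.
have [->|/ga E] := eqVneq (a p r) 0; first by rewrite !mul0r.
by rewrite intrD -E (wt_split p q r) (inj_eq (addrI (wt p r))).
Qed.

Lemma gr_comp_mulr k l a x : gr l a -> gr_comp (l + k) (x *m a) = gr_comp k x *m a.
Proof.
move=> /grP ga; apply/matrixP=> p q; rewrite gr_comp_entry !mxE mulr_suml.
apply: eq_bigr => r _; rewrite gr_comp_entry mulrAC.
have [->|/ga E] := eqVneq (a r q) 0; first by rewrite !mulr0.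
by rewrite intrD -E (wt_split p q r) [wt p r + _]addrC (inj_eq (addrI (wt r q))).
Qed.

(** f is homogeneous, so each graded component of an element of g^f is in g^f. *)
Lemma lie_f_gr_comp k x : lie f x = 0 -> lie f (gr_comp k x) = 0.
Proof.
move=> fx0; have gf := @gr_f K _ lam.
rewrite /lie -(gr_comp_mull k x gf) -(gr_comp_mulr k x gf).
apply/matrixP=> p q; rewrite mxE [X in _ + X]mxE !gr_comp_entry -mulNr -mulrDl.
by move/matrixP/(_ p q): fx0; rewrite !mxE => ->; rewrite mul0r.
Qed.

Lemma fil_gr_comp d k x : fil d x -> fil d (gr_comp k x).
Proof. by move=> fx p q; rewrite gr_comp_entry mulf_eq0 negb_or => /andP[/fx]. Qed.

Lemma fil_drop (m : int) x : fil m x -> fil (m - 1) (x - gr_comp (2 * m) x).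
Proof.
move=> fx p q; rewrite mxE [X in _ + X]mxE gr_comp_entry.
have [->|x0] := eqVneq (x p q) 0; first by rewrite mul0r subrr eqxx.
have [b le] := fx _ _ x0; rewrite wt_blk //.
case: (_%:~R =P _) => [_|ne _]; first by rewrite mulr1 subrr eqxx.
split=> //.
suff : (pos q)%:Z - (pos p)%:Z != m by lia.
by apply/eqP => E; apply: ne; rewrite E.
Qed.

(** In exp (ad u) y, with u of degree - m, only y and [u, e] matter modulo degree - m: the other
brackets involve u twice, or involve y - e, which has degree at most 0. *)
Lemma exp_ad_first m u y : (0 < m)%N -> fil (- m%:Z) u -> fil 0 (y - e) ->
  fil (- m%:Z) (exp_ad u y - (y - lie e u)).
Proof.
move=> m0 fu fy.
have fy1 : fil 1 y.
  rewrite -[y](subrK e); apply: filD (@fil_e K _ lam); exact: fil_le fy.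
have fiter k : fil (1 - (m * k)%N%:Z) (iter k (lie u) y).
  elim: k => [|k IH]; first by rewrite muln0 subr0.
  by apply: fil_le (fil_lie fu IH); lia.
case: (posnP N) => [N0 p | Npos]; first by have := ltn_ord p; lia.
rewrite /exp_ad; have -> : N.*2 = (N.*2.-2).+2 by lia.
rewrite !big_ord_recl /= !fact0 factS fact0 invr1 !scale1r.
set s : 'M[K]_N := \sum_(i < (N.*2.-2)) _.
have fs : fil (- m%:Z) s.
  apply: fil_sum => i _; apply: filZ; rewrite -!iterS.
  apply: fil_le (fiter i.+2); lia.
have -> : y + (lie u y + s) - (y - lie e u) = lie u (y - e) + s.
  rewrite [lie u (y - e)]lieBr [lie e u]lieC; move: (lie u y) (lie u e) => a b.
  by clearbody s; apply/matrixP=> i j; rewrite !mxE; ring.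
by apply: filD => //; apply: fil_le (fil_lie fu fy); lia.
Qed.

(** The components of y - e of degree above - m are those of an element v of g^f: the state of
the computation of varepsilon after m steps. *)
Definition slice_upto (m : nat) y :=
  exists v, [/\ fil 0 v, lie f v = 0 & fil (- m%:Z) (y - e - v)].

Lemma slice_upto_fil m y : slice_upto m y -> fil 0 (y - e).
Proof.
by move=> [v [fv _ fy]]; rewrite -[_ - e](subrK v); apply: filD fv; apply: fil_le fy; lia.
Qed.

Lemma block_diag_expmx d u : fil d u -> block_diag (expmx u).
Proof.
move=> fu; have bM x y : block_diag x -> block_diag y -> block_diag (x *m y).
  by move=> bx by_ p q /mulmx_neq0[r /bx -> /by_].
have bX k : block_diag (u ^+ k).
  elim: k => [|k IH]; first exact: fil_block_diag (@fil1 K _ lam).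
  by rewrite exprS; apply: bM => //; exact: fil_block_diag fu.
rewrite /expmx; elim/big_ind: _ => [p q|x y bx by_ p q|i _ p q].
- by rewrite mxE eqxx.
- by rewrite mxE; have [->|/bx //] := eqVneq (x p q) 0; rewrite add0r => /by_.
by rewrite mxE mulf_eq0 negb_or => /andP[_ /bX].
Qed.

(** The component of y - e of degree - m is [e, u] + v' with v' in g^f and u = eta of it. The
step subtracts [e, u] from it and changes nothing in higher degrees. *)
Lemma eps_step_slice (m : nat) y : slice_upto m y ->
  slice_upto m.+1 (eps_step (1 - m%:Z) y) /\
  exists g, [/\ g \in unitmx, block_diag g & eps_step (1 - m%:Z) y = g *m y *m invmx g].
Proof.
move=> sy; have fy0 := slice_upto_fil sy; case: sy => v [fv kv].
set r := y - e - v => fr.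
set i : int := 1 - m%:Z; set w := gr_comp (2 * i - 2) (y - e).
have i1 : i <= 1 by rewrite /i; lia.
have gw : gr (2 * i - 2) w by apply: gr_gr_comp.
have fw : fil 0 w by apply: fil_gr_comp.
have [gu [v' [kv' gv'] wE]] := etaP charK0 i1 gw.
have bu := block_diag_eta charK0 i1 gw (fil_block_diag fw).
rewrite /eps_step -/w; set u := Defs.eta i w in gu bu wE *.
have fu : fil (- m.+1%:Z) u.
  by apply: fil_gr => //; apply: gr_eq gu; rewrite /i; lia.
have fu1 : fil (-1) u by apply: fil_le fu; lia.
split; last first.
  have uN := fil_nilp fu1; have [gU gV] := expmx_unit charK0 uN.
  by exists (expmx u); split=> //; [exact: block_diag_expmx fu|rewrite gV exp_ad_conj].
have fe := exp_ad_first (ltn0Sn m) fu fy0.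
exists (v - gr_comp (2 * i - 2) v + v'); split.
- apply: filD; first by apply: filB => //; exact: fil_gr_comp.
  rewrite (_ : v' = w - lie e u); last by rewrite wE addrAC subrr add0r.
  apply: filB => //; apply: fil_le (fil_lie (@fil_e K _ lam) fu); lia.
- by rewrite lieDr kv' addr0 lieBr kv sub0r lie_f_gr_comp ?oppr0.
rewrite (_ : _ - _ = exp_ad u y - (y - lie e u) + (r - gr_comp (2 * (- m%:Z)) r)).
  by apply: filD => //; apply: fil_le (fil_drop fr); lia.
have -> : 2 * - m%:Z = 2 * i - 2 by rewrite /i; ring.
have rE : gr_comp (2 * i - 2) r = w - gr_comp (2 * i - 2) v.
  by rewrite /r [_ - v]addrC -scaleN1r gr_comp_linear scaleN1r [LHS]addrC.
rewrite rE wE /r; move: (exp_ad u y) (lie e u) (gr_comp _ v) => a b c.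
by apply/matrixP=> p q; rewrite !mxE; ring.
Qed.

(** After N + 2 steps no degree is left, so y - e itself is in g^f. The conjugating element is
block diagonal, which is what keeps the traces on the separate blocks. *)
Lemma varepsilon_slice t : fil 0 t ->
  [/\ lie f (varepsilon (e + t) - e) = 0, fil 0 (varepsilon (e + t) - e) &
    exists g, [/\ g \in unitmx, block_diag g & varepsilon (e + t) = g *m (e + t) *m invmx g]].
Proof.
move=> ft; pose y m := eps_comp m (e + t).
have H m : slice_upto m (y m) /\
    exists g, [/\ g \in unitmx, block_diag g & y m = g *m (e + t) *m invmx g].
  elim: m => [|m [IH [g [gU bg yE]]]].
    split; first by exists 0; split; [exact: fil0|exact: lie0r|rewrite /y /= subr0 addrC addKr].
    exists 1%:M; split; [exact: unitmx1|exact: fil_block_diag (@fil1 K _ lam)|].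
    by rewrite invmx1 mul1mx mulmx1.
  have [H1 [g' [gU' bg' yE']]] := eps_step_slice IH.
  split=> //; exists (g' *m g); split; first by rewrite unitmx_mul gU' gU.
    by move=> p q /mulmx_neq0[r /bg' -> /bg].
  have -> : y m.+1 = eps_step (1 - m%:Z) (y m) by [].
  by rewrite yE' yE invmxM // !mulmxA.
have [sN gN] := H N.+2; rewrite /varepsilon -/(y N.+2).
have [v [fv kv fN]] := sN.
have E : y N.+2 - e = v by apply/eqP; rewrite -subr_eq0; apply/eqP; apply: fil_small fN; lia.
by rewrite E.
Qed.

(** The projector onto block i. *)
Definition pi_mx (i : 'I_delta) : 'M[K]_N := diag_mx (\row_p (blk p == i)%:R).

Lemma block_diag_pi i x : block_diag x -> pi_mx i *m x = x *m pi_mx i.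
Proof.
move=> bx; apply/matrixP=> p q; rewrite mul_diag_mx mul_mx_diag !mxE.
have [->|/bx ->] := eqVneq (x p q) 0; first by rewrite mulr0 mul0r.
exact: mulrC.
Qed.

Lemma tr_pi_conj i g y k : g \in unitmx -> block_diag g ->
  \tr (pi_mx i *m (g *m y *m invmx g) ^+ k) = \tr (pi_mx i *m y ^+ k).
Proof.
move=> gU bg.
rewrite conj_expr //.
by rewrite !mulmxA block_diag_pi // mxtrace_mulC !mulmxA mulVmx // mul1mx.
Qed.

End SliceReduction.
Arguments pi_mx {K delta lam} i.

(** * Traces of odd powers detect the even part of a point of the slice *)

Lemma exprB_telescope (R : pzRingType) (x y : R) n :
  x ^+ n - y ^+ n = \sum_(a < n) x ^+ (n.-1 - a) * (x - y) * y ^+ a.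
Proof.
elim: n => [|n IH]; first by rewrite big_ord0 subrr.
rewrite big_ord_recr /= subnn mul1r.
transitivity (x * (x ^+ n - y ^+ n) + (x - y) * y ^+ n).
  by rewrite !exprS mulrBr mulrBl addrA subrK.
rewrite IH mulr_sumr; congr (_ + _); apply: eq_bigr => a _.
rewrite !mulrA -exprS; congr (_ ^+ _ * _ * _).
by case: n a {IH} => [[]|n] //= a; rewrite subSn // -ltnS.
Qed.

Section BlockTraces.
Context {K : fieldType} {delta : nat} (lam : 'I_delta -> nat).
Hypothesis charK0 : [pchar K] =i pred0.
Local Notation N := (\sum_(i < delta) lam i)%N.
Implicit Types (p q r : 'I_N) (x y t u v w : 'M[K]_N).
Local Notation e := (e_mx lam : 'M[K]_N).
Local Notation f := (f_mx lam : 'M[K]_N).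

Lemma e_pow_mul j x p r q : blk r = blk p -> pos r = (pos p + j)%N ->
  (e ^+ j *m x) p q = x r q.
Proof.
elim: j p => [|j IH] p br pr.
  by rewrite mul1mx (_ : p = r) //; apply: pos_inj => //; rewrite pr addn0.
rewrite exprS -mulmxA; case: (idx_succP p) => [p' bp' sp'|pl].
  by rewrite (e_mul _ _ bp' sp') IH ?bp' // pr sp' addSnnS.
by have := pos_le r; rewrite pr br pl; lia.
Qed.

Lemma e_pow_mul_out j x p q : (lam (blk p) < pos p + j)%N -> (e ^+ j *m x) p q = 0.
Proof.
elim: j p => [|j IH] p lt; first by have := pos_le p; lia.
rewrite exprS -mulmxA; case: (idx_succP p) => [p' bp' sp'|pl]; last exact: e_mul_last.
by rewrite (e_mul _ _ bp' sp') IH // bp' sp' addSnnS.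
Qed.

(** Commutation with f relates neighbouring entries on the diagonal of degree - j of x; the
product e^j x moves that diagonal to the main one. *)
Lemma lie_f_diagonal j x p p' : lie f x = 0 -> blk p' = blk p -> pos p' = (pos p).+1 ->
  (pos p' + j <= lam (blk p))%N ->
  (pos p * (lam (blk p) - pos p))%:R * (e ^+ j *m x) p' p' =
  ((pos p + j) * (lam (blk p) - (pos p + j)))%:R * (e ^+ j *m x) p p :> K.
Proof.
move=> fx0 bp' sp' le.
have [|r br pr] := @idx_exists _ lam (blk p) (pos p + j); first by have := pos_gt0 p; lia.
have [|r' br' pr'] := @idx_exists _ lam (blk p) (pos p' + j); first by have := pos_gt0 p'; lia.
rewrite (e_pow_mul _ _ br pr) (@e_pow_mul j x p' r') ?bp' //.
have srr : pos r' = (pos r).+1 by rewrite pr' pr sp'.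
have b : blk r' = blk r by rewrite br' br.
have := f_mul x p b srr; rewrite br pr => <-; rewrite -(mul_f _ _ bp' sp').
move/matrixP/(_ r' p): fx0; rewrite /lie mxE [RHS]mxE [X in _ + X]mxE.
by move/eqP; rewrite subr_eq0 => /eqP ->.
Qed.

Lemma tr_pi i x : \tr (pi_mx i *m x) = \sum_(p | blk p == i) x p p.
Proof.
rewrite /mxtrace [RHS]big_mkcond; apply: eq_bigr => p _.
by rewrite mul_diag_mx !mxE; case: eqP; rewrite ?mul1r ?mul0r.
Qed.

(** By [lie_f_diagonal] the entries d_k of e^j x on the main diagonal of a block of size l satisfy
d_k = d_1 C(k + j - 1, j) C(l - k, j) / C(l - 1, j), with all the coefficients positive.
Their sum can only vanish if d_1 = 0. *)
Lemma lie_f_trace0 j i x : lie f x = 0 -> \tr (pi_mx i *m (e ^+ j *m x)) = 0 ->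
  forall p, blk p = i -> (e ^+ j *m x) p p = 0.
Proof.
move=> fx0; rewrite tr_pi; set d := fun p => (e ^+ j *m x) p p.
rewrite -/(d _) => tr0 p bp; rewrite -/(d p).
have [out|] := ltnP (lam i) (pos p + j); first by rewrite /d e_pow_mul_out // bp.
move=> jl; have pp := pos_gt0 p.
have [|p1 bp1 pp1] := @idx_exists _ lam i 1; first by lia.
(* The product formula for d_k, up to the common factor d_1 / c_1. *)
pose c k := ('C(k + j - 1, j) * 'C(lam i - k, j))%N.
have c_gt0 k : (0 < k)%N -> (k + j <= lam i)%N -> (0 < c k)%N.
  by move=> k0 kl; rewrite muln_gt0 !bin_gt0; lia.
have dE k q : pos q = k.+1 -> blk q = i -> (k.+1 + j <= lam i)%N ->
    d q * (c 1%N)%:R = d p1 * (c k.+1)%:R.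
  elim: k q => [|k IH] q pq bq le.
    by rewrite (_ : q = p1) //; apply: pos_inj; rewrite ?bq ?bp1 // pp1.
  have [|r br pr] := @idx_exists _ lam i k.+1; first by lia.
  have := @lie_f_diagonal j x r q fx0; rewrite br bq pr pq => /(_ erefl erefl le).
  rewrite -/(d q) -/(d r) => E.
  have n0 : ((k.+1 * (lam i - k.+1))%N%:R : K) != 0.
    by apply: natr_neq0 => //; rewrite muln_gt0; lia.
  apply: (mulfI n0); rewrite mulrA E -mulrA IH //; last by lia.
  rewrite !(mulrCA _ (d p1)) -!natrM; congr (_ * _%:R); rewrite /c.
  have -> : (k.+2 + j - 1 = (k.+1 + j))%N by lia.
  have -> : (k.+1 + j - 1 = (k.+1 + j).-1)%N by lia.
  have -> : (lam i - k.+2 = (lam i - k.+1).-1)%N by lia.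
  by rewrite mulnACA [RHS]mulnACA !mul_bin_down addnK subnDA.
have d10 : d p1 = 0.
  have : (\sum_(q | blk q == i) d q) * (c 1%N)%:R = d p1 *
      (\sum_(q : 'I_N | (blk q == i) && (pos q + j <= lam i)%N) c (pos q))%N%:R.
    rewrite natr_sum mulr_suml mulr_sumr [RHS]big_mkcondr /=.
    apply: eq_bigr => q /eqP bq; case: ifPn => [le|]; last first.
      by rewrite -ltnNge => lt; rewrite /d e_pow_mul_out ?mul0r // bq.
    have qE : pos q = (pos q).-1.+1 by have := pos_gt0 q; lia.
    by rewrite [in RHS]qE; apply: dE => //; rewrite -qE.
  rewrite tr0 mul0r => /esym/eqP; rewrite mulf_eq0 => /orP[/eqP //|].
  rewrite (negPf (natr_neq0 _ _)) //.
  rewrite (bigD1 p1) /=; last by rewrite bp1 eqxx pp1; lia.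
  by rewrite addn_gt0 c_gt0 // pp1; lia.
have pE : pos p = (pos p).-1.+1 by lia.
have jl' : ((pos p).-1.+1 + j <= lam i)%N by rewrite -pE.
have /eqP := dE _ p pE bp jl'; rewrite -pE d10 mul0r mulf_eq0.
rewrite (negPf (natr_neq0 charK0 _)) ?orbF; first by move/eqP.
by apply: c_gt0 => //; lia.
Qed.

(** Conjugation by this involution is (-1)^m on matrices of degree m. *)
Definition sgn_mx : 'M[K]_N := diag_mx (\row_p (-1) ^+ pos p).

Lemma sgn_conj x p q : (sgn_mx *m x *m sgn_mx) p q = (-1) ^+ (pos p + pos q) * x p q.
Proof. by rewrite mul_mx_diag mxE mul_diag_mx !mxE exprD mulrAC. Qed.

Lemma sgn_sq : sgn_mx *m sgn_mx = 1%:M.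
Proof.
rewrite mulmx_diag -diag_const_mx; congr diag_mx; apply/rowP=> p.
by rewrite !mxE -exprD addnn -mul2n exprM sqrrN !expr1n.
Qed.

Lemma sgn_f : sgn_mx *m f *m sgn_mx = - f.
Proof.
apply/matrixP=> p q; rewrite sgn_conj [RHS]mxE f_entry.
case: andP => [[_ /eqP ->]|_]; last by rewrite mulr0 oppr0.
by rewrite addSn addnn exprS -mul2n exprM sqrrN !expr1n mulr1 mulN1r.
Qed.

Lemma sgn_e : sgn_mx *m e *m sgn_mx = - e.
Proof.
apply/matrixP=> p q; rewrite sgn_conj [RHS]mxE e_entry.
case: andP => [[_ /eqP <-]|_]; last by rewrite mulr0 oppr0.
by rewrite addnS addnn exprS -mul2n exprM sqrrN !expr1n !mulr1.
Qed.

Definition evenpart x : 'M[K]_N :=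
  \matrix_(p, q) if odd (pos p + pos q) then 0 else x p q.

Lemma evenpartE x : 2%:R *: evenpart x = x + sgn_mx *m x *m sgn_mx.
Proof.
apply/matrixP=> p q; rewrite mxE [X in _ * X]mxE mxE sgn_conj -signr_odd.
by case: odd; rewrite ?expr1 ?expr0 ?mulN1r ?mul1r ?subrr ?mulr0 //; ring.
Qed.

Lemma sgn_mxK x : sgn_mx *m (sgn_mx *m x) = x.
Proof. by rewrite mulmxA sgn_sq mul1mx. Qed.

Lemma lie_sgn_conj x y : lie (sgn_mx *m x *m sgn_mx) (sgn_mx *m y *m sgn_mx)
  = sgn_mx *m lie x y *m sgn_mx.
Proof. by rewrite /lie mulmxBr mulmxBl -!mulmxA !sgn_mxK. Qed.

Lemma lie_f_evenpart x : lie f x = 0 -> lie f (evenpart x) = 0.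
Proof.
move=> fx0; apply: (scalerI (natr_neq0 charK0 (isT : (0 < 2)%N))).
rewrite -lieZr evenpartE lieDr fx0 add0r scaler0 -[f]opprK lieNl -sgn_f lie_sgn_conj fx0.
by rewrite mulmx0 mul0mx oppr0.
Qed.

Lemma sgn_oddpart x : sgn_mx *m (x - evenpart x) *m sgn_mx = - (x - evenpart x).
Proof.
apply/matrixP=> p q; rewrite sgn_conj !mxE -signr_odd.
by case: odd; rewrite ?subrr ?subr0 ?mulr0 ?oppr0 // expr1 mulN1r.
Qed.

Lemma sgn_pow x k : sgn_mx *m x *m sgn_mx = - x -> odd k ->
  sgn_mx *m x ^+ k *m sgn_mx = - x ^+ k.
Proof.
move=> sx ok; have -> : sgn_mx *m x ^+ k *m sgn_mx = (sgn_mx *m x *m sgn_mx) ^+ k.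
  elim: k {ok} => [|k IH]; first by rewrite mulmx1 sgn_sq.
  by rewrite !exprS -IH -![_ * _]/(_ *m _) -!mulmxA sgn_mxK.
by rewrite sx exprNn -signr_odd ok expr1 mulN1r.
Qed.

(** x is conjugate to - x by an involution that preserves the blocks. *)
Lemma tr_pi_odd0 i x k : sgn_mx *m x *m sgn_mx = - x -> odd k ->
  \tr (pi_mx i *m x ^+ k) = 0.
Proof.
move=> sx ok; have := sgn_pow sx ok => E.
have : \tr (pi_mx i *m x ^+ k) = \tr (pi_mx i *m - x ^+ k).
  rewrite -E !tr_pi; apply: eq_bigr => p _.
  by rewrite sgn_conj addnn -mul2n exprM sqrrN !expr1n mul1r.
rewrite mulmxN linearN /= => /eqP; rewrite -addr_eq0 -mulr2n -mulr_natl mulf_eq0.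
by rewrite (negPf (natr_neq0 charK0 _)) // => /eqP.
Qed.

Lemma tr_pi_fil d i x : d < 0 -> fil d x -> \tr (pi_mx i *m x) = 0.
Proof.
move=> d0 fx; rewrite tr_pi big1 // => p _; apply/eqP/negPn/negP => /fx[_]; lia.
Qed.

Lemma fil_pow_lead x k : fil 0 (x - e) -> fil (k%:Z - 1) (x ^+ k - e ^+ k).
Proof.
move=> fx; have fx1 : fil 1 x.
  by rewrite -[x](subrK e); apply: filD (@fil_e K _ lam); exact: fil_le fx.
elim: k => [|k IH]; first by rewrite subrr; exact: fil0.
have -> : x ^+ k.+1 - e ^+ k.+1 = x *m (x ^+ k - e ^+ k) + (x - e) *m e ^+ k.
  by rewrite !exprS mulmxBr mulmxBl addrA subrK.
have fek := filX (k := k) (@fil_e K _ lam).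
by apply: filD; [apply: fil_le (filM fx1 IH) | apply: fil_le (filM fx fek);
   rewrite -mulr_natr]; lia.
Qed.

(** Telescoping y^(j+1) - y'^(j+1) gives j + 1 terms y^(j-a) (y - y') y'^a, each of degree at
most 0; the part of degree 0 comes from replacing y and y' by their leading term e. *)
Lemma fil_lead_zero j i y y' : fil 0 (y - e) -> fil 0 (y' - e) ->
  fil (- j%:Z) (y - y') ->
  \tr (pi_mx i *m y ^+ j.+1) - \tr (pi_mx i *m y' ^+ j.+1)
   = j.+1%:R * \tr (pi_mx i *m (e ^+ j *m (y - y'))).
Proof.
move=> fy fy' fd; set z := y - y' in fd *.
rewrite -linearB /= -mulmxBr exprB_telescope -/z /= mulmx_sumr linear_sum /=.
rewrite (eq_bigr (fun=> \tr (pi_mx i *m (e ^+ j *m z)))).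
  by rewrite sumr_const card_ord mulr_natl.
move=> a _; have aj : (a <= j)%N by rewrite -ltnS.
rewrite -![_ * _]/(_ *m _).
clearbody z.
have fea := filX (k := a) (@fil_e K _ lam).
have fya : fil (a%:Z) (y' ^+ a).
  rewrite -[y' ^+ a](subrK (e ^+ a)); apply: filD; last by apply: fil_le fea; rewrite -mulr_natr; lia.
  by apply: fil_le (fil_pow_lead (k := a) fy'); lia.
have feb := filX (k := j - a) (@fil_e K _ lam).
have -> : y ^+ (j - a) *m z *m y' ^+ a = e ^+ (j - a) *m z *m e ^+ a
   + ((y ^+ (j - a) - e ^+ (j - a)) *m z *m y' ^+ a
      + e ^+ (j - a) *m z *m (y' ^+ a - e ^+ a)).
  rewrite !mulmxBl mulmxBr; move: (_ *m y' ^+ a) (_ *m y' ^+ a) (_ *m e ^+ a) => A B C.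
  by apply/matrixP=> p q; rewrite !mxE; ring.
rewrite mulmxDr linearD /= [X in _ + X](@tr_pi_fil (-1)) ?addr0 //.
  rewrite !mulmxA mxtrace_mulC !mulmxA -(block_diag_pi _ (fil_block_diag fea)) -[_ *m e ^+ a *m _]mulmxA.
  by rewrite -[e ^+ a *m _]/(_ * _) -exprD subnKC // mulmxA.
apply: filD.
  by apply: fil_le (filM (filM (fil_pow_lead (k := j - a) fy) fd) fya); lia.
by apply: fil_le (filM (filM feb fd) (fil_pow_lead (k := a) fy')); rewrite -mulr_natr; lia.
Qed.

(** Compare y with y' = y - z, where z is the even part of y - e. Since y' is odd, the traces of
its odd powers vanish too, and [fil_lead_zero] with [lie_f_trace0] kills the leading part
of z, degree by degree. *)
Lemma slice_odd_of_traces y : fil 0 (y - e) -> lie f (y - e) = 0 ->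
  (forall i k, odd k -> \tr (pi_mx i *m y ^+ k) = 0) -> evenpart (y - e) = 0.
Proof.
move=> fy ky tr0; set z := evenpart (y - e).
have kz : lie f z = 0 by exact: lie_f_evenpart.
have filz0 : fil 0 z.
  by move=> p q; rewrite mxE; case: ifP => _; [rewrite eqxx|exact: fy].
pose y' := y - z.
have y'e : y' - e = y - e - z by rewrite /y' addrAC.
have fy' : fil 0 (y' - e) by rewrite y'e; exact: filB.
have sy' : sgn_mx *m y' *m sgn_mx = - y'.
  have yE : y' = e + (y - e - z) by rewrite -y'e addrC subrK.
  by rewrite yE mulmxDr mulmxDl sgn_oddpart sgn_e -opprD.
have zE : y - y' = z by rewrite /y' opprB addrC subrK.
suff H j : fil (- j%:Z) z.
  by apply: fil_small (H N); lia.
elim: j => [|j IH]; first by rewrite oppr0.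
move=> p q z0; have [b le] := IH _ _ z0; split=> //.
suff : pos p != (pos q + j)%N by lia.
apply/eqP => pE; have ej : ~~ odd j.
  apply/negP => oj; move: z0; rewrite mxE pE addnAC oddD oj addnn odd_double eqxx //.
have trz : \tr (pi_mx (blk q) *m (e ^+ j *m z)) = 0.
  have := @fil_lead_zero j (blk q) y y' fy fy'; rewrite zE => /(_ IH).
  rewrite tr0 ?tr_pi_odd0 //= subrr => /esym/eqP.
  by rewrite mulf_eq0 (negPf (natr_neq0 charK0 _)) // => /eqP.
have := lie_f_trace0 kz trz (erefl (blk q)).
by rewrite (e_pow_mul _ _ b pE) => z00; rewrite z00 eqxx in z0.
Qed.

End BlockTraces.

(** * Points of the slice that lie in e + p *)

Section SliceParity.
Context {K : fieldType} {delta : nat} (lam : 'I_delta -> nat).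
Hypothesis charK0 : [pchar K] =i pred0.
Local Notation N := (\sum_(i < delta) lam i)%N.
Implicit Types (p q r : 'I_N) (x y t u v w : 'M[K]_N).
Local Notation e := (e_mx lam : 'M[K]_N).

Lemma sum_idx (F : 'I_N -> K) :
  \sum_p F p = \sum_i \sum_(j < lam i) F (tagnat.Rank i j).
Proof.
rewrite sig_big_dep (reindex _ tagnat.sig_bij_on) /=.
by apply: eq_bigr => p _; rewrite tagnat.sig2K.
Qed.

Lemma sum_blk i (F : 'I_N -> K) :
  \sum_(p | blk p == i) F p = \sum_(j < lam i) F (tagnat.Rank i j).
Proof.
rewrite big_mkcond sum_idx (bigD1 i) //= [X in _ + X]big1 ?addr0 => [|i' ii'].
  by apply: eq_bigr => j _; rewrite /blk tagnat.Rank1K eqxx.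
by apply: big1 => j _; rewrite /blk tagnat.Rank1K (negPf ii').
Qed.

Lemma fil_diag t : is_diag_mx t -> fil 0 t.
Proof.
move=> /is_diag_mxP dt p q; have [->|pq] := eqVneq p q; first by split=> //; lia.
by rewrite dt ?eqxx.
Qed.

Lemma upper_pow t k p q : is_diag_mx t -> ((e + t) ^+ k) p q != 0 ->
  blk p = blk q /\ (pos p <= pos q)%N.
Proof.
move=> /is_diag_mxP dt; elim: k p q => [|k IH] p q.
  by rewrite mxE; case: (p =P q) => [->|]; rewrite ?eqxx.
rewrite exprSr => /mulmx_neq0[r /IH[-> le]].
rewrite mxE e_entry; case: andP => [[/eqP -> /eqP qr] _|_].
  by rewrite -qr; split=> //; exact: leqW.
have [<-|rq] := eqVneq r q; first by [].
by rewrite add0r dt ?eqxx.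
Qed.

Lemma diag_pow t k p : is_diag_mx t -> ((e + t) ^+ k) p p = t p p ^+ k.
Proof.
move=> dt; elim: k => [|k IH]; first by rewrite mxE eqxx.
rewrite exprSr mxE (bigD1 p) //= [X in _ + X]big1 ?addr0 => [|r rp].
  rewrite IH exprSr mxE e_entry; congr (_ * _).
  by rewrite (_ : _ && _ = false) ?add0r //; apply/negP => /andP[_]; lia.
apply/eqP; rewrite mulf_eq0 -[_ || _]negbK negb_or.
apply/negP => /andP[/(upper_pow dt)[b1 l1]].
have -> : (e + t) r p = ((e + t) ^+ 1) r p by [].
move/(upper_pow dt) => [b2 l2]; move: rp; rewrite eq_idx b2 eqxx /=.
by move/negP; apply; apply/eqP; lia.
Qed.

(** e + t is triangular, so only the diagonal t contributes to the traces of powers. *)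
Lemma tr_pi_pow t i k : is_diag_mx t ->
  \tr (pi_mx i *m (e + t) ^+ k) = \sum_(j < lam i) diag_entry t j ^+ k.
Proof.
move=> dt; rewrite tr_pi sum_blk; apply: eq_bigr => j _.
by rewrite diag_pow.
Qed.

(** The multiset of the s_j is stable under negation, so the sum equals its opposite. *)
Lemma sum_odd_sym m (s : 'I_m -> K) k : odd k ->
  (forall c, #|[set j | s j == c]%SET| = #|[set j | s j == - c]%SET|) ->
  \sum_j s j ^+ k = 0.
Proof.
move=> ok sym; pose cs := [seq s j | j <- enum 'I_m].
have cE c : count_mem c cs = #|[set j | s j == c]%SET|.
  by rewrite count_map -sum1_count big_enum_cond -sum1_card; apply: eq_bigl => j; rewrite !inE.
have pe : perm_eq cs [seq - c | c <- cs].
  apply/allP => c _ /=; rewrite cE count_map; apply/eqP.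
  rewrite sym -cE; apply: eq_count => x /=; by rewrite eqr_oppLR.
have S : \sum_(c <- cs) c ^+ k = - \sum_(c <- cs) c ^+ k.
  rewrite {1}(perm_big _ pe) /= big_map -sumrN; apply: eq_bigr => c _.
  by rewrite exprNn -signr_odd ok expr1 mulN1r.
have -> : \sum_j s j ^+ k = \sum_(c <- cs) c ^+ k by rewrite big_map big_enum.
apply/eqP; move/eqP: S; rewrite -addr_eq0 -mulr2n -mulr_natl mulf_eq0.
by rewrite (negPf (natr_neq0 charK0 _)).
Qed.

Section SymmetricPair.
Variable Phi : 'I_delta -> side.

Lemma in_bE p : in_b Phi p = ~~ in_a Phi p.
Proof. by rewrite /in_b /in_a; case: Phi; rewrite ?negbK. Qed.

Lemma p_spaceP x : p_space Phi x <->
  forall p q, in_a Phi p = in_a Phi q -> x p q = 0.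
Proof.
split=> [[xa xb] p q pq | H].
  have xE : x p q = (x *m (delta_mx q 0 : 'cV[K]_N)) p 0.
    rewrite mxE (bigD1 q) //= [X in _ + X]big1 ?addr0 => [|r rq].
      by rewrite mxE !eqxx mulr1.
    by rewrite mxE (negPf rq) mulr0.
  have [qa|qb] := boolP (in_a Phi q).
    have /xa/(_ p) : V_a Phi (delta_mx q 0 : 'cV[K]_N).
      by move=> r ra; rewrite mxE eqxx andbT; case: eqP ra => // ->; rewrite qa.
    by rewrite in_bE pq qa xE; apply.
  have /xb/(_ p) : V_b Phi (delta_mx q 0 : 'cV[K]_N).
    by move=> r rb; rewrite mxE eqxx andbT; case: eqP rb => // ->; rewrite in_bE (negPf qb).
  by rewrite pq qb xE; apply.
split=> v vP p pP; rewrite mxE big1 // => q _.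
  have [qa|qb] := boolP (in_a Phi q); last by rewrite vP ?mulr0.
  by rewrite H ?mul0r // qa; move: pP; rewrite in_bE negbK.
have [qa|qb] := boolP (in_a Phi q); first by rewrite vP ?mulr0 // in_bE qa.
by rewrite H ?mul0r // (negPf pP) (negPf qb).
Qed.

Lemma in_a_odd p q : blk p = blk q -> odd (pos p + pos q) ->
  in_a Phi p = ~~ in_a Phi q.
Proof.
move=> b; rewrite oddD => o; have := pos_le p; have := pos_le q.
rewrite /in_a b => lq lp; case: (Phi _); rewrite !oddB //.
all: by move: o; case: (odd (pos p)); case: (odd (pos q)); case: (odd (lam _)).
Qed.

(** In one block the parity of the position decides between V_a and V_b, whatever the value of
Phi on that block; so odd block diagonal matrices exchange V_a and V_b. *)
Lemma p_space_odd x : (forall p q, x p q != 0 -> blk p = blk q) -> evenpart x = 0 ->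
  p_space Phi x.
Proof.
move=> bx ex; apply/p_spaceP => p q pq; apply/eqP/negPn/negP => x0.
have b := bx _ _ x0; move/matrixP/(_ p q): ex; rewrite !mxE.
case: ifP => [o|_ /eqP]; last by rewrite (negPf x0).
by move: pq; rewrite (in_a_odd b o); case: in_a.
Qed.

Lemma p_space_e : p_space Phi e.
Proof.
apply: p_space_odd; first exact: fil_block_diag (@fil_e K _ lam).
apply/matrixP=> p q; rewrite !mxE; case: ifP => // o.
by case: andP => // [[_ /eqP E]]; move: o; rewrite -E addnS addnn /= odd_double.
Qed.

Lemma p_spaceD x y : p_space Phi x -> p_space Phi y -> p_space Phi (x + y).
Proof.
move=> /p_spaceP px /p_spaceP py; apply/p_spaceP => p q pq.
by rewrite mxE px // py // addr0.
Qed.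

Lemma varepsilon_p t : t_space t ->
  (forall c i, mult t i c = mult t i (- c)) ->
  [/\ Gorbit (e + t) (varepsilon (e + t)), slodowy_slice (varepsilon (e + t)) &
    p_space Phi (varepsilon (e + t) - e)].
Proof.
move=> [dt _] sym.
have [ky fy [g [gU bg yE]]] := varepsilon_slice charK0 (fil_diag dt).
split=> //; first by exists g => //; exists (e + t).
apply: p_space_odd; first exact: fil_block_diag fy.
apply: slice_odd_of_traces => // i k ok.
rewrite yE tr_pi_conj // tr_pi_pow //; apply: sum_odd_sym => // c.
exact: sym.
Qed.

End SymmetricPair.
End SliceParity.

(** * Polynomials in a square matrix *)

Section PolyEval.
Context {K : fieldType}.

(** Evaluation of a polynomial at a square matrix of any size: horner_mx is restricted to
positive sizes, while here sizes are sums that are not successors syntactically. *)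
Definition peval n : 'M[K]_n -> {poly K} -> 'M[K]_n :=
  match n with
  | 0 => fun _ _ => 0
  | n'.+1 => fun x P => horner_mx x P
  end.

Lemma dim0_mx_eq (x y : 'M[K]_0) : x = y.
Proof. by apply/matrixP => -[]. Qed.

Lemma pevalD n (x : 'M[K]_n) P Q : peval x (P + Q) = peval x P + peval x Q.
Proof. by case: n x => [|n] x; [exact: dim0_mx_eq|exact: rmorphD]. Qed.

Lemma pevalB n (x : 'M[K]_n) P Q : peval x (P - Q) = peval x P - peval x Q.
Proof. by case: n x => [|n] x; [exact: dim0_mx_eq|exact: rmorphB]. Qed.

Lemma pevalM n (x : 'M[K]_n) P Q : peval x (P * Q) = peval x P *m peval x Q.
Proof. by case: n x => [|n] x; [exact: dim0_mx_eq|exact: rmorphM]. Qed.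

Lemma pevalC n (x : 'M[K]_n) c : peval x c%:P = c%:M.
Proof. by case: n x => [|n] x; [exact: dim0_mx_eq|exact: horner_mx_C]. Qed.

Lemma pevalX n (x : 'M[K]_n) : peval x 'X = x.
Proof. by case: n x => [|n] x; [exact: dim0_mx_eq|exact: horner_mx_X]. Qed.

Lemma peval0 n (x : 'M[K]_n) : peval x 0 = 0.
Proof. by rewrite -(subrr (0 : {poly K})) pevalB subrr. Qed.

Lemma peval1 n (x : 'M[K]_n) : peval x 1 = 1%:M.
Proof. exact: pevalC. Qed.

Lemma pevalZ n (x : 'M[K]_n) c P : peval x (c *: P) = c *: peval x P.
Proof. by rewrite -mul_polyC pevalM pevalC mul_scalar_mx. Qed.

Lemma pevalXn n (x : 'M[K]_n) k : peval x 'X^k = x ^+ k.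
Proof.
by elim: k => [|k IH]; [rewrite expr0 peval1|rewrite exprS pevalM pevalX IH exprS].
Qed.

Lemma peval_sum n (x : 'M[K]_n) (I : Type) (s : seq I) (F : I -> {poly K}) :
  peval x (\sum_(i <- s) F i) = \sum_(i <- s) peval x (F i).
Proof.
by elim: s => [|i s IH]; rewrite ?big_nil ?peval0 // !big_cons pevalD IH.
Qed.

Lemma pevalE n (x : 'M[K]_n) (P : {poly K}) m : (size P <= m)%N ->
  peval x P = \sum_(i < m) P`_i *: x ^+ i.
Proof.
move=> sP; rewrite -{1}[P]coefK poly_def (big_ord_widen _ (fun i => P`_i *: 'X^i) sP).
rewrite big_mkcond peval_sum; apply: eq_bigr => i _; case: ltnP => [_|le].
  by rewrite pevalZ pevalXn.
by rewrite peval0 nth_default ?scale0r.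
Qed.

Lemma peval_comm n (x y g : 'M[K]_n) P : g *m x = y *m g -> g *m peval x P = peval y P *m g.
Proof.
move=> gE; elim/poly_ind: P => [|P c IH]; first by rewrite !peval0 mulmx0 mul0mx.
rewrite !pevalD !pevalM !pevalX !pevalC mulmxDr mulmxDl scalar_mxC; congr (_ + _).
by rewrite mulmxA IH -!mulmxA gE.
Qed.

Lemma peval_char_poly n (x : 'M[K]_n) : peval x (char_poly x) = 0.
Proof. by case: n x => [|n] x; [exact: dim0_mx_eq|exact: Cayley_Hamilton]. Qed.

Definition prefix_poly (tau : nat -> K) k : {poly K} := \prod_(j < k) ('X - (tau j)%:P).

Lemma prefix_polyS tau k : prefix_poly tau k.+1 = prefix_poly tau k * ('X - (tau k)%:P).
Proof. by rewrite /prefix_poly big_ord_recr. Qed.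

Lemma prefix_poly_monic tau k : prefix_poly tau k \is monic.
Proof. exact: monic_prod_XsubC. Qed.

Lemma size_prefix_poly tau k : size (prefix_poly tau k) = k.+1.
Proof. by rewrite size_prod_XsubC /index_enum -enumT size_enum_ord. Qed.

Lemma peval_prefix_polyS n (x : 'M[K]_n) tau k :
  peval x (prefix_poly tau k.+1) = peval x (prefix_poly tau k) *m (x - (tau k)%:M).
Proof. by rewrite prefix_polyS pevalM pevalB pevalX pevalC. Qed.

(** Such a matrix factors as M^T M, with M the matrix of the inclusion of P, and M M^T = 1. *)
Lemma rank_indicator_mx n (P : pred 'I_n) :
  \rank (diag_mx (\row_p (P p)%:R) : 'M[K]_n) = #|P|.
Proof.
pose M : 'M[K]_(#|P|, n) := \matrix_(a, j) (enum_val a == j)%:R.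
have MM : M *m M^T = 1%:M.
  apply/matrixP=> a b; rewrite !mxE (bigD1 (enum_val a)) //= [X in _ + X]big1 ?addr0.
    by rewrite !mxE eqxx mul1r [_ == enum_val a]eq_sym (inj_eq enum_val_inj).
  by move=> j ja; rewrite !mxE eq_sym (negPf ja) mul0r.
have UE : diag_mx (\row_p (P p)%:R) = M^T *m M.
  apply/matrixP=> p q; rewrite !mxE.
  under eq_bigr => a _ do rewrite !mxE.
  have [Pp|nP] := boolP (P p).
    rewrite (bigD1 (enum_rank_in Pp p)) //= [X in _ + X]big1 ?addr0.
      by rewrite enum_rankK_in // eqxx mul1r.
    move=> a ap; case: eqP => [E|]; last by rewrite mul0r.
    by case/eqP: ap; apply: enum_val_inj; rewrite enum_rankK_in.
  rewrite big1 ?mul0rn // => a _; case: eqP => [E|]; last by rewrite mul0r.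
  by have := enum_valP a; rewrite E; move: nP; rewrite unfold_in => /negP.
apply/eqP; rewrite eqn_leq; apply/andP; split.
  by rewrite UE (leq_trans (mxrankM_maxr _ _)) ?rank_leq_row.
have <- : \rank (M *m (M^T *m M) *m M^T) = #|P|.
  by rewrite !mulmxA MM mul1mx MM mxrank1.
by rewrite -UE (leq_trans (mxrankM_maxl _ _)) // mxrankM_maxr.
Qed.

End PolyEval.

(** * The matrices e + t, with t in the space t *)

Section CommonEigenvalues.
Context {K : fieldType} {delta : nat} (lam : 'I_delta -> nat).
Local Notation N := (\sum_(i < delta) lam i)%N.
Implicit Types (p q r : 'I_N) (x y t u v w : 'M[K]_N).
Local Notation e := (e_mx lam : 'M[K]_N).

Lemma blk_Rank i (j : 'I_(lam i)) : blk (tagnat.Rank i j) = i.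
Proof. exact: tagnat.Rank1K. Qed.

Lemma pos_Rank i (j : 'I_(lam i)) : pos (tagnat.Rank i j) = j.+1.
Proof. by rewrite /pos tagnat.Rank2K. Qed.

(** The elements of the space t are parametrized by the common sequence tau of the eigenvalues
of the blocks, see [t_space_tau_mx]. *)
Definition tau_mx (tau : nat -> K) : 'M[K]_N := diag_mx (\row_p tau (pos p).-1).

Lemma tau_mx_t_space tau : t_space (tau_mx tau).
Proof.
split=> [|i i' j j' _ jj']; first exact: diag_mx_is_diag.
by rewrite /diag_entry !mxE !eqxx !mulr1n /pos /= !tagnat.Rank2K /= jj'.
Qed.

Lemma diag_entryE t p i (j : 'I_(lam i)) : blk p = i -> pos p = j.+1 ->
  diag_entry t j = t p p.
Proof.
move=> bp sp; rewrite /diag_entry; suff -> : tagnat.Rank i j = p by [].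
by apply: pos_inj; rewrite ?sp ?bp /blk /pos ?tagnat.Rank1K ?tagnat.Rank2K.
Qed.

Lemma t_space_tau_mx t : t_space t -> exists tau, t = tau_mx tau.
Proof.
move=> [dt tP]; exists (fun j => if [pick p : 'I_N | pos p == j.+1] is Some p then t p p else 0).
have tpq p q : pos p = pos q -> t p p = t q q.
  move=> pq; have H r : t r r = diag_entry t (tagnat.sig2 r).
    by rewrite (@diag_entryE _ r).
  wlog le : p q pq / (blk p <= blk q)%N.
    move=> W; case: (leqP (blk p) (blk q)) => [|/ltnW] le; first exact: W.
    by rewrite (W q p).
  by rewrite (H p) (H q); apply: tP => //; case: pq.
apply/matrixP=> p q; rewrite !mxE; have [<-|pq] := eqVneq p q; last first.
  by move/is_diag_mxP: dt => ->.
case: pickP => [r /eqP rE|/(_ p)]; last by rewrite prednK ?eqxx.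
by rewrite mulr1n; apply: tpq; rewrite rE prednK.
Qed.

Lemma fil_tau_mx tau : fil 0 (tau_mx tau).
Proof. exact: fil_diag (proj1 (tau_mx_t_space tau)). Qed.

(** Modulo lower degree, y = e + (degree at most 0) may be replaced by e, so R(y) has the leading
term of R(e). *)
Lemma peval_lead x (P : {poly K}) m : fil 0 (x - e) -> (size P <= m.+1)%N ->
  fil (m%:Z - 1) (peval x P - P`_m *: e ^+ m).
Proof.
move=> fx sP; rewrite (pevalE _ sP) big_ord_recr /= -addrA -scalerBr.
apply: filD; last by apply: filZ; exact: fil_pow_lead.
apply: fil_sum => i _; apply: filZ; rewrite -[x ^+ i](subrK (e ^+ i)).
have im := ltn_ord i.
apply: filD; first by apply: fil_le (fil_pow_lead (k := i) fx); lia.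
by apply: fil_le (filX (k := i) (@fil_e K _ lam)); rewrite -mulr_natr; lia.
Qed.

Lemma fil_peval x (P : {poly K}) m : fil 0 (x - e) -> (size P <= m.+1)%N ->
  fil m%:Z (peval x P).
Proof.
move=> fx sP; rewrite -[peval _ _](subrK (P`_m *: e ^+ m)); apply: filD.
  by apply: fil_le (peval_lead fx sP); lia.
by apply: filZ; apply: fil_le (filX (k := m) (@fil_e K _ lam)); rewrite -mulr_natr; lia.
Qed.

Lemma e_pow_entry m p q : (e ^+ m) p q = ((blk p == blk q) && (pos p + m == pos q)%N)%:R.
Proof.
rewrite -[e ^+ m]mulmx1; have [le|lt] := leqP (pos p + m) (lam (blk p)).
  have [|r br pr] := @idx_exists _ lam (blk p) (pos p + m); first by have := pos_gt0 p; lia.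
  by rewrite (e_pow_mul _ _ br pr) mxE eq_idx br pr.
rewrite e_pow_mul_out //; case: andP => // [[/eqP b /eqP E]].
by have := pos_le q; rewrite -b -E; lia.
Qed.

(** The projector onto the source of e^d, see [short_mx_peval]. *)
Definition short_mx d : 'M[K]_N := diag_mx (\row_p (pos p + d <= lam (blk p))%N%:R).

Lemma sum_idx_nat (F : 'I_N -> nat) :
  (\sum_p F p = \sum_i \sum_(j < lam i) F (tagnat.Rank i j))%N.
Proof.
rewrite sig_big_dep (reindex _ tagnat.sig_bij_on) /=.
by apply: eq_bigr => p _; rewrite tagnat.sig2K.
Qed.

Lemma count_gt k l : (\sum_(j < l) (k < j.+1)%N = l - k)%N.
Proof.
elim: l => [|l IH]; first by rewrite big_ord0.
by rewrite big_ord_recr IH /=; case: ltnP => /=; lia.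
Qed.

Lemma count_le d l : (\sum_(j < l) (j.+1 + d <= l)%N = l - d)%N.
Proof.
rewrite -(count_gt d) [RHS](reindex_inj rev_ord_inj) /=.
by apply: eq_bigr => j _; congr nat_of_bool; have := ltn_ord j; lia.
Qed.

Lemma rank_short_mx d : \rank (short_mx d) = (\sum_i (lam i - d))%N.
Proof.
rewrite (rank_indicator_mx (fun p : 'I_N => pos p + d <= lam (blk p))%N).
rewrite -sum1_card big_mkcond sum_idx_nat; apply: eq_bigr => i _.
rewrite -count_le; apply: eq_bigr => j _.
by rewrite unfold_in pos_Rank blk_Rank; case: leqP.
Qed.

Definition tail_mx d : 'M[K]_N := diag_mx (\row_p (d < pos p)%N%:R).

Lemma rank_tail_mx d : \rank (tail_mx d) = (\sum_i (lam i - d))%N.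
Proof.
rewrite (rank_indicator_mx (fun p : 'I_N => d < pos p)%N).
rewrite -sum1_card big_mkcond sum_idx_nat; apply: eq_bigr => i _.
rewrite -count_gt; apply: eq_bigr => j _.
by rewrite unfold_in pos_Rank; case: ltnP.
Qed.

(** A row vector v with v (1 + x) = 0 satisfies v = v (- x)^k for all k, and x is nilpotent. *)
Lemma unipotent_unit x : fil (-1) x -> 1%:M + x \in unitmx.
Proof.
move=> fx; rewrite -row_free_unit; apply/inj_row_free => v.
rewrite mulmxDr mulmx1 => /eqP; rewrite addr_eq0 => /eqP vE.
have H k : v = v *m (- x) ^+ k.
  elim: k => [|k IH]; first by rewrite mulmx1.
  by rewrite exprS mulmxA mulmxN -vE -IH.
by rewrite (H N) (fil_nilp (filN fx)) mulmx0.
Qed.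

Lemma fil_shift : fil (-1) (e^T).
Proof.
move=> p q; rewrite mxE e_entry; case: andP => [[/eqP -> /eqP <-]|]; rewrite ?eqxx //.
Qed.

Lemma short_mx_peval x (R : {poly K}) d : fil 0 (x - e) -> R \is monic -> size R = d.+1 ->
  exists2 L, fil (-1) L & peval x R *m (e^T) ^+ d = short_mx d + L.
Proof.
move=> fx Rm sR; have Rd : R`_d = 1 by move/monicP: Rm; rewrite lead_coefE sR.
have fl := peval_lead fx (eq_leq sR); rewrite Rd scale1r in fl.
exists ((peval x R - e ^+ d) *m (e^T) ^+ d).
  apply: fil_le (filM fl (filX (k := d) fil_shift)).
  by rewrite -mulr_natr; lia.
have -> : short_mx d = e ^+ d *m (e^T) ^+ d.
  have -> : (e^T) ^+ d = (e ^+ d)^T.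
    by elim: (d) => [|k IH]; [rewrite trmx1|rewrite exprS exprSr trmx_mul IH].
  apply/matrixP=> p q; have [le|lt] := leqP (pos p + d) (lam (blk p)).
    have [|r br pr] := @idx_exists _ lam (blk p) (pos p + d); first by have := pos_gt0 p; lia.
    rewrite (e_pow_mul _ _ br pr) [RHS]mxE e_pow_entry br pr !mxE le.
    by rewrite eqn_add2r [blk q == _]eq_sym [pos q == _]eq_sym -eq_idx.
  by rewrite e_pow_mul_out // !mxE leqNgt lt mul0rn.
by rewrite mulmxBl [RHS]addrC subrK.
Qed.

(** Multiplied by the transpose of e^d, the matrix R(x) has the projector [short_mx d] as
leading part of degree 0, so it has at least the rank of that projector. *)
Lemma rank_peval_ge x (R : {poly K}) d : fil 0 (x - e) -> R \is monic -> size R = d.+1 ->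
  (\sum_i (lam i - d) <= \rank (peval x R))%N.
Proof.
move=> fx Rm sR; have [L fL E] := short_mx_peval fx Rm sR.
have SS : short_mx d *m short_mx d = short_mx d.
  rewrite mulmx_diag; congr diag_mx; apply/rowP=> p; rewrite !mxE.
  by case: leqP; rewrite ?mulr1 ?mulr0.
have -> : (\sum_i (lam i - d))%N = \rank (short_mx d *m (1%:M + L)).
  by rewrite mxrankMfree ?rank_short_mx // row_free_unit unipotent_unit.
rewrite (_ : _ *m (1%:M + L) = short_mx d *m (peval x R *m (e^T) ^+ d)).
  by rewrite (leq_trans (mxrankM_maxr _ _)) // mxrankM_maxl.
by rewrite E mulmxDr mulmx1 [RHS]mulmxDr SS.
Qed.

End CommonEigenvalues.
Arguments tau_mx {K delta lam} tau.
Arguments short_mx {K delta lam} d.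
Arguments tail_mx {K delta lam} d.

(** * Invariant factors of e + t, and orbits that meet p *)

Section ConjugacyInvariants.
Context {K : fieldType} {delta : nat} (lam : 'I_delta -> nat).
Local Notation N := (\sum_(i < delta) lam i)%N.
Implicit Types (p q r : 'I_N) (x y t u v w : 'M[K]_N).
Local Notation e := (e_mx lam : 'M[K]_N).

Lemma fil_e_tau_mx tau : fil 0 (e + tau_mx tau - e).
Proof. by rewrite addrC addKr; exact: fil_tau_mx. Qed.

Section Tau.
Variable tau : nat -> K.
Let x : 'M[K]_N := e + tau_mx tau.

(** On rows, P_k(x) maps every basis vector into the span of those of position above k: the
factor x - tau_k removes the position k itself. *)
Lemma prefix_entries k p q : peval x (prefix_poly tau k) p q != 0 ->
  blk p = blk q /\ (k < pos q)%N.
Proof.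
elim: k q => [|k IH] q.
  rewrite /prefix_poly big_ord0 peval1 mxE.
  by case: (p =P q) => [->|]; rewrite ?eqxx.
rewrite peval_prefix_polyS => /mulmx_neq0[r /IH[-> kr]].
rewrite mxE [x _ _]mxE e_entry !mxE.
case: andP => [[/eqP -> /eqP <-] //|_]; rewrite add0r.
have [<-|_] := eqVneq r q; last by rewrite !mulr0n subrr eqxx.
rewrite !mulr1n subr_eq0 => ne; split=> //; rewrite ltn_neqAle kr andbT.
by apply: contraNneq ne => E; rewrite -E.
Qed.

Lemma prefix_row0 k p q : (lam (blk p) <= k)%N -> peval x (prefix_poly tau k) p q = 0.
Proof.
move=> lk; apply/eqP/negPn/negP => /prefix_entries[b]; have := pos_le q.
by rewrite -b; lia.
Qed.

(** The lower bound of [rank_peval_ge] is attained by P_k, so P_k is a polynomial of degree k of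
minimal rank at x. *)
Lemma rank_prefix k : \rank (peval x (prefix_poly tau k)) = (\sum_i (lam i - k))%N.
Proof.
apply/eqP; rewrite eqn_leq rank_peval_ge ?prefix_poly_monic ?size_prefix_poly //; last first.
  exact: fil_e_tau_mx.
rewrite andbT -(@rank_tail_mx K) (_ : peval _ _ = peval x (prefix_poly tau k) *m tail_mx k).
  exact: mxrankM_maxr.
apply/matrixP=> p q; rewrite mul_mx_diag !mxE.
have [->|/prefix_entries[_ ->]] := eqVneq (peval x (prefix_poly tau k) p q) 0.
  by rewrite mul0r.
by rewrite mulr1.
Qed.

End Tau.

(** Put R = P'_(lam_i), of degree d = lam_i. Its rank at x is the minimum allowed by
[rank_peval_ge], because it is so at the conjugate e + t'. That minimum is already reached
on the blocks other than i, so R(x) vanishes on block i. Both R and P_(lam_i) then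
annihilate the cyclic vector of block i; being monic of degree lam_i, they are equal. *)
Lemma conj_prefix_poly tau tau' (A : 'M[K]_N) i : A \in unitmx ->
  A *m (e + tau_mx tau) = (e + tau_mx tau') *m A ->
  prefix_poly tau (lam i) = prefix_poly tau' (lam i).
Proof.
move=> AU AE; case: (posnP (lam i)) => [-> | li0]; first by rewrite /prefix_poly !big_ord0.
set d := lam i; set R := prefix_poly tau' d; set x := e + tau_mx tau in AE.
have fx : fil 0 (x - e) by exact: fil_e_tau_mx.
have sR : size R = d.+1 by exact: size_prefix_poly.
have Rm : R \is monic by exact: prefix_poly_monic.
have rR : \rank (peval x R) = (\sum_i (lam i - d))%N.
  rewrite -(rank_prefix tau' d) -(mxrankMfree (peval (e + tau_mx tau') R) (B := A)); last first.
    by rewrite row_free_unit.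
  by rewrite -(peval_comm R AE) eqmxMfull // row_full_unit.
set B := peval x R in rR.
have fB : fil d%:Z B by apply: fil_peval => //; rewrite sR.
have [L fL LE] := short_mx_peval fx Rm sR.
have BC : (1%:M - pi_mx i) *m B = B *m (1%:M - pi_mx i).
  by rewrite mulmxBl mulmxBr mul1mx mulmx1 (block_diag_pi _ (fil_block_diag fB)).
(* short_mx d is zero on block i, as lam_i = d, so removing this block from B costs no rank. *)
have rB : (\rank B <= \rank (B *m (1%:M - pi_mx i)))%N.
  rewrite rR -(@rank_short_mx K) -(mxrankMfree _ (B := 1%:M + L)); last first.
    by rewrite row_free_unit unipotent_unit.
  have SP : short_mx d *m (1%:M - pi_mx i) = short_mx d :> 'M[K]_N.
    rewrite mulmxBr mulmx1 mulmx_diag [X in _ - X](_ : _ = 0) ?subr0 //.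
    apply/matrixP=> p q; rewrite !mxE; case: (blk p =P i) => [b|_]; last by rewrite mulr0 mul0rn.
    rewrite b (_ : (_ <= _)%N = false) ?mul0r ?mul0rn //.
    by apply/negbTE; rewrite -ltnNge /d; have := pos_gt0 p; lia.
  have SS : short_mx d *m short_mx d = short_mx d :> 'M[K]_N.
    rewrite mulmx_diag; congr diag_mx; apply/rowP=> p; rewrite !mxE.
    by case: leqP; rewrite ?mulr1 ?mulr0.
  rewrite (_ : _ *m (1%:M + L) = short_mx d *m (B *m (1%:M - pi_mx i) *m (e^T) ^+ d)).
    by rewrite (leq_trans (mxrankM_maxr _ _)) // mxrankM_maxl.
  by rewrite -BC -!mulmxA LE mulmxA SP mulmxDr mulmx1 [RHS]mulmxDr SS.
have pB0 : pi_mx i *m B = 0.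
  apply/eqP; rewrite -submx0 (block_diag_pi _ (fil_block_diag fB)).
  have /eqP : (\rank (B *m (1%:M - pi_mx i)) + \rank (B :&: kermx (1%:M - pi_mx i)) = \rank B)%N.
    exact: mxrank_mul_ker.
  move=> E; have : \rank (B :&: kermx (1%:M - pi_mx i)) = 0%N by lia.
  move/eqP; rewrite mxrank_eq0 => /eqP <-; rewrite sub_capmx -{1}(block_diag_pi _ (fil_block_diag fB)) submxMl.
  apply/sub_kermxP; rewrite -mulmxA mulmxBr mulmx1 mulmx_diag.
  rewrite [X in B *m X](_ : _ = 0) ?mulmx0 //.
  rewrite [X in _ - X](_ : _ = pi_mx i) ?subrr //; congr diag_mx; apply/rowP=> p.
  by rewrite !mxE; case: eqP; rewrite ?mulr1 ?mulr0.
have [|p1 b1 s1] := @idx_exists _ lam i 1; first by rewrite li0.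
have B0 q : B p1 q = 0.
  by move/matrixP/(_ p1 q): pB0; rewrite mul_diag_mx !mxE b1 eqxx mul1r.
have P0 q : peval x (prefix_poly tau d) p1 q = 0 by apply: prefix_row0; rewrite b1.
apply/eqP; rewrite -subr_eq0; apply/eqP; set D := _ - _.
have D0 q : peval x D p1 q = 0 by rewrite pevalB mxE P0 mxE B0 subrr.
have sD : (size D <= d)%N.
  apply/leq_sizeP => j dj; rewrite coefB; have [<-|ne] := eqVneq d j.
    move/monicP: (prefix_poly_monic tau d); move/monicP: Rm.
    by rewrite !lead_coefE sR size_prefix_poly /= => -> ->; rewrite subrr.
  by rewrite !nth_default ?subrr // ?sR ?size_prefix_poly; lia.
apply/eqP; rewrite -size_poly_eq0; case E : (size D) => [//|m].
exfalso; have mD : D`_m != 0.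
  have : lead_coef D != 0 by rewrite lead_coef_eq0 -size_poly_eq0 E.
  by rewrite lead_coefE E.
have [|q bq sq] := @idx_exists _ lam i (1 + m); first by move: sD; rewrite E /d; lia.
have /(_ p1 q) := peval_lead fx (eq_leq E); rewrite mxE D0 add0r 2!mxE.
rewrite e_pow_entry b1 bq s1 sq !eqxx mulr1 oppr_eq0 => /(_ mD)[_].
by lia.
Qed.

Lemma mult_prefix tau i c :
  mult (tau_mx tau : 'M[K]_N) i c = count_mem c (mkseq tau (lam i)).
Proof.
rewrite /mult -sum1_card /mkseq count_map -sum1_count -val_enum_ord big_map big_enum_cond /=.
apply: eq_bigl => j; rewrite !inE /= (diag_entryE _ (blk_Rank j) (pos_Rank j)).
by rewrite !mxE eqxx mulr1n pos_Rank.
Qed.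

(** The sign changes sa (on V_a and V_b) and sgn_mx (on the positions) turn y into - y and
e - t into - (e + t), so a suitable product conjugates e + t to e - t. *)
Lemma p_orbit_mult t Phi y : t_space t -> Gorbit (e + t) y -> p_space Phi y ->
  forall c i, mult t i c = mult t i (- c).
Proof.
move=> /t_space_tau_mx[tau ->] [g gU [_ -> yE]] /p_spaceP py c i.
pose sa : 'M[K]_N := diag_mx (\row_p (if in_a Phi p then 1 else -1)).
have sasa : sa *m sa = 1%:M.
  rewrite mulmx_diag -diag_const_mx; congr diag_mx; apply/rowP=> p; rewrite !mxE.
  by case: in_a; rewrite ?mulr1 ?mulrNN ?mulr1.
have say : sa *m y = - y *m sa.
  apply/matrixP=> p q; rewrite mul_diag_mx mul_mx_diag !mxE.
  have [E|/eqP] := eqVneq (in_a Phi p) (in_a Phi q); first by rewrite (py _ _ E) oppr0 !mulr0 mul0r.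
  by case: in_a; case: in_a => // _; ring.
have [saU _] := mulmx1_unit sasa; have [sgU _] := mulmx1_unit (sgn_sq lam (K := K)).
pose x : 'M[K]_N := e + tau_mx tau; pose tau' j := - tau j.
have x'E : sgn_mx lam *m (- x) = (e + tau_mx tau') *m sgn_mx lam.
  rewrite -[sgn_mx lam *m - x]mulmx1 -(sgn_sq lam) mulmxA; congr (_ *m _).
  rewrite mulmxN mulNmx mulmxDr mulmxDl sgn_e opprD opprK; congr (_ + _).
  apply/matrixP=> p q; rewrite mxE sgn_conj !mxE; have [<-|] := eqVneq p q;
    last by rewrite !mulr0n mulr0 oppr0.
  by rewrite addnn -mul2n exprM sqrrN !expr1n mul1r !mulr1n.
(* A conjugates e + t to y, then to - y by sa, back to - (e + t), and finally to e - t. *)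
pose A := sgn_mx lam *m invmx g *m sa *m g.
have AU : A \in unitmx by rewrite !unitmx_mul unitmx_inv gU saU sgU.
have AE : A *m x = (e + tau_mx tau') *m A.
  rewrite /A !mulmxA -x'E -!mulmxA; congr (_ *m _).
  have gx : g *m x = y *m g by rewrite yE -!mulmxA mulVmx ?mulmx1.
  rewrite gx [sa *m (y *m g)]mulmxA say !mulNmx mulmxN; congr (- _).
  have gy : invmx g *m y = x *m invmx g by rewrite yE !mulmxA mulVmx // mul1mx.
  by rewrite !mulmxA gy.
have := conj_prefix_poly i AU AE.
have pE s : prefix_poly s (lam i) = \prod_(a <- mkseq s (lam i)) ('X - a%:P).
  by rewrite /prefix_poly /mkseq big_map -[in RHS](subn0 (lam i)) big_mkord.
rewrite !pE => /prod_XsubC_eq pm; rewrite !mult_prefix (permP pm).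
rewrite /mkseq !count_map; apply: eq_count => j /=.
by rewrite /tau' eqr_oppLR.
Qed.

End ConjugacyInvariants.

(** * Polynomial functions of one and of several variables *)

Section PolynomialTools.
Context {K : fieldType}.
Hypothesis charK0 : [pchar K] =i pred0.

Lemma natr_inj : injective (fun i : nat => i%:R : K).
Proof.
have W i j : (i <= j)%N -> i%:R = j%:R :> K -> i = j.
  move=> ij /eqP; rewrite eq_sym -subr_eq0 -natrB // => E; apply/eqP; rewrite eqn_leq ij /=.
  by rewrite leqNgt; apply/negP => lt; move: E; apply/negP; apply: natr_neq0 => //; rewrite subn_gt0.
move=> i j E; case: (leqP i j) => [|/ltnW] le; first exact: W.
by apply/esym/W.
Qed.

(** K contains the natural numbers, more than the polynomial has roots. *)
Lemma poly_nonroot (P : {poly K}) : P != 0 -> exists c, P.[c] != 0.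
Proof.
move=> P0; apply: contrapT => nP.
pose rs := [seq i%:R : K | i <- iota 0 (size P)].
have rsP : all (root P) rs.
  by apply/allP => c _; apply/negPn/negP => Pc; apply: nP; exists c.
have urs : uniq rs by rewrite map_inj_uniq ?iota_uniq //; exact: natr_inj.
by have := max_poly_roots P0 rsP urs; rewrite size_map size_iota ltnn.
Qed.

Lemma poly_eq0_fun (P : {poly K}) : (forall c, P.[c] = 0) -> P = 0.
Proof.
move=> P0; apply/eqP/negPn/negP => /poly_nonroot[c]; by rewrite P0 eqxx.
Qed.

Lemma base_digits_inj B r (a b : nat -> nat) :
  (forall i, (i < r)%N -> (a i < B)%N) -> (forall i, (i < r)%N -> (b i < B)%N) ->
  (\sum_(i < r) a i * B ^ i = \sum_(i < r) b i * B ^ i)%N ->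
  forall i, (i < r)%N -> a i = b i.
Proof.
elim: r a b => // r IH a b aB bB.
have shift (c : nat -> nat) : (\sum_(i < r.+1) c i * B ^ i
     = c 0%N + (\sum_(i < r) c i.+1 * B ^ i) * B)%N.
  rewrite big_ord_recl expn0 muln1 big_distrl; congr (_ + _)%N; apply: eq_bigr => i _.
  by rewrite lift0 expnS mulnCA mulnC.
rewrite !shift => E.
have E0 : a 0%N = b 0%N.
  have /(congr1 (fun m => m %% B)%N) := E.
  by rewrite ![(_ + _ * B)%N]addnC !modnMDl !modn_small ?aB ?bB.
have B0 : (0 < B)%N by apply: leq_ltn_trans (aB 0%N _).
move: E; rewrite E0 => /addnI/eqP; rewrite eqn_pmul2r // => /eqP E.
have H := IH (fun i => a i.+1) (fun i => b i.+1) _ _ E.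
case=> // i ir; apply: H => // j jr; [exact: aB|exact: bB].
Qed.

(** Kronecker substitution: X_i is replaced by the power B^i of one variable, with B above all
exponents, which keeps distinct monomials distinct. *)
Lemma mpoly_nonroot r (P : {mpoly K[r]}) : P != 0 -> exists s, P.@[s] != 0.
Proof.
move=> P0; pose B := msize P.
pose phi (m : 'X_{1..r}) := (\sum_(i < r) m i * B ^ i)%N.
have phi_inj m m' : m \in msupp P -> m' \in msupp P -> phi m = phi m' -> m = m'.
  move=> mP mP' E; apply/mnmP => i.
  pose d (mm : 'X_{1..r}) j := if insub j is Some j' then mm j' else 0%N.
  have dE mm (j : 'I_r) : d mm j = mm j by rewrite /d valK.
  have dB mm j : mm \in msupp P -> (j < r)%N -> (d mm j < B)%N.
    move=> mmP jr; rewrite -[j]/(val (Ordinal jr)) dE; apply: leq_ltn_trans (msize_mdeg_lt mmP).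
    by rewrite mdegE (bigD1 (Ordinal jr)) //= leq_addr.
  rewrite -!dE; apply: (@base_digits_inj B r) => // [j|j|]; [exact: dB|exact: dB|].
  by under eq_bigr => j _ do rewrite dE; under [in RHS]eq_bigr => j _ do rewrite dE.
pose Q : {poly K} := \sum_(m <- msupp P) P@_m *: 'X^(phi m).
have QE c : Q.[c] = P.@[fun i => c ^+ (B ^ i)].
  rewrite mevalE horner_sum; apply: eq_bigr => m _; rewrite hornerZ hornerXn; congr (_ * _).
  rewrite /phi expr_sum; apply: eq_bigr => i _; by rewrite mulnC exprM.
suff Q0 : Q != 0 by have [c] := poly_nonroot Q0; rewrite QE; exists (fun i => c ^+ (B ^ i)).
have : msupp P != [::] by rewrite msupp_eq0.
case E : (msupp P) => [//|m0 s] _; have m0P : m0 \in msupp P by rewrite E mem_head.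
apply/eqP => /(congr1 (fun R : {poly K} => R`_(phi m0))) /eqP.
rewrite coef0 coef_sum (bigD1_seq m0) ?msupp_uniq //= [X in _ + X]big1_seq ?addr0.
  by rewrite coefZ coefXn eqxx mulr1 (negPf (_ : P@_m0 != 0)) // -mcoeff_msupp.
move=> m /andP[mm0 mP]; rewrite coefZ coefXn; case: eqP => [/phi_inj H|]; last by rewrite mulr0.
by rewrite H ?eqxx in mm0.
Qed.

Lemma msizeM_le r (P Q : {mpoly K[r]}) : (msize (P * Q) <= (msize P + msize Q).-1)%N.
Proof.
have [->|P0] := eqVneq P 0; first by rewrite mul0r msize0.
have [->|Q0] := eqVneq Q 0; first by rewrite mulr0 msize0.
by rewrite msizeM.
Qed.

(** There are B^d monomials with exponents below B in d variables. Evaluated at the G_i / D0 and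
multiplied by a fixed power of D0, they become polynomials in r variables of degree below
a constant multiple E of B, which span a space of dimension at most E^r. For large B this
is less than B^d, and a linear relation is the required P. *)
Lemma counting_relation r d (G : 'I_d -> {mpoly K[r]}) (D0 : {mpoly K[r]}) :
  (r < d)%N -> exists2 P : {mpoly K[d]}, P != 0 &
   forall s, D0.@[s] != 0 -> P.@[fun i => (G i).@[s] / D0.@[s]] = 0.
Proof.
move=> rd; pose c := (msize D0 + \sum_i msize (G i))%N.
have cG i : (msize (G i) <= c.+1)%N by rewrite /c (bigD1 i) //=; lia.
have cD : (msize D0 <= c.+1)%N by rewrite /c; lia.
(* With these choices E <= (d c + 1) B, so E^r < B^(r+1). *)
pose B := ((d * c).+1 ^ r).+1.
pose E := (d * B * c).+1.
have count : (E ^ r < B ^ d)%N.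
  apply: (@leq_trans (B ^ r.+1)); last by rewrite leq_exp2l // /B ltnS expn_gt0.
  have EB : (E <= (d * c).+1 * B)%N by rewrite /E mulSn mulnAC -[(_).+1]addn1 addnC leq_add2r.
  have [->|r0] := posnP r; first by rewrite expn0 expn1 /B ltnS expn_gt0.
  apply: (@leq_ltn_trans (((d * c).+1 * B) ^ r)); first by rewrite leq_exp2r.
  by rewrite expnMn expnS ltn_pmul2r // expn_gt0.
pose A := {ffun 'I_d -> 'I_B}; pose T := {ffun 'I_r -> 'I_E}.
pose tot (a : A) := (\sum_i a i)%N.
have totB a : (tot a <= d * B)%N.
  rewrite /tot -[d in (d * B)%N]card_ord -sum_nat_const; apply: leq_sum => i _.
  exact: ltnW.
pose H (a : A) := \prod_i G i ^+ a i * D0 ^+ (d * B - tot a).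
have msizeX (Q : {mpoly K[r]}) k : (msize Q <= c.+1)%N -> (msize (Q ^+ k) <= (k * c).+1)%N.
  move=> Qc; elim: k => [|k IH]; first by rewrite expr0 msize1.
  by rewrite exprS (leq_trans (msizeM_le _ _)) // mulSn; lia.
have msizeP (a : A) (s : seq 'I_d) : (msize (\prod_(i <- s) G i ^+ a i) <= (\sum_(i <- s) a i * c).+1)%N.
  elim: s => [|i s IH]; first by rewrite !big_nil msize1.
  rewrite !big_cons (leq_trans (msizeM_le _ _)) //; have := msizeX _ (a i) (cG i); lia.
have HE a : (msize (H a) <= E)%N.
  rewrite /H (leq_trans (msizeM_le _ _)) //.
  have := msizeP a (index_enum _); rewrite -big_distrl /= -/(tot a) => h1.
  have := msizeX _ (d * B - tot a)%N cD => h2.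
  have h3 : (tot a * c <= d * B * c)%N by rewrite leq_mul2r totB orbT.
  move: h1 h2 h3; rewrite mulnBl /E.
  by move: (msize _) (msize _) (tot a * c)%N (d * B * c)%N => u1 u2 u3 u4; lia.
pose M : 'M[K]_(#|A|, #|T|) :=
  \matrix_(a, b) (H (enum_val a))@_[multinom (enum_val b : T) i : nat | i < r].
have : kermx M != 0.
  rewrite -mxrank_eq0 mxrank_ker subn_eq0 -ltnNge.
  by rewrite (leq_ltn_trans (rank_leq_col M)) // !card_ffun !card_ord.
move=> /rowV0Pn[v /sub_kermxP vM v0].
pose mn (a : A) : 'X_{1..d} := [multinom (a i : nat) | i < d].
have mn_inj : injective mn.
  by move=> a b /mnmP E'; apply/ffunP => i; apply: val_inj; have := E' i; rewrite !mnmE.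
pose P : {mpoly K[d]} := \sum_a v 0 (enum_rank a) *: 'X_[mn a].
have PE a : P@_(mn a) = v 0 (enum_rank a).
  rewrite /P raddf_sum (bigD1 a) //= [X in _ + X]big1 ?addr0 => [|b ba].
    by rewrite mcoeffZ mcoeffX eqxx mulr1.
  by rewrite mcoeffZ mcoeffX (inj_eq mn_inj) (negPf ba) mulr0.
exists P.
  apply: contraNneq v0 => P0; apply/eqP/rowP => j; rewrite mxE.
  by rewrite -(enum_valK j) -PE P0 mcoeff0.
have S0 : \sum_a v 0 (enum_rank a) *: H a = 0.
  apply/mpolyP => m; rewrite mcoeff0 raddf_sum /=.
  have [mE|] := boolP [forall i, m i < E]%N; last first.
    rewrite negb_forall => /existsP[i]; rewrite -leqNgt => mi.
    apply: big1 => a _; rewrite mcoeffZ; suff /eqP -> : (H a)@_m == 0 by rewrite mulr0.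
    rewrite mcoeff_eq0; apply: msize_mdeg_ge; apply: leq_trans (HE a) (leq_trans mi _).
    by rewrite mdegE (bigD1 i) //= leq_addr.
  pose b : T := [ffun i => Ordinal (forallP mE i)].
  move/rowP/(_ (enum_rank b)): vM; rewrite !mxE => vM; rewrite -[RHS]vM.
  rewrite (reindex (fun k : 'I_#|A| => enum_val k)) /=; last by apply: onW_bij; exact: enum_val_bij.
  apply: eq_bigr => a _; rewrite mcoeffZ mxE enum_valK enum_rankK; congr (_ * _@__).
  by apply/mnmP => i; rewrite mnmE ffunE.
move=> s Ds0; apply: (mulfI (expf_neq0 (d * B) Ds0)); rewrite mulr0.
rewrite -[RHS](meval0 s) -S0 !raddf_sum /= mulr_sumr; apply: eq_bigr => a _.
rewrite !mevalZ mulrCA; congr (_ * _); rewrite mevalX /H mevalM rmorph_prod /= rmorphXn /=.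
rewrite -{1}(subnK (totB a)) exprD -mulrA mulrC; congr (_ * _).
rewrite /tot expr_sum -big_split /=; apply: eq_bigr => i _.
by rewrite rmorphXn mnmE expr_div_n mulrC divfK // expf_neq0.
Qed.

(** A polynomial in the entries of g y g^(-1) becomes polynomial in g and y after multiplication
by a power of det g, since g^(-1) = adj g / det g. The coefficients are taken in an
arbitrary ring R', so that the statement applies to polynomial families of matrices. *)
Lemma eval_conj (R' : comNzRingType) (kappa : {rmorphism K -> R'}) n
    (g y : 'M[R']_n) (Q : {mpoly K[n * n]}) : exists p : R', exists M : nat,
  forall ev : {rmorphism R' -> K}, (forall c, ev (kappa c) = c) -> ev (\det g) != 0 ->
  evalm (map_mx ev g *m map_mx ev y *m invmx (map_mx ev g)) Q * ev (\det g) ^+ M = ev p.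
Proof.
pose z := g *m y *m \adj g.
exists (\sum_(m <- msupp Q) kappa Q@_m * \det g ^+ (msize Q - mdeg m)
         * \prod_i (mxvec z 0 i) ^+ m i).
exists (msize Q) => ev evK dg0; set d := ev (\det g) in dg0 *.
have gU : map_mx ev g \in unitmx by rewrite unitmxE det_map_mx unitfE.
have conjE : map_mx ev g *m map_mx ev y *m invmx (map_mx ev g) = d^-1 *: map_mx ev z.
  by rewrite /invmx gU det_map_mx -/d -scalemxAr !map_mxM map_mx_adj.
clearbody z. rewrite conjE /evalm mevalE mulr_suml rmorph_sum big_seq [RHS]big_seq; apply: eq_bigr => m mQ.
rewrite !rmorphM evK rmorphXn rmorph_prod -/d -!mulrA; congr (_ * _).
have mM : (mdeg m <= msize Q)%N by exact: (ltnW (msize_mdeg_lt mQ)).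
rewrite -{1}(subnK mM) exprD mulrCA; congr (_ * _).
rewrite {1}mdegE expr_sum -big_split /=; apply: eq_bigr => i _.
have -> : mxvec (d^-1 *: map_mx ev z) 0 i = d^-1 * ev (mxvec z 0 i).
  by rewrite linearZ /= -map_mxvec mxE; congr (_ * _); rewrite mxE.
rewrite rmorphXn exprMn exprVn mulrAC.
by rewrite mulVf ?mul1r // expf_neq0.
Qed.

Section AdjointRank.
Variable n : nat.
Implicit Types (x y g u : 'M[K]_n).

(** The matrix of ad x on row vectors of length n^2. *)
Definition ad_mx x : 'M[K]_(n * n) := lin_mulmx x - lin_mulmxr x.

Lemma ad_mxE x u : mxvec u *m ad_mx x = mxvec (lie x u).
Proof. by rewrite /ad_mx mulmxBr !mul_vec_lin /= -linearB. Qed.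

(** U and C come from a rank factorization of A: U A C = 1 says that U and C cut out a part of A
of full rank, and C U is a generalized inverse of A. *)
Lemma rank_factor m k (A : 'M[K]_(m, k)) : exists U : 'M[K]_(\rank A, m),
  exists C : 'M[K]_(k, \rank A), U *m A *m C = 1%:M /\ A *m C *m U *m A = A.
Proof.
pose L := col_base A; pose R := row_base A.
have A_E : A = L *m R by rewrite mulmx_base.
pose C := pinvmx R.
have RC : R *m C = 1%:M by rewrite mulmxVp // row_base_free.
pose U := (pinvmx L^T)^T.
have UL : U *m L = 1%:M.
  apply: (can_inj trmxK); rewrite trmx_mul trmxK trmx1 mulmxVp //.
  by rewrite /row_free mxrank_tr; have := col_base_full A; rewrite /row_full.
have UA : U *m A = R.
  transitivity (U *m (L *m R)); first by congr (_ *m _).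
  by rewrite mulmxA UL mul1mx.
have AC : A *m C = L.
  transitivity ((L *m R) *m C); first by congr (_ *m _).
  by rewrite -mulmxA RC mulmx1.
exists U, C; split; first by rewrite UA RC.
by rewrite AC -mulmxA UA -A_E.
Qed.

(** The line through a and b, as a matrix of polynomials. *)
Definition line_mx (a b : 'M[K]_n) : 'M[{poly K}]_n :=
  map_mx polyC a + 'X *: map_mx polyC (b - a).

Lemma line_mxE a b c : map_mx (horner_eval c) (line_mx a b) = a + c *: (b - a).
Proof.
by apply/matrixP=> i j; rewrite !mxE /horner_eval !hornerE.
Qed.

Lemma conj_line_poly g0 g1 y0 y1 (Q : {mpoly K[n * n]}) :
  exists P : {poly K}, exists M : nat, forall c,
  g0 + c *: (g1 - g0) \in unitmx ->
  evalm ((g0 + c *: (g1 - g0)) *m (y0 + c *: (y1 - y0)) *m invmx (g0 + c *: (g1 - g0))) Q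
    * \det (g0 + c *: (g1 - g0)) ^+ M = P.[c].
Proof.
have [P [M H]] := eval_conj polyC (line_mx g0 g1) (line_mx y0 y1) Q.
exists P, M => c gU.
have := H (horner_eval c) (fun a => hornerC a c).
by rewrite -det_map_mx !line_mxE; apply; rewrite -unitfE -unitmxE.
Qed.

Lemma det_line_poly g0 g1 : exists D : {poly K}, forall c, D.[c] = \det (g0 + c *: (g1 - g0)).
Proof.
exists (\det (line_mx g0 g1)) => c.
by rewrite -line_mxE det_map_mx.
Qed.

End AdjointRank.
End PolynomialTools.

(** * The dimension of an adjoint orbit *)

Section OrbitDimensionLowerBound.
Context {K : fieldType}.
Hypothesis charK0 : [pchar K] =i pred0.
Variable n : nat.
Implicit Types (x y g u : 'M[K]_n).

Lemma not_closed_witness (Z : set 'M[K]_n) z : zariski_closed Z -> ~ Z z ->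
  exists2 Q : {mpoly K[n * n]}, (forall y, Z y -> evalm y Q = 0) & evalm z Q != 0.
Proof.
move=> [I ->] nz; apply: contrapT => H; apply: nz => P IP /=.
apply/eqP/negPn/negP => P0; apply: H; exists P => // y; exact.
Qed.

(** Let the polynomials Q1 and Q2 be nonzero at points z1 and z2 of G.Y. Joining the points of Y
and the conjugating matrices by lines gives a rational curve in G.Y through z1 and z2; on
it Q1, Q2 and the determinant are nonzero outside finitely many parameters, so some point
of G.Y escapes both closed sets. *)
Lemma irreducible_Gsat (Y : set 'M[K]_n) : Y !=set0 ->
  (forall a b c, Y a -> Y b -> Y (a + c *: (b - a))) -> irreducible (Gsat Y).
Proof.
move=> [y Yy] Yline; split.
  by exists y; exists 1%:M; rewrite ?unitmx1 //; exists y => //; rewrite invmx1 mulmx1 mul1mx.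
move=> Z1 Z2 cZ1 cZ2 cover; apply: contrapT => /not_orP[n1 n2].
have [z1 [g1 g1U [y1 Y1 E1]] nz1] : exists2 z, Gsat Y z & ~ Z1 z.
  by apply: contrapT => H; apply: n1 => z zY; apply: contrapT => nz; apply: H; exists z.
have [z2 [g2 g2U [y2 Y2 E2]] nz2] : exists2 z, Gsat Y z & ~ Z2 z.
  by apply: contrapT => H; apply: n2 => z zY; apply: contrapT => nz; apply: H; exists z.
have [Q1 Q1Z Q1z] := not_closed_witness cZ1 nz1.
have [Q2 Q2Z Q2z] := not_closed_witness cZ2 nz2.
have [P1 [M1 H1]] := conj_line_poly g1 g2 y1 y2 Q1.
have [P2 [M2 H2]] := conj_line_poly g1 g2 y1 y2 Q2.
have [D HD] := det_line_poly g1 g2.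
have unitP c : D.[c] != 0 -> g1 + c *: (g2 - g1) \in unitmx.
  by rewrite HD unitmxE unitfE.
have c0 (a b : 'M[K]_n) : a + 0 *: (b - a) = a by rewrite scale0r addr0.
have c1 (a b : 'M[K]_n) : a + 1 *: (b - a) = b by rewrite scale1r addrC subrK.
have D0 : D != 0.
  apply/eqP => D0; have := HD 0; rewrite D0 horner0 c0 => /esym/eqP.
  by move: g1U; rewrite unitmxE unitfE => /negPf->.
have P10 : P1 != 0.
  apply/eqP => P0; have := H1 0; rewrite !c0 P0 horner0 -E1 => /(_ g1U)/eqP.
  rewrite mulf_eq0 (negPf Q1z) expf_eq0 => /andP[_].
  by move: g1U; rewrite unitmxE unitfE => /negPf->.
have P20 : P2 != 0.
  apply/eqP => P0; have := H2 1; rewrite !c1 P0 horner0 -E2 => /(_ g2U)/eqP.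
  rewrite mulf_eq0 (negPf Q2z) expf_eq0 => /andP[_].
  by move: g2U; rewrite unitmxE unitfE => /negPf->.
have [|c] := @poly_nonroot _ charK0 (P1 * P2 * D); first by rewrite !mulf_neq0.
rewrite !hornerM !mulf_eq0 !negb_or => /andP[/andP[P1c P2c] /unitP gU].
set g := g1 + _ in gU; set yc := y1 + c *: (y2 - y1).
have : (Z1 `|` Z2) (g *m yc *m invmx g).
  by apply: cover; exists g => //; exists yc => //; exact: Yline.
case=> [/Q1Z Q0|/Q2Z Q0].
  by move: P1c; rewrite -H1 // Q0 mul0r eqxx.
by move: P2c; rewrite -H2 // Q0 mul0r eqxx.
Qed.

Lemma GorbitP x y : Gorbit x y <-> exists2 g, g \in unitmx & y = g *m x *m invmx g.
Proof.
split=> [[g gU [_ -> ->]]|[g gU ->]]; first by exists g.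
by exists g => //; exists x.
Qed.

(** The F_i are the affine functions, zero at x, that form a dual basis to tangent vectors [x, u_i].
On the curve (1 + c u) x (1 + c u)^(-1), with u a combination of the u_i with coefficients
- s, they are F_i = c s_i + O(c^2). A relation P of lowest degree d would give P_d(s) = 0
for all s, where P_d is its homogeneous part of degree d. *)
Lemma orbit_alg_independent x : exists F : 'I_(\rank (ad_mx x)) -> {mpoly K[n * n]},
  alg_independent (Gorbit x) F.
Proof.
have [U [C [UC _]]] := rank_factor (ad_mx x).
set r := \rank (ad_mx x) in U C UC *.
pose F (i : 'I_r) : {mpoly K[n * n]} :=
  \sum_j C j i *: ('X_j - (mxvec x 0 j)%:MP).
have FE y i : evalm y (F i) = (mxvec (y - x) *m C) 0 i.
  rewrite /evalm /F raddf_sum mxE; apply: eq_bigr => j _ /=.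
  by rewrite mevalZ mevalB mevalXU mevalC linearB !mxE mulrC.
exists F => P P0; apply/eqP/negPn/negP => Pn0.
(* A monomial of lowest degree in the relation P. *)
have [m0 m0P m0min] : exists2 m0, m0 \in msupp P & forall m, m \in msupp P -> (mdeg m0 <= mdeg m)%N.
  have : msupp P != [::] by rewrite msupp_eq0.
  case E : (msupp P) => [//|m s] _.
  have [/= i iP imin] := @arg_minnP _ (@Ordinal (size (m :: s)) 0 isT) predT
     (fun i => mdeg (nth 0%MM (m :: s) i)) isT.
  exists (nth 0%MM (m :: s) i); first exact: mem_nth.
  move=> m' m'P; have lt : (index m' (m :: s) < size (m :: s))%N by rewrite index_mem.
  by have := imin (Ordinal lt) isT; rewrite [nat_of_ord (Ordinal lt)]/(index m' (m :: s)) nth_index.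
pose d := mdeg m0.
pose Pd : {mpoly K[r]} := \sum_(m <- msupp P | mdeg m == d) P@_m *: 'X_[m].
have Pd0 : Pd != 0.
  apply/eqP => /(congr1 (fun Q : {mpoly K[r]} => Q@_m0)) /eqP.
  rewrite mcoeff0 /Pd raddf_sum /= big_mkcond (bigD1_seq m0) ?msupp_uniq //= eqxx.
  rewrite [X in _ + X]big1_seq ?addr0 => [|m /andP[mm0 _]].
    by rewrite mcoeffZ mcoeffX eqxx mulr1 (negPf (_ : P@_m0 != 0)) // -mcoeff_msupp.
  by case: ifP => // _; rewrite mcoeffZ mcoeffX (negPf mm0) mulr0.
have [s /eqP[]] := mpoly_nonroot charK0 Pd0.
pose sv : 'rV[K]_r := \row_i s i.
pose u : 'M[K]_n := - vec_mx (sv *m U).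
pose b := u *m x - x *m u.
have bC : mxvec b *m C = sv.
  have -> : b = lie x (vec_mx (sv *m U)).
    by rewrite /b /u /lie mulNmx mulmxN opprK addrC.
  by rewrite -ad_mxE vec_mxK -!mulmxA (mulmxA U) UC mulmx1.
have bE : b = u *m x - x *m u by [].
clearbody b.
pose G : 'M[{poly K}]_n := line_mx 1%:M (1%:M + u).
have GE c : map_mx (horner_eval c) G = 1%:M + c *: u by rewrite line_mxE addrAC subrr add0r.
pose D : {poly K} := \det G.
have DE c : D.[c] = \det (1%:M + c *: u) by rewrite -GE det_map_mx.
pose Nv : 'rV[{poly K}]_r := mxvec (map_mx polyC b *m \adj G) *m map_mx polyC C.
have NE c i : (Nv 0 i).[c] = (mxvec (b *m \adj (1%:M + c *: u)) *m C) 0 i.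
  transitivity (map_mx (horner_eval c) Nv 0 i); first by rewrite [RHS]mxE.
  rewrite /Nv map_mxM map_mxvec map_mxM map_mx_adj GE; congr ((mxvec (_ *m _) *m _) _ _).
    by apply/matrixP=> a a'; rewrite !mxE; exact: hornerC.
  by apply/matrixP=> a a'; rewrite !mxE; exact: hornerC.
have D00 : D.[0] = 1 by rewrite DE scale0r addr0 det1.
have D0 : D != 0 by apply/eqP => E; move: D00; rewrite E horner0 => /eqP; rewrite eq_sym oner_eq0.
have N0 i : (Nv 0 i).[0] = s i.
  rewrite NE scale0r addr0 (_ : \adj _ = 1%:M) ?mulmx1 ?bC ?mxE //.
  by rewrite -[LHS]mul1mx mul_mx_adj det1.
(* Q below is P (F (y (c))) as a function of c, multiplied by D^M and divided by c^d. *)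
pose M := msize P.
pose Q : {poly K} := \sum_(m <- msupp P)
  P@_m *: ('X^(mdeg m - d) * \prod_i (Nv 0 i) ^+ m i * D ^+ (M - mdeg m)).
have Q0 : Q = 0.
  have : 'X^d * Q * D = 0.
    apply: (poly_eq0_fun charK0) => c; rewrite !hornerM.
    have [->|Dc] := eqVneq D.[c] 0; first by rewrite mulr0.
    suff -> : 'X^d.[c] * Q.[c] = 0 by rewrite mul0r.
    pose g : 'M[K]_n := 1%:M + c *: u.
    have gU : g \in unitmx by rewrite unitmxE unitfE -DE.
    have Pz : P.@[fun i => evalm (g *m x *m invmx g) (F i)] = 0.
      by apply: P0; apply/GorbitP; exists g.
    have Fc i : evalm (g *m x *m invmx g) (F i) = c / D.[c] * (Nv 0 i).[c].
      rewrite FE (_ : _ - x = (c / D.[c]) *: (b *m \adj g)); last first.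
        rewrite -{2}[x](mulmxK gU) -mulmxBl /invmx gU -DE -scalemxAr mulrC -scalerA.
        congr (_ *: _); rewrite scalemxAl; congr (_ *m _).
        rewrite bE scalerBr /g mulmxDl mulmxDr mul1mx mulmx1 -scalemxAl -scalemxAr.
        by rewrite opprD addrACA subrr add0r.
      by rewrite linearZ /= -scalemxAl mxE NE.
    rewrite hornerXn horner_sum mulr_sumr.
    transitivity (D.[c] ^+ M * P.@[fun i => evalm (g *m x *m invmx g) (F i)]); last by rewrite Pz mulr0.
    rewrite mevalE mulr_sumr big_seq [RHS]big_seq; apply: eq_bigr => m mP.
    have mM : (mdeg m <= M)%N by exact: (ltnW (msize_mdeg_lt mP)).
    have dm := m0min _ mP.
    rewrite hornerZ mulrCA [RHS]mulrCA; congr (_ * _).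
    rewrite !hornerM !horner_exp hornerX horner_prod !mulrA -exprD subnKC //.
    rewrite -[in RHS](subnK mM) exprD -[RHS]mulrA [LHS]mulrC; congr (_ * _).
    rewrite !mdegE !expr_sum -!big_split /=; apply: eq_bigr => i _.
    rewrite Fc horner_exp !exprMn exprVn !mulrA; congr (_ * _).
    by rewrite mulrC mulrA mulVf ?mul1r // expf_neq0.
  by move/eqP; rewrite !mulf_eq0 (negPf D0) orbF expf_eq0 polyX_eq0 andbF => /eqP.
have /(congr1 (fun R : {poly K} => R.[0])) := Q0; rewrite horner0 => <-.
rewrite /Pd raddf_sum horner_sum /= [LHS]big_mkcond big_seq [RHS]big_seq; apply: eq_bigr => m mP.
rewrite hornerZ !hornerM hornerXn expr0n subn_eq0 horner_exp D00 expr1n mulr1.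
have -> : (mdeg m <= d)%N = (mdeg m == d) by rewrite eqn_leq (m0min _ mP) andbT.
case: eqP => _; last by rewrite mul0r mulr0.
rewrite mul1r mevalZ mevalX horner_prod; congr (_ * _).
by apply: eq_bigr => i _; rewrite horner_exp N0.
Qed.

End OrbitDimensionLowerBound.

Section OrbitDimensionUpperBound.
Context {K : fieldType}.
Hypothesis charK0 : [pchar K] =i pred0.
Variable n : nat.
Implicit Types (x y g u : 'M[K]_n).

(** A polynomial that vanishes at g x g^(-1) for almost all g on the line from 1 to g1 vanishes
at g1 x g1^(-1). *)
Lemma orbit_dense x (Q : {mpoly K[n * n]}) :
  (forall g1, exists2 D : {poly K}, D != 0 &
     forall c, D.[c] != 0 -> 1%:M + c *: (g1 - 1%:M) \in unitmx ->
       evalm ((1%:M + c *: (g1 - 1%:M)) *m x *m invmx (1%:M + c *: (g1 - 1%:M))) Q = 0) ->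
  forall y, Gorbit x y -> evalm y Q = 0.
Proof.
move=> H y /GorbitP[g1 g1U ->]; have [D D0 HD] := H g1.
have [P [M HP]] := conj_line_poly 1%:M g1 x x Q.
have [E HE] := det_line_poly 1%:M g1.
have xE c : x + c *: (x - x) = x by rewrite subrr scaler0 addr0.
have E0 : E != 0.
  apply/eqP => E0; have := HE 0; rewrite E0 horner0 scale0r addr0 det1 => /eqP.
  by rewrite eq_sym oner_eq0.
have PDE : P * (D * E) = 0.
  apply: (poly_eq0_fun charK0) => c; rewrite !hornerM.
  have [->|Dc] := eqVneq D.[c] 0; first by rewrite mul0r mulr0.
  have [->|Ec] := eqVneq E.[c] 0; first by rewrite !mulr0.
  have gU : 1%:M + c *: (g1 - 1%:M) \in unitmx by rewrite unitmxE unitfE -HE.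
  by rewrite -HP // xE HD ?mul0r.
have P0 : P = 0.
  by move/eqP: PDE; rewrite !mulf_eq0 (negPf D0) (negPf E0) !orbF => /eqP.
have gE : 1%:M + 1 *: (g1 - 1%:M) = g1 by rewrite scale1r addrC subrK.
have := HP 1; rewrite gE xE P0 horner0 => /(_ g1U)/eqP.
rewrite mulf_eq0 expf_eq0; move: g1U; rewrite unitmxE unitfE => /negPf->.
by rewrite andbF orbF => /eqP.
Qed.

(** Let L be the row space of U, a complement of the centralizer C(x). For g near 1 the spaces
g C(x) and L are still complementary, so 1 = g z - l with z in C(x) and l in L; then
1 + l = g z conjugates x as g does. So 1 + L parametrizes a dense part of the orbit. *)
Lemma orbit_section x (r := \rank (ad_mx x)) : exists U : 'M[K]_(r, n * n), forall g1,
  exists2 D : {poly K}, D != 0 & forall c, D.[c] != 0 ->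
    let g := 1%:M + c *: (g1 - 1%:M) in g \in unitmx ->
    exists s : 'rV[K]_r, let l := 1%:M + vec_mx (s *m U) in
      l \in unitmx /\ g *m x *m invmx g = l *m x *m invmx l.
Proof.
have [U [C [UC ACUA]]] := rank_factor (ad_mx x).
exists U => g1.
(* pL and pC are the projections onto L along C(x) and onto C(x) along L. *)
pose pL : 'M[K]_(n * n) := ad_mx x *m C *m U.
pose pC : 'M[K]_(n * n) := 1%:M - pL.
have pCad : pC *m ad_mx x = 0 by rewrite /pC mulmxBl mul1mx ACUA subrr.
pose B : 'M[K]_(n * n) := pC *m (lin_mulmx g1 - 1%:M).
pose T : 'M[{poly K}]_(n * n) := line_mx 1%:M (1%:M + B).
have TE c : map_mx (horner_eval c) T = 1%:M + c *: B by rewrite line_mxE addrAC subrr add0r.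
pose cP : 'M[{poly K}]_n :=
  vec_mx (map_mx polyC (mxvec 1%:M) *m \adj T *m map_mx polyC pC).
have cPE c : map_mx (horner_eval c) cP = vec_mx (mxvec 1%:M *m \adj (1%:M + c *: B) *m pC).
  rewrite /cP map_vec_mx !map_mxM map_mx_adj TE; congr (vec_mx (_ *m _ *m _)).
    by apply/rowP=> j; rewrite !mxE; exact: hornerC.
  by apply/matrixP=> i j; rewrite !mxE; exact: hornerC.
have pC1 : mxvec 1%:M *m pC = mxvec 1%:M.
  rewrite /pC /pL mulmxBr mulmx1 !mulmxA ad_mxE /lie mulmx1 mul1mx subrr linear0.
  by rewrite !mul0mx subr0.
have pCE : pC = 1%:M - pL by [].
have BE : B = pC *m (lin_mulmx g1 - 1%:M) by [].
clearbody pC B.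
exists (\det T * \det cP).
  rewrite mulf_neq0 //; apply/eqP => /(congr1 (horner_eval 0)).
    rewrite -det_map_mx TE scale0r addr0 det1 rmorph0 => /eqP; by rewrite oner_eq0.
  rewrite -det_map_mx cPE scale0r addr0.
  have -> : \adj (1%:M : 'M[K]_(n * n)) = 1%:M by rewrite -[LHS]mul1mx mul_mx_adj det1.
  rewrite mulmx1 pC1 mxvecK det1 rmorph0 => /eqP; by rewrite oner_eq0.
move=> c; rewrite hornerM mulf_eq0 negb_or => /andP[Tc cPc] g gU.
have Tc' : \det (1%:M + c *: B) != 0 by rewrite -TE det_map_mx.
have TU : 1%:M + c *: B \in unitmx by rewrite unitmxE unitfE.
pose w := mxvec 1%:M *m invmx (1%:M + c *: B).
pose z := vec_mx (w *m pC).
have zU : z \in unitmx.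
  have : vec_mx (mxvec 1%:M *m \adj (1%:M + c *: B) *m pC) \in unitmx.
    by rewrite unitmxE unitfE -cPE det_map_mx.
  rewrite /z /w /invmx TU -scalemxAr -scalemxAl linearZ /=.
  by move=> zU; rewrite unitmxZ // unitfE invr_eq0.
have zx : z *m x = x *m z.
  apply/eqP; rewrite eq_sym -subr_eq0; apply/eqP; apply: (can_inj mxvecK).
  by rewrite -/(lie x z) -ad_mxE vec_mxK -mulmxA pCad mulmx0 linear0.
have gz : g *m z = 1%:M + vec_mx (- (w *m ad_mx x *m C) *m U).
  have wT : w *m (1%:M + c *: B) = mxvec 1%:M by rewrite mulmxKV.
  have lg : mxvec (g *m z) = w *m pC *m (1%:M + c *: (lin_mulmx g1 - 1%:M)).
    rewrite mulmxDr mulmx1 -scalemxAr mulmxBr mulmx1 -[w *m pC]vec_mxK -/z mul_vec_lin /=.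
    by rewrite /g mulmxDl mul1mx -scalemxAl mulmxBl mul1mx linearD linearZ /= linearB.
  apply: (can_inj mxvecK); rewrite lg [mxvec (_ + _)]linearD /= vec_mxK -wT.
  have -> : - (w *m ad_mx x *m C) *m U = - (w *m pL) by rewrite mulNmx /pL !mulmxA.
  clearbody pL; rewrite !mulmxDr !mulmx1 BE -!scalemxAr !mulmxA.
  have -> : w *m pC = w - w *m pL by rewrite pCE mulmxBr mulmx1.
  by rewrite addrAC.
exists (- (w *m ad_mx x *m C)); rewrite -gz; split; first by rewrite unitmx_mul gU zU.
rewrite invmxM // !mulmxA -[g *m z *m x]mulmxA zx !mulmxA.
by rewrite mulmxK.
Qed.

(** By [orbit_section] functions on the orbit are rational functions of r = rank (ad x)
parameters; more than r of them are related by [counting_relation]. *)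
Lemma orbit_dim_le x d (F : 'I_d -> {mpoly K[n * n]}) :
  alg_independent (Gorbit x) F -> (d <= \rank (ad_mx x))%N.
Proof.
move=> indF; rewrite leqNgt; apply/negP => rd.
have [U HU] := orbit_section x; set r := \rank (ad_mx x) in U HU rd.
pose Lp : 'M[{mpoly K[r]}]_n :=
  map_mx (@mpolyC r K) 1%:M + \sum_(k < r) 'X_k *: map_mx (@mpolyC r K) (vec_mx (row k U)).
have LpE (s : 'I_r -> K) : map_mx (meval s) Lp = 1%:M + vec_mx ((\row_k s k) *m U).
  transitivity (1%:M + \sum_k s k *: vec_mx (row k U)).
    apply/matrixP=> i j; rewrite mxE [in LHS]mxE [in RHS]mxE rmorphD /= !summxE raddf_sum.
    congr (_ + _); first by rewrite mxE mevalC.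
    by apply: eq_bigr => k _; rewrite mxE [in RHS]mxE /= mevalM mevalXU mxE mevalC.
  rewrite mulmx_sum_row linear_sum; congr (_ + _); apply: eq_bigr => k _.
  by rewrite mxE linearZ.
have ev1 i := eval_conj (@mpolyC r K) Lp (map_mx (@mpolyC r K) x) (F i).
have /choice[pf /choice[Mf HF]] : forall i, exists p, exists M, forall ev : {rmorphism {mpoly K[r]} -> K},
   (forall c, ev (c%:MP) = c) -> ev (\det Lp) != 0 ->
   evalm (map_mx ev Lp *m map_mx ev (map_mx (@mpolyC r K) x) *m invmx (map_mx ev Lp)) (F i)
    * ev (\det Lp) ^+ M = ev p.
  by move=> i; exact: ev1.
pose M := (\sum_i Mf i)%N.
pose G i := pf i * \det Lp ^+ (M - Mf i).
have [P P0 HP] := counting_relation G (\det Lp ^+ M) rd.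
move/eqP: P0; apply; apply: indF => y yx.
pose Q : {mpoly K[n * n]} := P \mPo [tuple F i | i < d].
have QE z : evalm z Q = P.@[fun i => evalm z (F i)].
  rewrite /evalm /Q comp_mpoly_meval; apply: meval_eq => i.
  by rewrite tnth_map tnth_ord_tuple.
rewrite -QE; apply: orbit_dense yx => g1; have [D D0 HD] := HU g1.
exists D => // c Dc gU; have [s [lU ->]] := HD c Dc gU.
rewrite QE; pose sf (k : 'I_r) := s 0 k.
have LE : map_mx (meval sf) Lp = 1%:M + vec_mx (s *m U).
  by rewrite LpE; congr (_ + vec_mx (_ *m _)); apply/rowP=> k; rewrite mxE.
have xE : map_mx (meval sf) (map_mx (@mpolyC r K) x) = x.
  by apply/matrixP=> i j; rewrite !mxE mevalC.
have dL : (\det Lp).@[sf] = \det (1%:M + vec_mx (s *m U)) by rewrite -LE det_map_mx.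
have dL0 : (\det Lp).@[sf] != 0 by rewrite dL -unitfE -unitmxE.
rewrite -[RHS](HP sf); last by rewrite rmorphXn expf_neq0.
apply: meval_eq => i.
have XE k : (\det Lp ^+ k).@[sf] = (\det Lp).@[sf] ^+ k by exact: rmorphXn.
have := HF i (meval sf) (mevalC sf) dL0; rewrite LE xE.
rewrite -[X in _ * X ^+ _]/((\det Lp).@[sf]) -[X in _ = X]/((pf i).@[sf]) => E.
rewrite /G mevalM -E !XE -[_ * _ * _ ^+ (M - _)]mulrA -exprD subnKC; last first.
  by rewrite /M (bigD1 i) //= leq_addr.
by rewrite mulfK // expf_neq0.
Qed.

Lemma has_dim_Gorbit x : has_dim (Gorbit x) (\rank (ad_mx x)).
Proof. by split; [exact: orbit_alg_independent|move=> d F; exact: orbit_dim_le]. Qed.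

Lemma has_dim_unique (Y : set 'M[K]_n) d d' : has_dim Y d -> has_dim Y d' -> d = d'.
Proof.
move=> [[F HF] Hd] [[F' HF'] Hd']; apply/eqP.
by rewrite eqn_leq (Hd' _ _ HF) (Hd _ _ HF').
Qed.

End OrbitDimensionUpperBound.

(** * The centralizer of e + t *)

Section RowwiseMaps.
Context {K : fieldType} {n : nat}.
Implicit Types (M : 'I_n -> 'M[K]_n) (A B : 'M[K]_n).

Definition rowwise M B : 'M[K]_n := \matrix_p (row p B *m M p).

Lemma rowwise_is_linear M : linear (rowwise M).
Proof.
move=> a A B; apply/row_matrixP => p.
rewrite rowK [RHS]linearP /= !rowK (linearP (row p)) /= mulmxDl.
by rewrite -scalemxAl.
Qed.

HB.instance Definition _ M :=
  GRing.isLinear.Build K 'M[K]_n 'M[K]_n _ (rowwise M) (rowwise_is_linear M).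

Lemma mulmx_row_inj m k (A B : 'M[K]_(m, k)) : (forall v : 'rV_m, v *m A = v *m B) -> A = B.
Proof. by move=> H; apply/row_matrixP => i; rewrite !rowE H. Qed.

Lemma lin_rowwise_comp M M' :
  lin_mx (rowwise M) *m lin_mx (rowwise M') = lin_mx (rowwise (fun p => M p *m M' p)).
Proof.
apply: mulmx_row_inj => v; rewrite -[v]vec_mxK mulmxA !mul_vec_lin; congr mxvec.
by apply/row_matrixP => p; rewrite !rowK mulmxA.
Qed.

Lemma lin_rowwise1 : lin_mx (rowwise (fun=> 1%:M)) = 1%:M :> 'M[K]_(n * n).
Proof.
apply: mulmx_row_inj => v; rewrite -[v]vec_mxK mul_vec_lin mulmx1; congr mxvec.
by apply/row_matrixP => p; rewrite rowK mulmx1.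
Qed.

Lemma lin_rowwise_unit M : (forall p, M p \in unitmx) -> lin_mx (rowwise M) \in unitmx.
Proof.
move=> MU; have [] // := @mulmx1_unit _ _ (lin_mx (rowwise M)) (lin_mx (rowwise (fun p => invmx (M p)))).
rewrite lin_rowwise_comp -lin_rowwise1; congr lin_mx.
by apply/funext => B; apply/row_matrixP => p; rewrite !rowK mulmxV.
Qed.

Lemma rank_lin_rowwise_pid (r : 'I_n -> nat) : (forall p, r p <= n)%N ->
  \rank (lin_mx (rowwise (fun p => pid_mx (r p)))) = (\sum_p r p)%N.
Proof.
move=> rn; pose D : 'M[K]_n := \matrix_(p, q) (q < r p)%N%:R.
pose P (k : 'I_(n * n)) := mxvec D 0 k != 0.
have DE p q : (D p q != 0) = (q < r p)%N.
  by rewrite mxE; case: ltnP; rewrite ?oner_eq0 ?eqxx.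
have -> : lin_mx (rowwise (fun p => pid_mx (r p))) = diag_mx (\row_k (P k)%:R).
  apply: mulmx_row_inj => v; rewrite -[v]vec_mxK mul_vec_lin /=.
  apply/rowP=> k; rewrite mul_mx_diag [RHS]mxE [X in _ * X]mxE.
  case/mxvec_indexP: k => p q; rewrite /P !mxvecE DE mxE.
  rewrite mxE (bigD1 q) //= [X in _ + X]big1 ?addr0 => [|j jq].
    by rewrite !mxE eqxx.
  by rewrite [X in _ * X]mxE (_ : (j == q :> nat) = false) ?mulr0 //; exact: negPf jq.
rewrite rank_indicator_mx -sum1_card big_mkcond /=.
transitivity (\sum_(p < n) \sum_(q < n) (q < r p)%N)%N.
  rewrite (reindex _ (curry_mxvec_bij _ _)) pair_bigA /=; apply: eq_bigr => -[p q] _ /=.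
  by rewrite unfold_in /P mxvecE DE; case: ltnP.
apply: eq_bigr => p _.
rewrite -(big_mkord predT (fun q => (q < r p)%N : nat)) (big_cat_nat _ (n := r p)) //=.
rewrite [X in (_ + X)%N]big_nat_cond [X in (_ + X)%N]big1 ?addn0 => [|q]; last first.
  by rewrite andbT => /andP[/leq_gtF->].
rewrite big_nat_cond (eq_bigr (fun=> 1%N)) => [|q]; last by rewrite andbT => /andP[_ ->].
by rewrite -big_nat_cond sum_nat_const_nat subn0 muln1.
Qed.

(** Reduction to the case where each M p is a diagonal projector, by a rank factorization of
each M p. *)
Lemma rank_lin_rowwise M : \rank (lin_mx (rowwise M)) = (\sum_p \rank (M p))%N.
Proof.
rewrite -(rank_lin_rowwise_pid (fun p => rank_leq_row (M p))).
pose C p := col_ebase (M p); pose R p := row_ebase (M p).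
have -> : lin_mx (rowwise M) = lin_mx (rowwise C) *m
    lin_mx (rowwise (fun p => pid_mx (\rank (M p)))) *m lin_mx (rowwise R).
  rewrite !lin_rowwise_comp; congr lin_mx; apply/funext => B.
  by apply/row_matrixP => p; rewrite !rowK mulmx_ebase.
rewrite mxrankMfree ?row_free_unit ?lin_rowwise_unit // => [|p]; last exact: row_ebase_unit.
by rewrite eqmxMfull // row_full_unit lin_rowwise_unit // => p; exact: col_ebase_unit.
Qed.

Lemma eq_rank_ker m k (A B : 'M[K]_(m, k)) :
  (forall v : 'rV_m, v *m A = 0 <-> v *m B = 0) -> \rank A = \rank B.
Proof.
have W (A' B' : 'M[K]_(m, k)) : (forall v : 'rV_m, v *m A' = 0 -> v *m B' = 0) ->
    (\rank B' <= \rank A')%N.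
  move=> H; have : (kermx A' <= kermx B')%MS.
    by apply/rV_subP => v /sub_kermxP/H/sub_kermxP.
  move=> /mxrankS; rewrite !mxrank_ker; have := rank_leq_row A'; have := rank_leq_row B'; lia.
by move=> H; apply/eqP; rewrite eqn_leq !W // => v; case: (H v).
Qed.

End RowwiseMaps.

Section CentralizerDimension.
Context {K : fieldType} {delta : nat} (lam : 'I_delta -> nat).
Local Notation N := (\sum_(i < delta) lam i)%N.
Implicit Types (p q r : 'I_N) (x y t u v w : 'M[K]_N).
Local Notation e := (e_mx lam : 'M[K]_N).

(** The transpose of e shifts rows in the direction opposite to e. *)
Lemma eT_mul x p p' q : blk p' = blk p -> pos p' = (pos p).+1 ->
  (e^T *m x) p' q = x p q.
Proof.
move=> b s; rewrite -[x in LHS]trmxK -trmx_mul mxE.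
by rewrite (mul_e _ _ b s) mxE.
Qed.

Lemma eT_mul_first x p q : pos p = 1%N -> (e^T *m x) p q = 0.
Proof. by move=> s; rewrite -[x in LHS]trmxK -trmx_mul mxE mul_e_first. Qed.

Section Tau.
Variable tau : nat -> K.
Let t : 'M[K]_N := tau_mx tau.
Let x : 'M[K]_N := e + t.
Let P k := peval x (prefix_poly tau k).
(** Row (i, j + 1) of this matrix is A_(i,j+1) - A_(i,j) (x - tau_j), and row (i, 1) is A_(i,1).
It is a unitriangular function of A, which makes [rank_ad_tau_mx] a count of row
conditions. *)
Let defect A := A - e^T *m (A *m x - t *m A).
(** The conditions on the rows of the defect of A that say that A commutes with x. *)
Let row_test p : 'M[K]_N := if pos p == 1%N then P (lam (blk p)) else 1%:M.

Lemma tau_mx_mul A p q : (t *m A) p q = tau (pos p).-1 * A p q.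
Proof. by rewrite mul_diag_mx !mxE. Qed.

Lemma mulmx_shift_entry A k p q : (A *m (x - (tau k)%:M)) p q = (A *m x) p q - tau k * A p q.
Proof.
by rewrite mulmxBr mxE mul_mx_scalar [X in _ + X]mxE [X in _ - X]mxE.
Qed.

Lemma defect_succ A p p' q : blk p' = blk p -> pos p' = (pos p).+1 ->
  defect A p' q = A p' q - (A *m (x - (tau (pos p).-1)%:M)) p q.
Proof.
move=> b s; rewrite mxE [X in _ + X]mxE (eT_mul _ _ b s); congr (_ - _).
by rewrite mulmx_shift_entry mxE [X in _ + X]mxE tau_mx_mul.
Qed.

Lemma defect_first A p q : pos p = 1%N -> defect A p q = A p q.
Proof. by move=> s; rewrite mxE [X in _ + X]mxE eT_mul_first // subr0. Qed.

Lemma lie_x_succ A p p' q : blk p' = blk p -> pos p' = (pos p).+1 ->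
  lie x A p q = defect A p' q.
Proof.
move=> b s; rewrite (defect_succ _ _ b s) mulmx_shift_entry mxE [X in _ + X]mxE.
by rewrite mulmxDl [X in X - _]mxE (e_mul _ _ b s) tau_mx_mul opprB addrA.
Qed.

Lemma lie_x_last A p q : pos p = lam (blk p) ->
  lie x A p q = - (A *m (x - (tau (pos p).-1)%:M)) p q.
Proof.
move=> pl; rewrite mulmx_shift_entry mxE [X in _ + X]mxE mulmxDl [X in X - _]mxE.
by rewrite e_mul_last // add0r tau_mx_mul opprB.
Qed.

Lemma rowwise_first B p q : pos p = 1%N ->
  rowwise row_test B p q = (B *m P (lam (blk p))) p q.
Proof. by move=> s; rewrite mxE /row_test s eqxx -row_mul mxE. Qed.

Lemma rowwise_next B p q : pos p != 1%N -> rowwise row_test B p q = B p q.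
Proof. by move=> /negPf s; rewrite mxE /row_test s mulmx1 mxE. Qed.

(** A commutes with x iff its rows satisfy A_(i,j+1) = A_(i,j) (x - tau_j) and
A_(i,1) P_(lam_i)(x) = 0: it is determined by the images A_(i,1) of the cyclic vectors, each
of which must be annihilated by P_(lam_i). *)
Lemma ker_ad_rowwise A : lie x A = 0 <-> rowwise row_test (defect A) = 0.
Proof.
split=> H; apply/matrixP=> p q; rewrite [RHS]mxE.
  case: (idx_predP p) => [p' b s | s].
    rewrite rowwise_next ?s ?eqSS -?lt0n //.
    by rewrite -(lie_x_succ _ _ (esym b) s) H mxE.
  rewrite rowwise_first // mxE.
  transitivity ((A *m P (lam (blk p))) p q).
    by rewrite [RHS]mxE; apply: eq_bigr => r _; rewrite defect_first.
  have cA : A *m x = x *m A by apply/eqP; rewrite eq_sym -subr_eq0; apply/eqP.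
  rewrite (peval_comm _ cA) mxE big1 // => r _.
  by rewrite -/x prefix_row0 ?mul0r.
have Grow p' r : pos p' != 1%N -> defect A p' r = 0.
  by move=> s; rewrite -(rowwise_next _ _ s) H mxE.
have ArowE k p1 : pos p1 = 1%N -> forall p2, blk p2 = blk p1 -> pos p2 = k.+1 ->
    forall r, A p2 r = (A *m P k) p1 r.
  move=> s1; elim: k => [|k IH] p2 b2 s2 r.
    rewrite (_ : p2 = p1); last by apply: pos_inj; rewrite ?s2.
    by rewrite /P /prefix_poly big_ord0 peval1 mulmx1.
  case: (idx_predP p2) => [p' b s | s]; last by rewrite s2 in s.
  have s21 : pos p2 != 1%N by rewrite s2.
  have /eqP := Grow p2 r s21; rewrite (defect_succ _ _ (esym b) s) subr_eq0 => /eqP ->.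
  have s' : pos p' = k.+1 by lia.
  rewrite s' /= /P peval_prefix_polyS mulmxA mxE [RHS]mxE.
  by apply: eq_bigr => r' _; rewrite -(IH p') // b.
case: (idx_succP p) => [p' b s | pl].
  by rewrite (lie_x_succ _ _ b s) Grow // s eqSS -lt0n.
have [|p1 b1 s1] := @idx_exists _ lam (blk p) 1; first by rewrite -pl pos_gt0.
have pE : pos p = (pos p).-1.+1 by rewrite prednK.
rewrite lie_x_last // (_ : (_ *m _) p q = (A *m P (lam (blk p))) p1 q).
  have := rowwise_first (defect A) q s1; rewrite H [LHS]mxE b1 => /esym E.
  suff -> : (A *m P (lam (blk p))) p1 q = 0 by rewrite oppr0.
  rewrite -E mxE [RHS]mxE; apply: eq_bigr => r _.
  by rewrite defect_first.
rewrite -pl pE /P peval_prefix_polyS mulmxA mxE [RHS]mxE /=.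
by apply: eq_bigr => r _; rewrite -(ArowE _ p1 s1 p).
Qed.

Lemma defect_inj A : defect A = 0 -> A = 0.
Proof.
move=> G0; suff H k p : pos p = k.+1 -> forall q, A p q = 0.
  by apply/matrixP=> p q; rewrite [RHS]mxE (H (pos p).-1) ?prednK.
elim: k p => [|k IH] p s q; first by rewrite -(defect_first _ _ s) G0 mxE.
case: (idx_predP p) => [p' b s' | s']; last by rewrite s' in s.
have := defect_succ A q (esym b) s'; rewrite G0 mxE => /esym/eqP.
rewrite subr_eq0 => /eqP ->; rewrite mxE big1 // => r _.
by rewrite (IH p') ?mul0r //; lia.
Qed.

(** By [ker_ad_rowwise] the centralizer of x has the dimension of the sum over i of the kernels
of P_(lam_i)(x), and [rank_prefix] gives the dimension of each. *)
Lemma rank_ad_tau_mx : (\rank (ad_mx x) + \sum_i \sum_j minn (lam i) (lam j) = N * N)%N.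
Proof.
pose GG : 'M[K]_(N * N) := 1%:M - (lin_mulmxr x - lin_mulmx t) *m lin_mulmx (e^T).
have GGE A : mxvec A *m GG = mxvec (defect A).
  rewrite /GG mulmxBr mulmx1 mulmxA mulmxBr !mul_vec_lin /= -linearB mul_vec_lin /=.
  by rewrite -linearB.
have GU : GG \in unitmx.
  rewrite -row_free_unit; apply/inj_row_free => v.
  rewrite -[v]vec_mxK GGE => /eqP; rewrite mxvec_eq0 => /eqP/defect_inj->.
  by rewrite linear0.
have -> : \rank (ad_mx x) = (\sum_p \rank (row_test p))%N.
  rewrite -rank_lin_rowwise -[RHS](eqmxMfull _ (_ : row_full GG)); last first.
    by rewrite row_full_unit.
  apply: eq_rank_ker => v; rewrite -[v]vec_mxK ad_mxE mulmxA GGE mul_vec_lin /=.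
  by split=> /eqP; rewrite mxvec_eq0 => /eqP/ker_ad_rowwise->; rewrite linear0.
have -> : (N * N = \sum_i lam i * N)%N by rewrite -big_distrl.
rewrite sum_idx_nat -big_split /=; apply: eq_bigr => i _.
rewrite /row_test; case: (posnP (lam i)) => [l0 | l0].
  rewrite big1 ?add0n => [|j]; last by have := ltn_ord j; rewrite {2}l0.
  by rewrite l0 mul0n big1 // => j _; rewrite min0n.
rewrite (bigD1 (Ordinal l0)) //= pos_Rank eqxx.
rewrite [X in (_ + X + _)%N](eq_bigr (fun=> N)) => [|j j0]; last first.
  rewrite pos_Rank (_ : (_ == 1)%N = false) ?mxrank1 //.
  by apply/negbTE; apply: contraNneq j0 => -[E]; apply/eqP/val_inj.
rewrite sum_nat_const cardC1 card_ord blk_Rank rank_prefix addnAC -big_split /=.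
rewrite (eq_bigr lam) => [|j _]; last by rewrite minnE; lia.
by rewrite -mulSn prednK.
Qed.

End Tau.
End CentralizerDimension.

(** * Subspaces generated by few vectors *)

Section CyclicSpan.
Context {K : fieldType} {n k : nat}.
Implicit Types (x : 'M[K]_n) (V : 'M[K]_(k, n)).

(** Its row space is the smallest subspace that contains the rows of V and is stable under x. *)
Definition cyc_mx V x := \mxcol_(j < n) (V *m x ^+ j).

Lemma cyc_mxS V x m (A : 'M[K]_(m, n)) :
  (forall j : 'I_n, (V *m x ^+ j <= A)%MS) -> (cyc_mx V x <= A)%MS.
Proof.
by move=> H; rewrite eqmx_col; apply/sumsmx_subP => j _; rewrite genmxE.
Qed.

Lemma sub_cyc_mx V x (j : 'I_n) : (V *m x ^+ j <= cyc_mx V x)%MS.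
Proof. by rewrite eqmx_col (sumsmx_sup j) // genmxE. Qed.

Lemma peval_sub_cyc V x (P : {poly K}) : (size P <= n)%N -> (V *m peval x P <= cyc_mx V x)%MS.
Proof.
move=> sP; rewrite (pevalE _ sP) mulmx_sumr summx_sub // => j _.
by rewrite -scalemxAr scalemx_sub // sub_cyc_mx.
Qed.

(** Division by R writes every power of x as a combination of 1, ..., x^(d-1) plus a multiple of
R(x). *)
Lemma rank_cyc_mx_le V x (R : {poly K}) d : R \is monic -> size R = d.+1 ->
  (\rank (cyc_mx V x) <= k * d + \rank (peval x R))%N.
Proof.
move=> Rm sR; pose W := (\sum_(i < d) <<V *m x ^+ i>>)%MS.
have sub : (cyc_mx V x <= W + peval x R)%MS.
  apply: cyc_mxS => j; rewrite -pevalXn (divp_eq 'X^j R) pevalD pevalM mulmxDr mulmxA.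
  apply: addmx_sub; first by apply: submx_trans (submxMl _ _) (addsmxSr _ _).
  apply: submx_trans (addsmxSl _ _).
  have sr : (size ('X^j %% R)%R <= d)%N.
    by rewrite -ltnS -sR ltn_modp -size_poly_eq0 sR.
  rewrite (pevalE _ sr) mulmx_sumr summx_sub // => i _.
  by rewrite -scalemxAr scalemx_sub // (sumsmx_sup i) // genmxE.
apply: leq_trans (mxrankS sub) _; apply: leq_trans (mxrank_adds_leqif _ _) _.
rewrite leq_add2r mulnC; apply: leq_trans (_ : \sum_(i < d) k <= _)%N; last first.
  by rewrite sum_nat_const card_ord.
rewrite /W; elim/big_ind2: _ => [|A1 m1 A2 m2 h1 h2|i _]; first by rewrite mxrank0.
  by apply: leq_trans (mxrank_adds_leqif _ _) _; exact: leq_add.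
by rewrite genmxE rank_leq_row.
Qed.

Lemma rank_cyc_mx_conj V x g : g \in unitmx ->
  \rank (cyc_mx V (g *m x *m invmx g)) = \rank (cyc_mx (V *m g) x).
Proof.
move=> gU; have -> : cyc_mx V (g *m x *m invmx g) = cyc_mx (V *m g) x *m invmx g.
  rewrite /cyc_mx mxcol_mul; congr mxcol; apply/funext => j.
  by rewrite conj_expr // !mulmxA.
by rewrite mxrankMfree // row_free_unit unitmx_inv.
Qed.

End CyclicSpan.

Section CyclicSpanOfJordanBasis.
Context {K : fieldType} {delta : nat} (lam : 'I_delta -> nat).
Local Notation N := (\sum_(i < delta) lam i)%N.
Implicit Types (p q r : 'I_N) (x y t u v w : 'M[K]_N).
Local Notation e := (e_mx lam : 'M[K]_N).

Definition partial_sum k := (\sum_(i < delta | i < k) lam i)%N.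

(** The basis vector of position k + 1 is the image of the first one of its block under P_k. *)
Lemma prefix_generator tau k p q : pos p = 1%N ->
  (k < lam (blk p))%N ->
  peval (e + tau_mx tau) (prefix_poly tau k) p q = ((blk q == blk p) && (pos q == k.+1))%:R.
Proof.
move=> s; elim: k q => [|k IH] q kl.
  by rewrite /prefix_poly big_ord0 peval1 mxE eq_idx s [blk p == _]eq_sym [1%N == _]eq_sym.
have [|r br sr] := @idx_exists _ lam (blk p) k.+1; first exact: (ltnW kl).
rewrite peval_prefix_polyS mxE (bigD1 r) //= [X in _ + X]big1 ?addr0 => [|r' rr'].
  by rewrite IH ?(ltnW kl) // br sr !eqxx mul1r mxE
    [X in X + _]mxE e_entry !mxE br sr /= addrK [blk p == _]eq_sym [k.+2 == _]eq_sym.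
rewrite IH ?(ltnW kl) //; move: rr'; rewrite eq_idx br sr => /negPf->.
by rewrite mul0r.
Qed.

(** The first basis vectors of the first k blocks generate these blocks. *)
Lemma rank_cyc_tau_mx_ge tau k :
  exists V : 'M[K]_(k, N), (partial_sum k <= \rank (cyc_mx V (e + tau_mx tau)))%N.
Proof.
pose V : 'M[K]_(k, N) := \matrix_(a, q) ((blk q == a :> nat) && (pos q == 1%N))%:R.
exists V; pose U : 'M[K]_N := diag_mx (\row_p (blk p < k)%N%:R).
have -> : partial_sum k = \rank U.
  rewrite (rank_indicator_mx (fun p : 'I_N => blk p < k)%N) -sum1_card big_mkcond sum_idx_nat.
  rewrite /partial_sum big_mkcond; apply: eq_bigr => i _.
  rewrite (eq_bigr (fun=> (i < k)%N : nat)) => [|j _].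
    by rewrite sum_nat_const card_ord; case: ltnP; rewrite ?muln1 ?muln0.
  by rewrite unfold_in blk_Rank; case: ltnP.
apply: mxrankS; apply/row_subP => p.
have [bk|bk] := ltnP (blk p) k; last first.
  rewrite (_ : row p U = 0) ?sub0mx //; apply/rowP=> q.
  by rewrite !mxE ltnNge bk mul0rn.
have pE : pos p = (pos p).-1.+1 by rewrite prednK.
have [|p1 b1 s1] := @idx_exists _ lam (blk p) 1.
  by have := pos_le p; have := pos_gt0 p; lia.
have lt : ((pos p).-1 < lam (blk p1))%N by have := pos_le p; rewrite b1; lia.
pose Q := prefix_poly tau (pos p).-1.
have -> : row p U = row (Ordinal bk) V *m peval (e + tau_mx tau) Q.
  apply/rowP=> q; rewrite 2!mxE [RHS]mxE (bigD1 p1) //= [X in _ + X]big1 ?addr0 => [|r rp].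
    rewrite !mxE b1 s1 !eqxx mul1r prefix_generator // -pE b1 bk -eq_idx eq_sym.
    by case: eqP.
  rewrite !mxE; case: andP => [[/eqP b /eqP s]|_]; last by rewrite mul0r.
  by case/eqP: rp; apply: pos_inj; rewrite ?s ?s1 // b1; apply: val_inj.
rewrite -row_mul; apply: submx_trans (row_sub _ _) _; apply: peval_sub_cyc.
by rewrite size_prefix_poly -pE (leq_trans (pos_le p)) // lam_le_N.
Qed.

(** [rank_cyc_mx_le] with R = P_d and d the size of the last of the first k blocks: by
[rank_prefix] the bound is k d + sum_(i <= k) (lam_i - d). *)
Lemma rank_cyc_tau_mx_le tau k (V : 'M[K]_(k, N)) :
  (forall i i' : 'I_delta, (i <= i')%N -> (lam i' <= lam i)%N) ->
  (\rank (cyc_mx V (e + tau_mx tau)) <= partial_sum k)%N.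
Proof.
move=> dec; case: k V => [|k] V.
  apply: leq_trans (rank_cyc_mx_le V (e + tau_mx tau) (char_poly_monic (e + tau_mx tau)) (size_char_poly _)) _.
  by rewrite peval_char_poly mxrank0 mul0n.
have [kd|dk] := ltnP k delta; last first.
  apply: leq_trans (rank_leq_col _) _; rewrite /partial_sum [X in (_ <= X)%N]big_mkcond /=.
  apply: leq_sum => i _; rewrite ifT // ltnS.
  exact: leq_trans (ltnW (ltn_ord i)) dk.
set d := lam (Ordinal kd).
apply: leq_trans (rank_cyc_mx_le V (e + tau_mx tau) (prefix_poly_monic tau d) (size_prefix_poly tau d)) _.
rewrite rank_prefix /partial_sum (bigID (fun i : 'I_delta => i < k.+1)%N) /=.
rewrite [X in (_ + (_ + X))%N]big1 ?addn0 => [|i]; last first.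
  rewrite -leqNgt => ki; apply/eqP; rewrite subn_eq0; apply: dec; exact: ltnW.
have -> : (k.+1 * d = \sum_(i < delta | i < k.+1) d)%N.
  rewrite sum_nat_const; congr (_ * _)%N.
  rewrite -sum1_card big_mkcond /=.
  rewrite -(big_mkord predT (fun i => if i < k.+1 then 1 else 0)%N).
  rewrite (big_cat_nat _ (n := k.+1)) //= [X in (_ + X)%N]big_nat_cond [X in (_ + X)%N]big1 ?addn0.
    rewrite big_nat_cond (eq_bigr (fun=> 1%N)) => [|i]; last by rewrite andbT => /andP[_ ->].
    by rewrite -big_nat_cond sum_nat_const_nat subn0 muln1.
  by move=> i; rewrite andbT => /andP[/leq_gtF->].
rewrite -big_split /=; apply: leq_sum => i ik; rewrite subnKC //.
by apply: dec; rewrite -ltnS.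
Qed.

End CyclicSpanOfJordanBasis.

(** * The Frobenius normal form *)

Lemma path_geq_nth0 d l : sorted geq l -> (nth 0%N l 0 <= d)%N -> path geq d l.
Proof. by case: l => //= a s -> ->. Qed.

Lemma nth_le_nth0 l i : sorted geq l -> (nth 0%N l i <= nth 0%N l 0)%N.
Proof.
move=> sl; have [il|li] := ltnP i (size l); last by rewrite nth_default.
have gT : transitive geq by move=> b a c ab bc; exact: leq_trans bc ab.
by apply: (sorted_leq_nth gT leqnn 0%N sl) => //; rewrite inE; apply: leq_ltn_trans il.
Qed.

Section Frobenius.
Context {K : closedFieldType}.
Hypothesis charK0 : [pchar K] =i pred0.
Variable n : nat.
Variable x : 'M[K]_n.
Implicit Types (W : 'M[K]_n) (v w : 'rV[K]_n) (p q : {poly K}).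

Lemma peval_stable W q : stablemx W x -> stablemx W (peval x q).
Proof.
move=> Wx; elim/poly_ind: q => [|q c IH]; first by rewrite peval0 mulmx0 sub0mx.
rewrite pevalD pevalM pevalX pevalC mulmxDr addmx_sub ?mul_mx_scalar ?scalemx_sub //.
by rewrite mulmxA (submx_trans (submxMr _ IH)).
Qed.

Lemma ann_sub W v q : (v <= W)%MS -> W *m peval x q = 0 -> v *m peval x q = 0.
Proof. by move=> /submxP[u ->] Wq; rewrite -mulmxA Wq mulmx0. Qed.

(** The minimal polynomial of x on W. *)
Lemma min_ann W : exists2 p, p \is monic /\ W *m peval x p = 0 &
  forall q, W *m peval x q = 0 -> p %| q.
Proof.
pose B m := `[< exists p, [/\ p \is monic, W *m peval x p = 0 & size p = m] >].
have exB : exists m, B m.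
  exists (size (char_poly x)); apply/asboolP; exists (char_poly x); split=> //.
    exact: char_poly_monic.
  by rewrite peval_char_poly mulmx0.
case: (ex_minnP exB) => m /asboolP[p [pm Wp sp]] minp.
exists p => // q Wq; rewrite /dvdp; apply/eqP/eqP; apply: contraT => r0.
have Wr : W *m peval x (q %% p) = 0.
  by move: Wq; rewrite {1}(divp_eq q p) pevalD mulrC pevalM mulmxDr mulmxA Wp mul0mx add0r.
have p0 : p != 0 by exact: monic_neq0.
have lr0 : lead_coef (q %% p) != 0 by rewrite lead_coef_eq0.
have /minp : B (size (q %% p)%R).
  apply/asboolP; exists ((lead_coef (q %% p))^-1 *: (q %% p)); split.
  - by rewrite monicE lead_coefZ mulVf.
  - by rewrite pevalZ -scalemxAr Wr scaler0.
  - by rewrite size_scale // invr_eq0.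
by rewrite -sp leqNgt ltn_modp p0.
Qed.

(** A vector is annihilated by a proper divisor of p only if it is so by some p / (X - a), with a
a root of p. The curve c |-> sum_i c^i W_i leaves each of these finitely many proper
subspaces of W for almost all c. *)
Lemma cyclic_vector W p : p \is monic -> W *m peval x p = 0 ->
  (forall q, W *m peval x q = 0 -> p %| q) ->
  exists2 v : 'rV[K]_n, (v <= W)%MS & forall q, v *m peval x q = 0 -> (size q < size p)%N -> q = 0.
Proof.
move=> pm Wp pmin; have p0 := monic_neq0 pm.
pose vc (c : K) : 'rV[K]_n := (\row_(i < n) c ^+ i) *m W.
have bad (a : K) (k : {poly K}) : p = k * ('X - a%:P) -> exists2 P : {poly K}, P != 0 &
    forall c, P.[c] != 0 -> vc c *m peval x k != 0.
  move=> pE; have k0 : k != 0 by apply: contraNneq p0 => k0; rewrite pE k0 mul0r.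
  have /matrix0Pn[i0 [j0 B0]] : W *m peval x k != 0.
    apply/negP => /eqP/pmin/dvdp_leq-/(_ k0); rewrite pE size_Mmonic ?monicXsubC //.
    by rewrite size_XsubC addn2 /= ltnn.
  pose P : {poly K} := \sum_(i < n) (W *m peval x k) i j0 *: 'X^i.
  have Pc c : P.[c] = (vc c *m peval x k) 0 j0.
    rewrite /vc -mulmxA horner_sum [RHS]mxE; apply: eq_bigr => i _.
    by rewrite hornerZ hornerXn mulrC [in RHS]mxE.
  exists P.
    apply: contraNneq B0 => P0; have := congr1 (fun R : {poly K} => R`_i0) P0.
    rewrite coef0 coef_sum (bigD1 i0) //= [X in _ + X]big1 ?addr0 => [|i ii0].
      by rewrite coefZ coefXn eqxx mulr1 => ->.
    by rewrite coefZ coefXn eq_sym (negPf (_ : i != i0 :> nat)) ?mulr0.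
  by move=> c; rewrite Pc; apply: contraNneq => ->; rewrite mxE.
have [rs pE] := closed_field_poly_normal p.
move/monicP: (pm) pE => -> pE; rewrite scale1r in pE.
have [P P0 HP] : exists2 P : {poly K}, P != 0 & forall c, P.[c] != 0 ->
    forall (a : K) (k : {poly K}), a \in rs -> p = k * ('X - a%:P) -> vc c *m peval x k != 0.
  elim: rs {pE} => [|a s [P P0 HP]]; first by exists 1; rewrite ?oner_neq0.
  have [dv|ndv] := boolP (('X - a%:P) %| p).
    have pk : p = (p %/ ('X - a%:P)) * ('X - a%:P) by rewrite divpK.
    have [Q Q0 HQ] := bad a _ pk.
    exists (P * Q); first by rewrite mulf_neq0.
    move=> c; rewrite hornerM mulf_eq0 negb_or => /andP[Pc Qc] b k.
    rewrite inE => /orP[/eqP-> pk'|bs]; last exact: HP.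
    have -> : k = p %/ ('X - a%:P) by rewrite pk' mulpK // polyXsubC_eq0.
    exact: HQ.
  exists P => // c Pc b k; rewrite inE => /orP[/eqP-> pk|bs]; last exact: HP.
  by case/negP: ndv; rewrite pk dvdp_mull.
have [c Pc] := poly_nonroot charK0 P0.
exists (vc c); first exact: submxMl.
set v := vc c; move=> q vq sq; apply: contraTeq (sq) => q0; rewrite -leqNgt.
have vp : v *m peval x p = 0 by apply: ann_sub Wp; exact: submxMl.
pose g := gcdp q p.
have vg : v *m peval x g = 0.
  have [[u1 u2] /= /eqpP[[c1 c2] /= /andP[c10 c20] E]] := Bezoutp q p.
  have : c2 *: (v *m peval x g) = 0.
    rewrite scalemxAr -pevalZ -E pevalZ pevalD (mulrC u1) (mulrC u2) !pevalM -scalemxAr mulmxDr !mulmxA.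
    by rewrite vq vp !mul0mx addr0 scaler0.
  by move/eqP; rewrite scaler_eq0 (negPf c20) => /eqP.
rewrite leqNgt; apply/negP => _.
have gp : g %| p by exact: dvdp_gcdr.
have pg : p = (p %/ g) * g by rewrite divpK.
have g0 : g != 0 by rewrite gcdp_eq0 negb_and p0 orbT.
have sk : size (p %/ g)%R != 1%N.
  apply/eqP => s1; have := congr1 (fun R : {poly K} => size R) pg.
  rewrite /= size_mul // ?s1 ?add1n /=; last by rewrite -size_poly_gt0 s1.
  move=> E; have := dvdp_leq q0 (dvdp_gcdl q p); rewrite -/g -E; by rewrite leqNgt sq.
have /closed_rootP[a /factor_theorem[k kE]] := sk.
have pk : p = (k * g) * ('X - a%:P) by rewrite {1}pg kE mulrAC.
have ar : a \in rs.
  have : root p a by rewrite pk rootM root_XsubC eqxx orbT.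
  by rewrite pE root_prod_XsubC.
have := HP c Pc a (k * g) ar pk; rewrite mulrC pevalM mulmxA -/v vg mul0mx.
by rewrite eqxx.
Qed.

Lemma prefix_span v tau d q : (size q <= d)%N ->
  (v *m peval x q <= \sum_(j < d) <<v *m peval x (prefix_poly tau j)>>)%MS.
Proof.
elim: d q => [|d IH] q; first by rewrite size_poly_leq0 => /eqP->; rewrite peval0 mulmx0 sub0mx.
move=> sq; rewrite big_ord_recr /=.
have -> : q = (q - q`_d *: prefix_poly tau d) + q`_d *: prefix_poly tau d by rewrite subrK.
rewrite pevalD mulmxDr pevalZ -scalemxAr; apply: addmx_sub; last first.
  by rewrite scalemx_sub // (submx_trans _ (addsmxSr _ _)) // genmxE.
apply: submx_trans (addsmxSl _ _); apply: IH; apply/leq_sizeP => j dj.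
rewrite coefB coefZ; have [<-|ne] := eqVneq d j.
  have /monicP := prefix_poly_monic tau d; rewrite lead_coefE size_prefix_poly /= => ->.
  by rewrite mulr1 subrr.
rewrite (nth_default 0 (_ : (size q <= j)%N)); last by lia.
by rewrite (nth_default 0 (_ : (size (prefix_poly tau d) <= j)%N)) ?mulr0 ?subrr // size_prefix_poly; lia.
Qed.

Definition cyclic_span (l : seq nat) tau (g : nat -> 'rV[K]_n) : 'M[K]_n :=
  (\sum_(i < size l) \sum_(j < nth 0%N l i) <<g i *m peval x (prefix_poly tau j)>>)%MS.

(** Choose v in W whose annihilator is the minimal polynomial p of W, of degree d, and a linear
form phi that vanishes on v x^j for j < d - 1 but not for j = d - 1. The vectors w of W with
phi (w x^j) = 0 for all j < d form a stable complement W' of the cyclic subspace of v,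
because p(x) = 0 on W. The induction hypothesis applies to W'; its first invariant factor
divides p, so the sequence tau found for W' can be continued to factor p. *)
Lemma cyclic_decomposition m W : stablemx W x -> (\rank W <= m)%N ->
  exists l, exists tau, exists g,
  [/\ sorted geq l /\ all (leq 1) l, sumn l = \rank W,
      forall i, (i < size l)%N -> g i *m peval x (prefix_poly tau (nth 0%N l i)) = 0,
      (W <= cyclic_span l tau g)%MS &
      forall q, W *m peval x q = 0 -> prefix_poly tau (nth 0%N l 0) %| q].
Proof.
elim: m W => [|m IH] W Wx.
  rewrite leqn0 mxrank_eq0 => /eqP->; exists [::], (fun=> 0), (fun=> 0); split=> //.
  - by rewrite mxrank0.
  - by rewrite sub0mx.
  - by move=> q _; rewrite /prefix_poly big_ord0 dvd1p.
move=> rW; have [W0|W0] := eqVneq W 0; first by apply: IH => //; rewrite W0 mxrank0.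
have [p [pm Wp] pmin] := min_ann W.
have p0 := monic_neq0 pm.
have [v vW vmin] := cyclic_vector pm Wp pmin.
have sp : (1 < size p)%N.
  rewrite ltnNge; apply/negP => sp; have sp1 : size p == 1%N.
    by rewrite eqn_leq sp size_poly_gt0.
  move: Wp pm; have /size_poly1P[c c0 ->] := sp1; rewrite monicE lead_coefC => + /eqP c1.
  by rewrite pevalC c1 mulmx1 => /eqP; rewrite (negPf W0).
pose d := (size p).-1; have sd : size p = d.+1 by rewrite /d prednK // ltnW.
have d0 : (0 < d)%N by rewrite -ltnS -sd.
clearbody d.
pose A : 'M[K]_(d, n) := \matrix_(j < d) (v *m x ^+ j).
have AE (q : {poly K}) : (size q <= d)%N -> v *m peval x q = (\row_(j < d) q`_j) *m A.
  move=> sq; rewrite (pevalE _ sq) mulmx_sumr mulmx_sum_row; apply: eq_bigr => j _.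
  by rewrite rowK mxE -scalemxAr.
have vp : v *m peval x p = 0 by exact: ann_sub vW Wp.
have rowP_poly (c : 'rV[K]_d) : exists2 q : {poly K}, (size q <= d)%N & c = \row_(j < d) q`_j.
  exists (rVpoly c); first exact: size_poly.
  by apply/rowP=> j; rewrite mxE coef_rVpoly_ord.
have Afree : row_free A.
  apply/inj_row_free => c; have [q sq ->] := rowP_poly c; rewrite -AE // => vq.
  by rewrite (vmin q vq) ?sd ?ltnS //; apply/rowP=> j; rewrite !mxE coef0.
have dlt : (d.-1 < d)%N by rewrite prednK.
(* phi takes the value 1 at v x^(d-1) and 0 at v x^j for j < d - 1. *)
pose phi : 'cV[K]_n := pinvmx A *m delta_mx (Ordinal dlt) 0.
have phiE q : (size q <= d)%N -> (v *m peval x q *m phi) 0 0 = q`_d.-1.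
  move=> sq; rewrite AE // /phi -mulmxA (mulmxA A) mulmxVp // mul1mx.
  rewrite mxE (bigD1 (Ordinal dlt)) //= [X in _ + X]big1 ?addr0 => [|j jd].
    by rewrite !mxE !eqxx mulr1.
  by rewrite [X in _ * X]mxE (negPf jd) mulr0.
pose Phi : 'M[K]_(n, d) := \matrix_(i, j) (x ^+ j *m phi) i 0.
have PhiE w j : (w *m Phi) 0 j = (w *m x ^+ j *m phi) 0 0.
  by rewrite -mulmxA !mxE; apply: eq_bigr => i _; rewrite mxE.
(* A Phi is a Hankel matrix with ones on the antidiagonal and zeros before it. *)
have APfree : row_free (A *m Phi).
  apply/inj_row_free => c; have [q sq ->] := rowP_poly c; rewrite mulmxA -AE // => H.
  suff -> : q = 0 by apply/rowP=> j; rewrite !mxE coef0.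
  apply/eqP; rewrite -lead_coef_eq0; apply/eqP.
  have [->|q0] := eqVneq q 0; first by rewrite lead_coef0.
  have sq0 : (0 < size q)%N by rewrite size_poly_gt0.
  have jd : (d - size q < d)%N by lia.
  have := PhiE (v *m peval x q) (Ordinal jd); rewrite H mxE => /esym.
  rewrite /= -pevalXn -[v *m _ *m _]mulmxA -pevalM phiE; last first.
    by rewrite size_mulXn // subnK.
  rewrite coefMXn lead_coefE; case: ltnP => [lt|_].
    by have := leq_sub2l d sq0; rewrite subn1 => /(leq_trans lt); rewrite ltnn.
  rewrite (_ : (_ - _)%N = (size q).-1) //.
  by move: sq0 sq; case: (size q) => // k _ kd; rewrite /= subnBA ?(ltnW kd) //; lia.
have APu : A *m Phi \in unitmx by rewrite -row_free_unit.
have AW : (A <= W)%MS.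
  apply/row_subP => j; rewrite rowK -pevalXn.
  by apply: submx_trans (peval_stable 'X^j Wx); rewrite submxMr.
pose W' := (W :&: kermx Phi)%MS.
have W'W : (W' <= W)%MS by exact: capmxSl.
have W'Phi : W' *m Phi = 0 by apply/sub_kermxP; exact: capmxSr.
have W'x : stablemx W' x.
  rewrite sub_capmx (submx_trans (submxMr _ W'W)) //=; apply/sub_kermxP.
  apply/row_matrixP=> i; rewrite -mulmxA row_mul row0.
  set w := row i W'; have wW : (w <= W)%MS by apply: submx_trans (row_sub _ _) W'W.
  have wPhi j : (w *m x ^+ j *m phi) 0 0 = 0 \/ (d <= j)%N.
    have [jd|] := ltnP j d; last by right.
    by left; rewrite -(PhiE w (Ordinal jd)) -row_mul W'Phi !mxE.
  apply/rowP=> j; rewrite mulmxA PhiE [RHS]mxE -(mulmxA w) -[x *m x ^+ j]exprS.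
  have [//|le] := wPhi j.+1.
  have jE : j.+1 = d by apply/eqP; rewrite eqn_leq le ltn_ord.
  have := ann_sub wW Wp; rewrite (pevalE _ (eq_leq sd)) big_ord_recr /= mulmxDr.
  move: (pm); rewrite monicE lead_coefE sd /= => /eqP->; rewrite scale1r jE.
  move/eqP; rewrite addrC addr_eq0 => /eqP->; rewrite mulNmx mxE mulmx_sumr mulmx_suml summxE.
  rewrite big1 ?oppr0 // => i' _; rewrite -scalemxAr -scalemxAl mxE.
  have [->|] := wPhi i'; first by rewrite mulr0.
  by rewrite leqNgt ltn_ord.
have rWE : \rank W = (d + \rank W')%N.
  rewrite -(mxrank_mul_ker W Phi); congr (_ + _)%N; apply/eqP.
  rewrite eqn_leq rank_leq_col /=; apply: (@leq_trans (\rank (A *m Phi))).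
    by rewrite (eqP APfree).
  by rewrite mxrankS // submxMr.
have [|l' [tau' [g' [[sl' pl'] suml' kill' span' min']]]] := IH W' W'x; first by lia.
have dvp : prefix_poly tau' (nth 0%N l' 0) %| p.
  by apply: min'; apply/eqP; rewrite -submx0 -Wp submxMr.
have l'd : (nth 0 l' 0 <= d)%N.
  by have := dvdp_leq p0 dvp; rewrite size_prefix_poly sd ltnS.
have [rs rsE] := closed_field_poly_normal (p %/ prefix_poly tau' (nth 0%N l' 0)).
set l0 := nth 0%N l' 0 in dvp l'd rsE.
have qm : p %/ prefix_poly tau' l0 \is monic.
  by rewrite -(monicMr _ (prefix_poly_monic tau' l0)) divpK.
move/monicP: qm rsE => -> rsE; rewrite scale1r in rsE.
(* tau' up to the first invariant factor of W', followed by the roots of the cofactor. *)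
pose tau j := if (j < l0)%N then tau' j else nth 0 rs (j - l0)%N.
have tauE j : (j <= l0)%N -> prefix_poly tau j = prefix_poly tau' j.
  move=> jl; apply: eq_bigr => i _; rewrite /tau ifT //.
  exact: leq_trans (ltn_ord i) jl.
have srs : (l0 + size rs = d)%N.
  have : size p = size ((p %/ prefix_poly tau' l0) * prefix_poly tau' l0) by rewrite divpK.
  rewrite rsE size_Mmonic ?prefix_poly_monic ?monic_neq0 ?monic_prod_XsubC //.
  by rewrite size_prod_XsubC size_prefix_poly sd addSn addnS /= => -[->]; exact: addnC.
have pE : prefix_poly tau d = p.
  rewrite -[RHS](divpK dvp) rsE -srs /prefix_poly.
  rewrite big_split_ord /= mulrC; congr (_ * _).
    rewrite (big_nth 0) big_mkord; apply: eq_bigr => i _.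
    by rewrite /tau ltnNge leq_addr /= addKn.
  by apply: eq_bigr => i _; rewrite /tau ltn_ord.
exists (d :: l'), tau, (fun i => if i is i'.+1 then g' i' else v); split.
- by split; [exact: path_geq_nth0|rewrite /= d0 pl'].
- by rewrite /= suml' rWE.
- case=> [|i] /=; first by rewrite pE.
  by rewrite ltnS => il; rewrite tauE ?kill' // nth_le_nth0.
- rewrite /cyclic_span [size _]/= big_ord_recl /=.
  set B := W *m Phi *m invmx (A *m Phi) *m A.
  have -> : W = B + (W - B) by rewrite addrC subrK.
  apply: addmx_sub.
    apply: submx_trans (addsmxSl _ _); apply: submx_trans (submxMl _ _) _.
    apply/row_subP => j; rewrite rowK -pevalXn; apply: prefix_span.
    by rewrite size_polyXn.
  apply: submx_trans (addsmxSr _ _); apply: (submx_trans (B := W')).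
    rewrite sub_capmx addmx_sub ?eqmx_opp ?(submx_trans (submxMl _ _)) //=.
    apply/sub_kermxP; rewrite mulmxBl /B -[_ *m A *m Phi]mulmxA.
    by rewrite mulmxKV // subrr.
  apply: submx_trans span' _; apply/sumsmx_subP => i _; apply: (sumsmx_sup i) => //.
  apply/sumsmx_subP => j _; apply: (sumsmx_sup j) => //=.
  rewrite tauE //; apply: leq_trans (ltnW (ltn_ord j)) _; exact: nth_le_nth0.
by move=> q Wq; rewrite /= pE; exact: pmin.
Qed.

End Frobenius.

(** * Semicontinuity and the type of a matrix *)

Section Orbits.
Context {K : fieldType} {n : nat}.
Implicit Types x y z : 'M[K]_n.

Lemma Gorbit_sym x y : Gorbit x y -> Gorbit y x.
Proof.
move=> /GorbitP[g gU ->]; apply/GorbitP; exists (invmx g); first by rewrite unitmx_inv.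
by rewrite invmxK !mulmxA mulVmx // mul1mx mulmxKV.
Qed.

Lemma Gorbit_trans x y z : Gorbit x y -> Gorbit y z -> Gorbit x z.
Proof.
move=> /GorbitP[g gU ->] /GorbitP[k kU ->]; apply/GorbitP.
by exists (k *m g); rewrite ?unitmx_mul ?kU // invmxM // !mulmxA.
Qed.

Lemma Gorbit_eq x y : Gorbit x y -> Gorbit x = Gorbit y.
Proof.
move=> xy; apply/seteqP; split=> z; last exact: Gorbit_trans.
exact: Gorbit_trans (Gorbit_sym xy).
Qed.

Lemma GsatP (Y : set 'M[K]_n) z : Gsat Y z <-> exists2 y, Y y & Gorbit y z.
Proof.
split=> [[g gU [y Yy ->]]|[y Yy /GorbitP[g gU ->]]].
  by exists y => //; apply/GorbitP; exists g.
by exists g => //; exists y.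
Qed.

Hypothesis charK0 : [pchar K] =i pred0.

Lemma rank_ad_Gorbit x y : Gorbit x y -> \rank (ad_mx x) = \rank (ad_mx y).
Proof.
move=> xy; apply: has_dim_unique (has_dim_Gorbit charK0 x) _.
by rewrite (Gorbit_eq xy); exact: has_dim_Gorbit.
Qed.

(** Q is a minor of cyc_mx V y, after the constant matrices B and C of [rank_factor] have turned
the matrix at x0 into an identity matrix of the size of its rank. *)
Lemma rank_cyc_open k (V : 'M[K]_(k, n)) x0 : exists Q : {mpoly K[n * n]},
  evalm x0 Q != 0 /\
  forall y, evalm y Q != 0 -> (\rank (cyc_mx V x0) <= \rank (cyc_mx V y))%N.
Proof.
have [B [C [BC _]]] := rank_factor (cyc_mx V x0).
set r := \rank (cyc_mx V x0) in B C BC *.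
pose Yg : 'M[{mpoly K[n * n]}]_n := \matrix_(i, j) 'X_(mxvec_index i j).
pose cg : 'M[{mpoly K[n * n]}]_(\sum_(j < n) k, n) :=
  \mxcol_(j < n) (map_mx (@mpolyC _ K) V *m Yg ^+ j).
pose Q := \det (map_mx (@mpolyC _ K) B *m cg *m map_mx (@mpolyC _ K) C).
pose ev y : {rmorphism {mpoly K[n * n]} -> K} := meval (fun i => mxvec y 0 i).
have evC y a b (M : 'M[K]_(a, b)) : map_mx (ev y) (map_mx (@mpolyC _ K) M) = M.
  by apply/matrixP=> i j; rewrite !mxE; exact: mevalC.
have evY y : map_mx (ev y) Yg = y.
  by apply/matrixP=> i j; rewrite !mxE /ev /= mevalXU mxvecE.
have evX y j : map_mx (ev y) (Yg ^+ j) = y ^+ j.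
  elim: j => [|j IH]; first by rewrite map_mx1.
  by rewrite !exprS map_mxM IH evY.
have evQ y : evalm y Q = \det (B *m cyc_mx V y *m C).
  transitivity (ev y Q); first by [].
  rewrite /Q -det_map_mx !map_mxM !evC; congr (\det (_ *m _ *m _)).
  apply/matrixP=> i j; rewrite [LHS]mxE [in LHS]mxE [RHS]mxE.
  by rewrite -(evX y) -{2}(evC y _ _ V) -map_mxM [RHS]mxE.
exists Q; split; first by rewrite evQ BC det1 oner_neq0.
move=> y; rewrite evQ -unitfE -unitmxE => /mxrank_unit <-.
by apply: leq_trans (mxrankM_maxl _ _) _; exact: mxrankM_maxr.
Qed.

Definition nonvanishing (S : set 'M[K]_n) (Q : {mpoly K[n * n]}) :=
  exists2 y, S y & evalm y Q != 0.

(** Two nonempty open subsets of an irreducible set meet. *)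
Lemma nonvanishingM S Q1 Q2 : irreducible S ->
  nonvanishing S Q1 -> nonvanishing S Q2 -> nonvanishing S (Q1 * Q2).
Proof.
move=> [_ irrS] [y1 S1 n1] [y2 S2 n2]; apply: contrapT => H.
pose Z (Q : {mpoly K[n * n]}) : set 'M[K]_n := [set x | evalm x Q = 0].
have cZ Q : zariski_closed (Z Q).
  exists [set Q]; apply/seteqP; split=> [x Zx P -> //|x]; exact.
have [|ZS|ZS] := irrS (Z Q1) (Z Q2) (cZ _) (cZ _).
- move=> y Sy; apply: contrapT => /not_orP[z1 z2]; apply: H; exists y => //.
  by rewrite /evalm mevalM mulf_neq0 //; apply/eqP.
- by move: n1; rewrite (ZS _ S1) eqxx.
- by move: n2; rewrite (ZS _ S2) eqxx.
Qed.

Lemma nonvanishing_prod S m (Q : 'I_m -> {mpoly K[n * n]}) : irreducible S ->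
  (forall k, nonvanishing S (Q k)) -> nonvanishing S (\prod_k Q k).
Proof.
move=> irrS H; elim/big_ind: _ => [||k _]; last exact: H.
  by have [[y Sy] _] := irrS; exists y => //; rewrite /evalm meval1 oner_neq0.
by move=> Q1 Q2; exact: nonvanishingM.
Qed.

Lemma evalm_prod_neq0 m (Q : 'I_m -> {mpoly K[n * n]}) y :
  evalm y (\prod_k Q k) != 0 -> forall k, evalm y (Q k) != 0.
Proof. by rewrite /evalm rmorph_prod => /prodf_neq0 H k; exact: H. Qed.

End Orbits.

Section PartitionSums.

Section OnePartition.
Variables (delta : nat) (nu : 'I_delta -> nat).

(** A finite sequence continued by zeros, so that partitions of different lengths can be compared. *)
Definition pad0 i := if insub i is Some i' then nu i' else 0%N.

Lemma pad0_ord (i : 'I_delta) : pad0 i = nu i.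
Proof. by rewrite /pad0 valK. Qed.

Lemma pad0_out i : (delta <= i)%N -> pad0 i = 0%N.
Proof. by move=> di; rewrite /pad0 insubN // -leqNgt. Qed.

Lemma sum_pad0 (F : nat -> nat) M : F 0%N = 0%N -> (delta <= M)%N ->
  (\sum_(i < M) F (pad0 i) = \sum_i F (nu i))%N.
Proof.
move=> F0 dM; rewrite -(big_mkord predT (fun i => F (pad0 i))) (big_cat_nat _ (n := delta)) //=.
rewrite [X in (_ + X)%N]big_nat_cond [X in (_ + X)%N]big1 ?addn0 => [|i]; last first.
  by rewrite andbT => /andP[di _]; rewrite pad0_out.
by rewrite big_mkord; apply: eq_bigr => i _; rewrite pad0_ord.
Qed.

Lemma partial_sum_pad0 k : partial_sum nu k = (\sum_(i < k) pad0 i)%N.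
Proof.
pose M := maxn delta k.
transitivity (\sum_(0 <= i < M | i < k) pad0 i)%N; last first.
  by rewrite -(big_mkord predT pad0) [RHS](big_nat_widen _ k M) // leq_maxr.
rewrite (big_cat_nat _ (n := delta)) ?leq_maxl //=.
rewrite [X in (_ + X)%N]big_nat_cond [X in (_ + X)%N]big1 ?addn0 => [|i]; last first.
  by move=> /andP[/andP[di _] _]; rewrite pad0_out.
by rewrite big_mkord; apply: eq_bigr => i _; rewrite pad0_ord.
Qed.

Lemma partial_sumS k : partial_sum nu k.+1 = (partial_sum nu k + pad0 k)%N.
Proof. by rewrite !partial_sum_pad0 big_ord_recr. Qed.

Hypothesis dec : forall i i' : 'I_delta, (i <= i')%N -> (nu i' <= nu i)%N.

Lemma pad0_dec i j : (i <= j)%N -> (pad0 j <= pad0 i)%N.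
Proof.
move=> ij; have [dj|jd] := leqP delta j; first by rewrite (pad0_out dj).
have id_ := leq_ltn_trans ij jd.
by rewrite (pad0_ord (Ordinal jd)) (pad0_ord (Ordinal id_)) dec.
Qed.

Lemma sum_min_pad0 M :
  (\sum_(i < M) \sum_(j < M) minn (pad0 i) (pad0 j)
   + 2 * \sum_(k < M.+1) partial_sum nu k = (2 * M).+1 * partial_sum nu M)%N.
Proof.
elim: M => [|M IH].
  by rewrite big_ord0 big_ord_recr big_ord0 /= partial_sum_pad0 big_ord0.
have minE (i : 'I_M) : minn (pad0 i) (pad0 M) = pad0 M by apply/minn_idPr/pad0_dec/ltnW.
rewrite big_ord_recr /= (eq_bigr (fun i : 'I_M => \sum_(j < M) minn (pad0 i) (pad0 j) + pad0 M)%N).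
  rewrite big_split sum_nat_const card_ord big_ord_recr /= minnn.
  rewrite [X in (_ + (X + _) + _)%N](eq_bigr (fun=> pad0 M)) => [|i _]; last by rewrite minnC minE.
  rewrite sum_nat_const card_ord (big_ord_recr M.+1) /= !partial_sumS; move: IH.
  move: (\sum_(i < M) _)%N (\sum_(i < M.+1) _)%N (partial_sum nu M) (pad0 M) => a b c d.
  lia.
by move=> i _; rewrite big_ord_recr /= minE.
Qed.

(** For a nonincreasing sequence both sides grow by the same amount when a term is added. So the
sum of the min (nu_i, nu_j) is determined by the sum of all partial sums. *)
Lemma sum_min M : (delta <= M)%N ->
  (\sum_i \sum_j minn (nu i) (nu j) + 2 * \sum_(k < M.+1) partial_sum nu k
   = (2 * M).+1 * \sum_i nu i)%N.
Proof.
move=> dM; have := sum_min_pad0 M; rewrite partial_sum_pad0 (sum_pad0 (F := id)) // => <-; congr (_ + _)%N.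
rewrite -(sum_pad0 (F := fun a => \sum_j minn a (nu j)) _ dM); last first.
  by rewrite big1 // => j _; rewrite min0n.
apply: eq_bigr => i _; by rewrite -(sum_pad0 (F := fun a => minn (pad0 i) a) _ dM) ?minn0.
Qed.

End OnePartition.

Lemma partition_size_le delta (nu : 'I_delta -> nat) : (forall i, 0 < nu i)%N ->
  (delta <= \sum_i nu i)%N.
Proof.
by move=> pos; rewrite -[X in (X <= _)%N]card_ord -sum1_card; apply: leq_sum => i _.
Qed.

Lemma pad0_eq delta delta' (nu : 'I_delta -> nat) (nu' : 'I_delta' -> nat) :
  (forall i, 0 < nu i)%N -> (forall i, 0 < nu' i)%N -> pad0 nu =1 pad0 nu' ->
  exists E : delta = delta', nu = (fun i => nu' (cast_ord E i)).
Proof.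
have W d d' (mu : 'I_d -> nat) (mu' : 'I_d' -> nat) : (forall i, 0 < mu' i)%N ->
    pad0 mu =1 pad0 mu' -> (d' <= d)%N.
  move=> pos H; rewrite leqNgt; apply/negP => dd'.
  have := H d; rewrite pad0_out // -[X in pad0 mu' X]/(val (Ordinal dd')) pad0_ord => E.
  by have := pos (Ordinal dd'); rewrite -E.
move=> pos pos' H; have E : delta = delta'.
  apply/eqP; rewrite eqn_leq (W _ _ _ _ pos' H) andbT.
  by apply: (W _ _ nu' nu) => // i; rewrite H.
exists E; apply/funext => i; rewrite -pad0_ord H.
by rewrite -[X in pad0 nu' X]/(val (cast_ord E i)) pad0_ord.
Qed.

End PartitionSums.

Section FrobeniusForm.
Context {K : closedFieldType}.
Hypothesis charK0 : [pchar K] =i pred0.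

(** The rows g_i P_j(x) form an invertible matrix G, since they span, and G x = (e + t) G is the
recursion defining the P_j. *)
Lemma cyclic_basis_Gorbit n (x : 'M[K]_n) delta (nu : 'I_delta -> nat)
    (E : (\sum_i nu i)%N = n) tau (g : 'I_delta -> 'rV[K]_n) :
  (forall i, g i *m peval x (prefix_poly tau (nu i)) = 0) ->
  (1%:M <= \sum_i \sum_(j < nu i) <<g i *m peval x (prefix_poly tau j)>>)%MS ->
  Gorbit (castmx (E, E) (e_mx nu + tau_mx tau)) x.
Proof.
case: _ / E x g => x g kill span; rewrite castmx_id.
pose G := \matrix_(p < (\sum_i nu i)%N) (g (blk p) *m peval x (prefix_poly tau (pos p).-1)).
have GU : G \in unitmx.
  rewrite -row_full_unit -sub1mx (submx_trans span) //.
  apply/sumsmx_subP => i _; apply/sumsmx_subP => j _; rewrite genmxE.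
  apply: (eq_row_sub (tagnat.Rank i j)); by rewrite rowK blk_Rank pos_Rank.
have Gx : G *m x = (e_mx nu + tau_mx tau) *m G.
  apply/row_matrixP=> p; rewrite row_mul rowK.
  have -> : g (blk p) *m peval x (prefix_poly tau (pos p).-1) *m x =
      g (blk p) *m peval x (prefix_poly tau (pos p)) + tau (pos p).-1 *: row p G.
    rewrite -{2}(prednK (pos_gt0 p)) peval_prefix_polyS rowK mulmxA mulmxBr mul_mx_scalar.
    by rewrite subrK.
  rewrite mulmxDl [RHS]linearD /=; congr (_ + _); last first.
    by apply/rowP=> q; rewrite mxE [in RHS]mxE tau_mx_mul [in LHS]mxE.
  case: (idx_succP p) => [p' b s | pl].
    apply/rowP=> q; rewrite [RHS]mxE (e_mul _ _ b s).
    by rewrite [RHS]mxE b s.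
  rewrite pl kill; apply/rowP=> q; by rewrite mxE [RHS]mxE e_mul_last.
apply/GorbitP; exists (invmx G); first by rewrite unitmx_inv.
by rewrite invmxK -mulmxA -Gx mulKmx.
Qed.

Lemma frobenius_form n (x : 'M[K]_n) : exists delta, exists nu : 'I_delta -> nat,
  exists E : (\sum_i nu i)%N = n, exists tau,
  is_partition nu /\ Gorbit (castmx (E, E) (e_mx nu + tau_mx tau)) x.
Proof.
have [|l [tau [g [[sl pl] suml kill span _]]]] := @cyclic_decomposition K charK0 n x n 1%:M _ (rank_leq_row _).
  by rewrite mul1mx submx1.
pose nu (i : 'I_(size l)) := nth 0%N l i.
have E : (\sum_i nu i)%N = n.
  by rewrite -[RHS](mxrank1 K) -suml sumnE (big_nth 0%N) big_mkord.
exists (size l), nu, E, tau; split; last first.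
  by apply: (@cyclic_basis_Gorbit _ _ _ nu E tau (fun i => g i)) => // i; exact: kill.
split=> [i|i i' ii']; first by apply: (allP pl); exact: mem_nth.
have gT : transitive geq by move=> b a c ab bc; exact: leq_trans bc ab.
by apply: (sorted_leq_nth gT leqnn 0%N sl); rewrite ?inE.
Qed.

(** The rank of ad x and the ranks of the matrices cyc_mx V x, computed on the normal form. *)
Lemma frobenius_invariants n (x : 'M[K]_n) delta (nu : 'I_delta -> nat)
    (E : (\sum_i nu i)%N = n) tau : is_partition nu ->
  Gorbit (castmx (E, E) (e_mx nu + tau_mx tau)) x ->
  [/\ (\rank (ad_mx x) + \sum_i \sum_j minn (nu i) (nu j) = n * n)%N,
      forall k, exists V : 'M[K]_(k, n), (partial_sum nu k <= \rank (cyc_mx V x))%N &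
      forall k (V : 'M[K]_(k, n)), (\rank (cyc_mx V x) <= partial_sum nu k)%N].
Proof.
case: _ / E x => x [_ dec]; rewrite castmx_id => xO; split.
- by rewrite -(rank_ad_Gorbit charK0 xO) rank_ad_tau_mx.
- move=> k; have [V HV] := @rank_cyc_tau_mx_ge K delta nu tau k.
  have /GorbitP[g gU ->] := xO; exists (V *m invmx g).
  by rewrite rank_cyc_mx_conj // mulmxKV.
- move=> k V; have /GorbitP[g gU ->] := xO.
  by rewrite rank_cyc_mx_conj //; exact: rank_cyc_tau_mx_le.
Qed.

End FrobeniusForm.

(** * The sheet of e, and the proposition *)

Section Sheet.
Context {K : closedFieldType} (charK0 : [pchar K] =i pred0).
Context {delta : nat} (lam : 'I_delta -> nat) (lamP : is_partition lam).
Local Notation N := (\sum_(i < delta) lam i)%N.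
Local Notation e := (e_mx lam : 'M[K]_N).

Definition e_plus_t : set 'M[K]_N := [set e + t | t in @t_space K delta lam].

Lemma e_plus_t_line a b c : e_plus_t a -> e_plus_t b -> e_plus_t (a + c *: (b - a)).
Proof.
move=> [_ /t_space_tau_mx[tau ->] <-] [_ /t_space_tau_mx[tau' ->] <-].
exists (tau_mx (fun j => tau j + c * (tau' j - tau j))); first exact: tau_mx_t_space.
rewrite opprD addrACA subrr add0r -addrA; congr (_ + _).
apply/matrixP=> p q; rewrite !mxE; case: eqP => _; rewrite ?mulr1n // !mulr0n.
by rewrite subrr mulr0 addr0.
Qed.

Lemma e_plus_t_e : e_plus_t e.
Proof.
exists (tau_mx (fun=> 0)); first exact: tau_mx_t_space.
by rewrite (_ : tau_mx _ = 0) ?addr0 //; apply/matrixP=> p q; rewrite !mxE mul0rn.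
Qed.

Lemma e_plus_t_invariants x : Gsat e_plus_t x ->
  [/\ (\rank (ad_mx x) + \sum_i \sum_j minn (lam i) (lam j) = N * N)%N,
      forall k, exists V : 'M[K]_(k, N), (partial_sum lam k <= \rank (cyc_mx V x))%N &
      forall k (V : 'M[K]_(k, N)), (\rank (cyc_mx V x) <= partial_sum lam k)%N].
Proof.
move=> /GsatP[_ [_ /t_space_tau_mx[tau ->] <-] xO].
exact: (@frobenius_invariants _ charK0 N x delta lam erefl tau lamP).
Qed.

(** The three steps are: G.(e + t) has constant orbit dimension m; it is irreducible; every x in S
is of type lam. The maximality of S does the rest. *)
Lemma sheet_eq S : is_Gsheet S -> S e -> S = Gsat e_plus_t.
Proof.
move=> [m [SY irrS maxS]] Se.
have inGe : Gsat e_plus_t e.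
  apply/GsatP; exists e; first exact: e_plus_t_e.
  by exists 1%:M; rewrite ?unitmx1 //; exists e; rewrite // invmx1 mul1mx mulmx1.
have rankS x : S x -> \rank (ad_mx x) = m.
  by move=> /SY Yx; exact: has_dim_unique (has_dim_Gorbit charK0 x) Yx.
have [re geE leE] := e_plus_t_invariants inGe.
have me : \rank (ad_mx e) = m by exact: rankS.
apply/esym/maxS.
- move=> x xG /=; have [rx _ _] := e_plus_t_invariants xG.
  have <- : \rank (ad_mx x) = m by rewrite -me; lia.
  exact: has_dim_Gorbit.
- by apply: irreducible_Gsat => //; [exists e; exact: e_plus_t_e|exact: e_plus_t_line].
move=> x Sx; have [d [nu [E [tau [nuP xO]]]]] := frobenius_form charK0 x.
have [rx geX leX] := frobenius_invariants charK0 nuP xO.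
(* Multiplying these Q_k gives a point y of S at which all the ranks are at least those at e and at x. *)
have Qk k : {Q : {mpoly K[N * N]} | nonvanishing S Q /\ forall y, evalm y Q != 0 ->
   forall d' (mu : 'I_d' -> nat), (forall V : 'M[K]_(k, N), \rank (cyc_mx V y) <= partial_sum mu k)%N ->
     (partial_sum lam k <= partial_sum mu k)%N /\ (partial_sum nu k <= partial_sum mu k)%N}.
  apply: cid; have [V1 H1] := geE k; have [V2 H2] := geX k.
  have [Q1 [Q1e Q1P]] := rank_cyc_open V1 e.
  have [Q2 [Q2x Q2P]] := rank_cyc_open V2 x.
  exists (Q1 * Q2); split; first by apply: nonvanishingM => //; [exists e|exists x].
  move=> y; rewrite /evalm mevalM mulf_eq0 negb_or => /andP[y1 y2] d' mu H.
  split; first exact: leq_trans H1 (leq_trans (Q1P y y1) (H V1)).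
  exact: leq_trans H2 (leq_trans (Q2P y y2) (H V2)).
have [y Sy yQ] : nonvanishing S (\prod_(k < N.+1) sval (Qk k)).
  by apply: nonvanishing_prod => // k; case: (Qk k) => Q [].
have [d' [mu [E' [tau' [muP yO]]]]] := frobenius_form charK0 y.
have [ry _ leY] := frobenius_invariants charK0 muP yO.
have domk k : (k < N.+1)%N ->
    (partial_sum lam k <= partial_sum mu k)%N /\ (partial_sum nu k <= partial_sum mu k)%N.
  move=> kN; have := evalm_prod_neq0 yQ (Ordinal kN).
  by case: (Qk _) => Q /= [_ HQ] yk; apply: HQ yk _ _ _ => V; exact: leY.
have size_le d1 (a : 'I_d1 -> nat) : is_partition a -> (\sum_i a i)%N = N -> (d1 <= N)%N.
  by move=> [a0 _] <-; exact: partition_size_le.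
have sumE d1 (a : 'I_d1 -> nat) z : is_partition a -> (\sum_i a i)%N = N -> S z ->
   (\rank (ad_mx z) + \sum_i \sum_j minn (a i) (a j) = N * N)%N ->
   (m + (2 * N).+1 * N = N * N + 2 * \sum_(k < N.+1) partial_sum a k)%N.
  move=> aP aN Sz; rewrite (rankS z Sz); have := sum_min (proj2 aP) (size_le _ _ aP aN).
  rewrite aN; lia.
have lamN := sumE _ lam e lamP erefl Se re.
have nuN := sumE _ nu x nuP E Sx rx.
have muN := sumE _ mu y muP E' Sy ry.
have partial_sum_eq (a : nat -> nat) : (forall k, (k < N.+1)%N -> (a k <= partial_sum mu k)%N) ->
   (\sum_(k < N.+1) a k = \sum_(k < N.+1) partial_sum mu k)%N ->
   forall k, (k < N.+1)%N -> a k = partial_sum mu k.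
  move=> le sE k kN; apply/eqP; have := leqif_sum (P := predT) (E1 := fun k : 'I_N.+1 => a k)
     (E2 := fun k : 'I_N.+1 => partial_sum mu k) (fun i _ => leqif_eq (le i (ltn_ord i))).
  by move=> /eq_leqif/esym; rewrite sE eqxx => /forall_inP/(_ (Ordinal kN) isT).
have lamnu k : (k < N.+1)%N -> partial_sum lam k = partial_sum nu k.
  move=> kN; rewrite (partial_sum_eq (partial_sum lam)) ?(partial_sum_eq (partial_sum nu)) //.
  - by move=> k' /domk[].
  - lia.
  - by move=> k' /domk[].
  - lia.
have lamsize := size_le _ lam lamP erefl; have nusize := size_le _ nu nuP E.
have extE : pad0 lam =1 pad0 nu.
  move=> k; have [kN|Nk] := ltnP k N.
    have := lamnu k.+1 kN; rewrite !partial_sumS lamnu; last exact: ltnW.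
    by move=> /addnI.
  by rewrite !pad0_out // ?(leq_trans lamsize) ?(leq_trans nusize).
have [Ed nuE] := pad0_eq (proj1 nuP) (proj1 lamP) (fun k => esym (extE k)).
subst d; have {}nuE : nu = lam by rewrite nuE; apply/funext => i; rewrite cast_ord_id.
subst nu; rewrite (eq_irrelevance E erefl) castmx_id in xO.
by apply/GsatP; exists (e + tau_mx tau) => //; exists (tau_mx tau) => //; exact: tau_mx_t_space.
Qed.

End Sheet.

Theorem proposition3p2p6
  (K : closedFieldType) (charK0 : [pchar K] =i pred0)
  (delta : nat) (lam : 'I_delta -> nat) (lamP : is_partition lam)
  (Phi : 'I_delta -> side)
  (S_G : set 'M[K]_(\sum_(i < delta) lam i))
  (S_G_sheet : is_Gsheet S_G) (S_G_e : S_G (e_mx lam)) :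
  [/\ forall t : 'M[K]_(\sum_(i < delta) lam i), t_space t ->
        (forall c i, mult t i c = mult t i (- c)) ->
        e_plus_Xp S_G Phi (varepsilon (e_mx lam + t)),
      forall t : 'M[K]_(\sum_(i < delta) lam i), t_space t ->
        (Gorbit (e_mx lam + t) `&` p_space Phi !=set0 <->
         forall c i, mult t i c = mult t i (- c)) &
      Gsat (S_G `&` p_space Phi) = Gsat (e_plus_Xp S_G Phi)].
Proof.
have SE := sheet_eq charK0 lamP S_G_sheet S_G_e.
have part1 t : t_space t -> (forall c i, mult t i c = mult t i (- c)) ->
    e_plus_Xp S_G Phi (varepsilon (e_mx lam + t)).
  move=> tT sym; have [O sl ps] := varepsilon_p charK0 Phi tT sym.
  exists (varepsilon (e_mx lam + t) - e_mx lam); last by rewrite addrC subrK.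
  split=> //; rewrite /X_space /= [e_mx lam + _]addrC subrK; split=> //.
  by rewrite SE; apply/GsatP; exists (e_mx lam + t) => //; exists t.
have e_plus_Xp_sub y : e_plus_Xp S_G Phi y -> (S_G `&` p_space Phi) y.
  move=> [x [[Sx _] px] <-]; split=> //.
  by apply: p_spaceD => //; exact: p_space_e.
split=> //.
- move=> t tT; split=> [[y [yO py]]|sym]; first by move=> c i; apply: p_orbit_mult tT yO py c i.
  have [O _ _] := varepsilon_p charK0 Phi tT sym.
  by exists (varepsilon (e_mx lam + t)); split=> //; case: (e_plus_Xp_sub _ (part1 t tT sym)).
apply/seteqP; split=> z /GsatP[y yP yz]; last first.
  by apply/GsatP; exists y => //; exact: e_plus_Xp_sub.
case: yP => Sy py.
have /GsatP[_ [t tT <-] ty] : Gsat (@e_plus_t K delta lam) y by rewrite -SE.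
have sym c i : mult t i c = mult t i (- c) by apply: p_orbit_mult tT ty py c i.
have [O _ _] := varepsilon_p charK0 Phi tT sym.
apply/GsatP; exists (varepsilon (e_mx lam + t)); first exact: part1.
exact: Gorbit_trans (Gorbit_sym O) (Gorbit_trans ty yz).
Qed.
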